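(* The field of rational invariants of $\mathbb{H}^4(\mathbb{R}^3)$ is generated by the following six algebraically independent rational functions of $H\in\mathbb{H}^4(\mathbb{R}^3)$: $$i_2=\frac{\|w_7\|^2}{M_{12}},\qquad i_3=\frac{\langle *^3w_7,T_6\rangle}{M_{12}^2},\qquad i_4=\frac{\langle *^4w_7,T_6\cdot T_6\rangle}{M_{12}^3},$$ $$k_4=\frac{1}{5M_{12}^3}\langle H*( *^3w_7),\,T_6*(T_6\overset{(1)}{\underset{s}{\cdot}}T_6)'\rangle+\frac{1}{7M_{12}^3}\langle H\times( *^3w_7),J_{18}\rangle-\frac{7}{99M_{12}^2}\langle H:( *^3w_7),T_6\rangle,$$ $$k_8=\frac{\langle w_7\times H,T_6\cdot T_6\rangle\,\langle *^6w_7,J_{18}\rangle}{M_{12}^6},$$ $$k_9=\frac{\langle *^6w_7,J_{18}\rangle}{M_{12}^5}\left(\frac{36}{M_{12}^2}\langle( *^2w_7)*H,J_{18}\rangle+\frac{28}{5M_{12}}\langle(H\cdot w_7)\times w_7,T_6\rangle\right),$$ where $$T_6:=d_2^2\times d_2,\qquad M_{12}:=\|d_2^2\times d_2\|^2,\qquad w_7:=H\,\vdots\,T_6,\qquad J_{18}:=(T_6\overset{(1)}{\underset{s}{\cdot}}T_6)'\times T_6,$$ and $d_2:=\operatorname{tr}_{13}H^2$.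
   Context: $\mathbb{H}^4(\mathbb{R}^3)$ is the real vector space of harmonic (totally symmetric and traceless) fourth-order tensors on $\mathbb{R}^3$, with components taken in an orthonormal basis (repeated indices summed). The rotation group $\mathrm{SO}(3,\mathbb{R})$ acts by $(g\star H)_{ijkl}=g_{ip}g_{jq}g_{kr}g_{ls}H_{pqrs}$. The field of rational invariants $\mathbb{R}(\mathbb{H}^4)^{\mathrm{SO}(3,\mathbb{R})}$ is the field of real rational functions on $\mathbb{H}^4(\mathbb{R}^3)$ invariant under this action; a finite set of rational invariants generates it if every rational invariant is a rational expression (with real coefficients) in the elements of the set. Tensor operations. $(H^2)_{ijkl}=H_{ijpq}H_{pqkl}$ and $(\operatorname{tr}_{13}T)_{ij}=T_{kikj}$; $d_2^2$ is the matrix square. $T^s$ denotes the total symmetrization of a tensor $T$ (average over all permutations of indices). $S^1\odot S^2:=(S^1\otimes S^2)^s$. The $r$-contraction of $T^1,T^2$ contracts the last $r$ indices of $T^1$ with the first $r$ indices of $T^2$, in order: $T^1_{i_1\dots i_{n_1-r}k_1\dots k_r}T^2_{k_1\dots k_rj_{r+1}\dots j_{n_2}}$; it is written $\cdot$, $:$, $\vdots$ for $r=1,2,3$. The symmetric $r$-contraction $S^1\overset{(r)}{\underset{s}{\cdot}}S^2$ is the total symmetrization of the $r$-contraction. The generalized cross product of totally symmetric tensors $S^1,S^2$ of orders $n_1,n_2$ is $S^1\times S^2:=(S^2\cdot\varepsilon\cdot S^1)^s$, totally symmetric of order $n_1+n_2-1$, $\varepsilon$ being the Levi-Civita tensor;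 in terms of the associated homogeneous polynomials $p_i(x)=S^i(x,\dots,x)$ it corresponds to $\frac{1}{n_1n_2}\det(x,\nabla p_1,\nabla p_2)$. For totally symmetric $S$ of order $n$, $S'$ denotes its leading harmonic part, i.e. the component of order $n$ in its harmonic decomposition (the unique harmonic tensor of order $n$ with $S-S'=q\odot R$ for some totally symmetric $R$, where $q_{ij}=\delta_{ij}$). The harmonic product of harmonic tensors is $H^1*H^2:=(H^1\odot H^2)'$, and $*^kw$ is the harmonic product of $k$ copies of $w$. $\langle\cdot,\cdot\rangle$ is the full contraction of two tensors of the same order and $\|\cdot\|$ the associated norm. Thus $T_6$ has order 3, $w_7$ order 1 and $J_{18}$ order 6. *)

(* Defs.v *)
From HB Require Import structures.
From mathcomp Require Import all_boot all_order all_algebra perm generic_quotient.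
From mathcomp Require Import reals.
From mathcomp Require Import mpoly.

Set Implicit Arguments.
Unset Strict Implicit.
Unset Printing Implicit Defensive.

Import GRing.Theory.
Local Open Scope ring_scope.

(* An order-n tensor on F^3 is the family of its components in an orthonormal *)
(* basis.  The scalars are an arbitrary field because the tensor operations   *)
(* are used over R and over the field of rational functions on H^4(R^3).      *)
Definition tensor (F : fieldType) (n : nat) := {ffun n.-tuple 'I_3 -> F^o}.

Section Tensors.
Variable F : fieldType.
Local Notation tensor := (tensor F).
Implicit Types m n r : nat.

(* The component of T whose list of indices is s; it is only meant for        *)
(* size s = n, and the value ord0 in nth is never used below.                 *)
Definition entry n (T : tensor n) (s : seq 'I_3) : F :=
  T [tuple nth ord0 s i | i < n].

Definition permute n (s : 'S_n) (T : tensor n) : tensor n :=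
  [ffun t => T [tuple tnth t (s i) | i < n]].

Definition sym n (T : tensor n) : tensor n :=
  [ffun t => (n`!%:R)^-1 * \sum_(s : 'S_n) (permute s T t : F)].

Definition inner n (S T : tensor n) : F := \sum_t (S t : F) * (T t : F).

Definition sqnorm n (T : tensor n) : F := inner T T.

Definition tprod m n (S : tensor m) (T : tensor n) : tensor (m + n) :=
  [ffun t : (m + n).-tuple 'I_3 => entry S (take m t) * entry T (drop m t)].

Definition symprod m n (S : tensor m) (T : tensor n) : tensor (m + n) :=
  sym (tprod S T).

Definition contr r m n (S : tensor m) (T : tensor n) :
    tensor ((m - r) + (n - r)) :=
  [ffun t : ((m - r) + (n - r)).-tuple 'I_3 => \sum_(k : r.-tuple 'I_3)
     entry S (take (m - r) t ++ k) * entry T (k ++ drop (m - r) t)].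

Definition symcontr r m n (S : tensor m) (T : tensor n) :
    tensor ((m - r) + (n - r)) :=
  sym (contr r S T).

(* eps_ijk = det (e_i, e_j, e_k) *)
Definition levi_civita : tensor 3 :=
  [ffun t => \det (\matrix_(a < 3, b < 3) ((tnth t a == b)%:R : F))].

(* The order is m + n - 1 for m, n > 0. *)
Definition cross m n (S : tensor m) (T : tensor n) :
    tensor (((n - 1) + (3 - 1) - 1) + (m - 1)) :=
  sym (contr 1 (contr 1 T levi_civita) S).

Definition qmetric : tensor 2 := [ffun t => (tnth t ord0 == tnth t ord_max)%:R].

Definition trace12 n (T : tensor n.+2) : tensor n :=
  [ffun t : n.-tuple 'I_3 => \sum_(i < 3) T [tuple of i :: i :: t]].

Lemma permute_linear n (s : 'S_n) : linear (@permute n s).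
Proof. by move=> a S T; apply/ffunP=> t; rewrite !ffunE. Qed.

HB.instance Definition _ n (s : 'S_n) :=
  GRing.isLinear.Build F (tensor n) (tensor n) *:%R (@permute n s)
    (@permute_linear n s).

Lemma trace12_linear n : linear (@trace12 n).
Proof.
move=> a S T; apply/ffunP=> t; rewrite !ffunE scaler_sumr -big_split /=.
by apply: eq_bigr => i _; rewrite !ffunE.
Qed.

HB.instance Definition _ n :=
  GRing.isLinear.Build F (tensor n.+2) (tensor n) *:%R (@trace12 n)
    (@trace12_linear n).

Definition qprod n (U : tensor n) : tensor n.+2 := symprod qmetric U.

Lemma qprod_linear n : linear (@qprod n).
Proof.
move=> a T U; apply/ffunP=> t; rewrite /qprod /symprod /sym !ffunE.
have E s : permute s (tprod qmetric (a *: T + U)) t =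
    a * permute s (tprod qmetric T) t + permute s (tprod qmetric U) t.
  by rewrite !ffunE /entry !ffunE mulrDr mulrCA.
rewrite (eq_bigr _ (fun s _ => E s)) big_split -mulr_sumr mulrDr /=.
by rewrite mulrCA.
Qed.

HB.instance Definition _ n :=
  GRing.isLinear.Build F (tensor n) (tensor n.+2) *:%R (@qprod n)
    (@qprod_linear n).

Definition symv n : {vspace tensor n} :=
  (\bigcap_(s : 'S_n) fixedSpace (linfun (permute s)))%VS.

(* By symmetry it is enough to ask that one trace vanish. *)
Definition harmonic n : {vspace tensor n} :=
  match n with
  | n'.+2 => (symv n'.+2 :&: lker (linfun (@trace12 n')))%VS
  | n' => symv n'
  end.

(* The tensors q (.) R with R totally symmetric of order n - 2. *)
Definition qmultiples n : {vspace tensor n} :=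
  match n with
  | n'.+2 => (linfun (@qprod n') @: symv n')%VS
  | _ => 0%VS
  end.

(* S' is the component of S on the first summand of                           *)
(* symv n = harmonic n (+) qmultiples n.                                      *)
Definition leading n (S : tensor n) : tensor n :=
  daddv_pi (harmonic n) (qmultiples n) S.

Definition harmprod m n (S : tensor m) (T : tensor n) : tensor (m + n) :=
  leading (symprod S T).

Fixpoint harmpow (w : tensor 1) k : tensor k :=
  match k with
  | 0 => [ffun=> 1]
  | k'.+1 => harmprod w (harmpow w k')
  end.

Lemma symvP n (T : tensor n) :
  reflect (forall s : 'S_n, permute s T = T) (T \in symv n).
Proof.
apply: (iffP idP) => [TV s|Tsym].
  have /fixedSpaceP : T \in fixedSpace (linfun (permute s)).
    by move: TV; rewrite !memvE => /subv_bigcapP /(_ s isT).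
  by rewrite lfunE.
rewrite memvE; apply/subv_bigcapP => s _; rewrite -memvE.
by apply/fixedSpaceP; rewrite lfunE /= Tsym.
Qed.

Lemma harmonicP n (T : tensor n.+2) :
  reflect ((forall s : 'S_n.+2, permute s T = T) /\ trace12 T = 0)
          (T \in harmonic n.+2).
Proof.
rewrite memv_cap memv_ker lfunE /=; apply: (iffP andP).
  by case=> /symvP ? /eqP.
by case=> /symvP ? /eqP.
Qed.

Lemma qmultiplesP n (T : tensor n.+2) :
  reflect (exists2 U : tensor n, U \in symv n & T = qprod U)
          (T \in qmultiples n.+2).
Proof.
by apply: (iffP memv_imgP) => -[U Usym ->]; exists U => //; rewrite lfunE.
Qed.

(* (tr13 T)_ij = T_kikj *)
Definition trace13 (T : tensor 4) : tensor 2 :=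
  [ffun t => \sum_(k < 3) entry T [:: k; tnth t ord0; k; tnth t ord_max]].

Section Invariants.
Variable H : tensor 4.

Definition cov_d2 : tensor 2 := trace13 (contr 2 H H).
Definition cov_T6 : tensor 3 := cross (contr 1 cov_d2 cov_d2) cov_d2.
Definition inv_M12 : F := sqnorm cov_T6.
Definition cov_w7 : tensor 1 := contr 3 H cov_T6.
Definition cov_J18 : tensor 6 :=
  cross (leading (symcontr 1 cov_T6 cov_T6)) cov_T6.

Local Notation T6 := cov_T6.
Local Notation M12 := inv_M12.
Local Notation w7 := cov_w7.
Local Notation J18 := cov_J18.

Definition inv_i2 : F := sqnorm w7 / M12.

Definition inv_i3 : F := inner (harmpow w7 3) T6 / M12 ^+ 2.

Definition inv_i4 : F := inner (harmpow w7 4) (contr 1 T6 T6) / M12 ^+ 3.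

Definition inv_k4 : F :=
    (5%:R * M12 ^+ 3)^-1 *
      inner (harmprod H (harmpow w7 3))
            (harmprod T6 (leading (symcontr 1 T6 T6)))
  + (7%:R * M12 ^+ 3)^-1 * inner (cross H (harmpow w7 3)) J18
  - 7%:R / (99%:R * M12 ^+ 2) * inner (contr 2 H (harmpow w7 3)) T6.

Definition inv_k8 : F :=
  inner (cross w7 H) (contr 1 T6 T6) * inner (harmpow w7 6) J18 / M12 ^+ 6.

Definition inv_k9 : F :=
  inner (harmpow w7 6) J18 / M12 ^+ 5 *
    (36%:R / M12 ^+ 2 * inner (harmprod (harmpow w7 2) H) J18
     + 28%:R / (5%:R * M12) * inner (cross (contr 1 H w7) w7) T6).

End Invariants.

End Tensors.

Section RationalFunctions.
Variable R : realType.

Local Notation H4 := (harmonic R 4).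
Local Notation dimH4 := (\dim H4).
Local Notation basisH4 := (vbasis H4).

(* The field R(H^4): the indeterminate 'X_i stands for the i-th coordinate    *)
(* function on H^4(R^3) with respect to the basis vbasis H4.                  *)
Definition ratfun := {fraction {mpoly R[dimH4]}}.

Definition ratcst (c : R) : ratfun := FracField.tofrac (c%:MP_[dimH4]).

Definition ratcoord (i : 'I_dimH4) : ratfun :=
  FracField.tofrac ('X_i : {mpoly R[dimH4]}).

(* The identity map of H^4(R^3), as a tensor of rational functions: the value *)
(* at this tensor of an algebraic expression in H is the rational function    *)
(* of H that the expression defines.                                          *)
Definition generic : tensor ratfun 4 :=
  [ffun t => \sum_(i < dimH4) ratcst (basisH4`_i t) * ratcoord i].

Definition rateval m (v : 'I_m -> ratfun) (P : {mpoly R[m]}) : ratfun :=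
  mmap ratcst v P.

Definition SO3 (g : 'M[R]_3) : Prop := g *m g^T = 1%:M /\ \det g = 1.

Definition act n (g : 'M[R]_3) (T : tensor R n) : tensor R n :=
  [ffun t => \sum_(u : n.-tuple 'I_3)
     (\prod_(a < n) g (tnth t a) (tnth u a)) * (T u : R)].

(* The i-th coordinate of act g H, as a linear form in the coordinates of H. *)
Definition act_coord (g : 'M[R]_3) (i : 'I_dimH4) : ratfun :=
  \sum_(j < dimH4) ratcst (coord basisH4 i (act g basisH4`_j)) * ratcoord j.

(* The rational function H |-> f (act g H). *)
Definition pullback (g : 'M[R]_3) (f : ratfun) : ratfun :=
  rateval (act_coord g) (\n_(repr f)) / rateval (act_coord g) (\d_(repr f)).

Definition rational_invariant (f : ratfun) : Prop :=
  forall g, SO3 g -> pullback g f = f.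

Definition generates_invariants m (v : 'I_m -> ratfun) : Prop :=
  (forall i, rational_invariant (v i)) /\
  (forall f, rational_invariant f ->
     exists P Q : {mpoly R[m]},
       rateval v Q != 0 /\ f = rateval v P / rateval v Q).

Definition alg_independent m (v : 'I_m -> ratfun) : Prop :=
  forall P : {mpoly R[m]}, rateval v P = 0 -> P = 0.

End RationalFunctions.

Arguments generic : clear implicits.

(* Main.v *)
(* Slice method.  Rotate H so that d_2 is diagonal.  Then T_6 is v xyz, v being *)
(* the Vandermonde product of the eigenvalues of d_2, and M_12 = v^2 / 6.  In   *)
(* the coordinates (L, A, B) of harm4, w_7 = v A, the functions i_2, i_3, i_4   *)
(* are generators of the T_d-invariants of A, and k_4, k_8, k_9 are linear in B *)
(* with coefficients depending on A, while the vanishing of the off-diagonal    *)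
(* components of d_2 is a linear system for L.  Hence the slice of tensors with *)
(* diagonal d_2 is birational to the space of the pairs (A, k) with             *)
(* k = (k_4, k_8, k_9), and T_d, acting on A alone, preserves it.               *)
(* An invariant f = p / q restricts to the slice as a quotient p' / q' of       *)
(* polynomials in (A, k).  The averages of p' q' and q'^2 over T_d have the     *)
(* same quotient, the second one is not zero, and both are polynomials in the   *)
(* six functions.  Independence holds because (A, k) is free on the slice.      *)
(* Rational functions are compared at the real points where M_12 is not 0.      *)

From HB Require Import structures.
Require Import Defs.
From mathcomp Require Import all_boot all_order all_algebra perm generic_quotient.
From mathcomp Require Import boolp reals polyrcf ring lra.
From mathcomp Require Import mpoly.

Set Implicit Arguments.
Unset Strict Implicit.
Unset Printing Implicit Defensive.

Import Order.TTheory GRing.Theory Num.Theory.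
Local Open Scope ring_scope.

(** * Polynomials and polynomial functions *)

(** Some rotation makes the symmetric matrix [cov_d2] diagonal ([diagonalize_d2]). Where [inv_M12]
    is not zero its eigenvalues are distinct, and the rotations keeping it diagonal only permute the
    axes up to sign. A rational invariant is thus a function on the slice of tensors with diagonal
    [cov_d2], symmetric under a finite group.

    A harmonic tensor has nine parameters [L], [A], [B] ([harmonic4_param]). The slice is cut out by
    three equations affine in [L], with coefficients in [A] and [B] ([offdiagE]), and k_4, k_8, k_9
    are linear in [B] with coefficients in [A] ([slice_k4], [slice_k8], [slice_k9]). Two uses of
    Cramer's rule recover the tensor from [A] and [k] ([par_of_unique]), and generic [A] and [k] can
    be prescribed ([slice_tensor_invariants]). The finite group fixes [k] and acts on [A] as T_d
    ([td_rotation]). T_d-sums of polynomials in [A] are polynomials in generators of degrees 2, 3, 4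
    ([td_sum]), which are independent ([td_inv_independent]); i_2, i_3, i_4 are these up to the
    triangular change [to_inv].

    For generation ([generation]), let p / q be invariant and let p', q' be its numerator and
    denominator on the slice, cleared of denominators. At each point of the T_d-orbit p q'^2 = p' q'
    q. Summing over T_d gives p Q = P q, with P and Q polynomials in the six functions, and Q is not
    zero because it is a sum of real squares. For independence ([invariants_independent]), a
    relation would hold at all generic [A] and [k], which [td_inv_independent] excludes.

    The theorem speaks of elements of a fraction field, the computations of real tensors. The
    relation [specializes] connects the two; the delicate operation is [leading], defined by linear
    algebra over each field and transported by [map_leading]. *)

Lemma horner_muni (R : comNzRingType) n (p : {mpoly R[n.+1]}) (x : 'I_n.+1 -> R) :
  p.@[x] =
  (map_poly (meval (fun i => x (widen_ord (leqnSn n) i))) (muni p)).[x ord_max].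
Proof.
rewrite muniE raddf_sum horner_sum mevalE; apply: eq_bigr => m _ /=.
rewrite map_polyZ /= map_polyXn hornerZ hornerXn mevalZ mevalX.
rewrite big_ord_recr /= mulrA; congr (_ * _ * _).
by apply: eq_bigr => i _; rewrite mnmE.
Qed.

Lemma muni_eq0 (R : nzRingType) n (p : {mpoly R[n.+1]}) : muni p = 0 -> p = 0.
Proof.
move=> p0; apply/mpolyP => m0; rewrite mcoeff0.
case: (boolP (m0 \in msupp p)) => [m0p|/memN_msupp_eq0 //].
have: ((muni p)`_(m0 ord_max))@_[multinom m0 (widen_ord (leqnSn n) i) | i < n] = 0.
  by rewrite p0 coef0 mcoeff0.
rewrite muniE coef_sum raddf_sum /= (bigD1_seq m0) ?msupp_uniq //=.
rewrite coefZ coefXn eqxx mulr1 mcoeffZ mcoeffX eqxx mulr1 big1 ?addr0 // => m ne.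
rewrite coefZ coefXn; case: eqP => [e|]; last by rewrite mulr0 mcoeff0.
rewrite mulr1 mcoeffZ mcoeffX; case: eqP => [e'|]; last by rewrite mulr0.
case/eqP: ne; apply/mnmP => i; case: (unliftP ord_max i) => [j|] -> //.
have := congr1 (fun m : 'X_{1..n} => m j) e'; rewrite !mnmE /=.
have -> : lift ord_max j = widen_ord (leqnSn n) j.
  by apply: val_inj; rewrite /= /bump leqNgt ltn_ord.
by [].
Qed.

Lemma poly_eq0_nat (R : numDomainType) (p : {poly R}) :
  (forall k : nat, p.[k%:R] = 0) -> p = 0.
Proof.
move=> p0; apply/eqP/negPn/negP => /max_poly_roots mr.
have h1 : all (root p) [seq k%:R | k <- iota 0 (size p)].
  by apply/allP => x /mapP [k _ ->]; apply/rootP.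
have h2 : uniq [seq k%:R : R | k <- iota 0 (size p)].
  by rewrite map_inj_uniq ?iota_uniq // => i j /eqP; rewrite eqr_nat => /eqP.
by have := mr _ h1 h2; rewrite size_map size_iota ltnn.
Qed.

(** Induction on the number of variables through [muni]. The sample points are natural numbers
    because [td_inv_independent] needs coordinates that have square roots. *)
Lemma mpoly_eq0_nat (R : numDomainType) n (p : {mpoly R[n]}) :
  (forall x : 'I_n -> nat, p.@[fun i => (x i)%:R] = 0) -> p = 0.
Proof.
elim: n p => [|n IHn] p p0.
  apply/mpolyP => m; rewrite mcoeff0; have := p0 (fun _ => 0%N).
  have E (m' : 'X_{1..0}) : m' = m by apply/mnmP; case.
  case: (boolP (m \in msupp p)) => [mp|/memN_msupp_eq0 //].
  rewrite mevalE (bigD1_seq m) ?msupp_uniq //= big_ord0 mulr1 big1 ?addr0 //.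
  by move=> m'; rewrite (E m') eqxx.
apply: muni_eq0; apply/polyP => k; rewrite coef0; apply: IHn => x.
have -> : ((muni p)`_k).@[fun i => (x i)%:R] =
    (map_poly (meval (fun i => (x i)%:R)) (muni p))`_k by rewrite coef_map.
suff -> : map_poly (meval (fun i => (x i)%:R)) (muni p) = 0 by rewrite coef0.
apply: poly_eq0_nat => l.
pose y (i : 'I_n.+1) := if unlift ord_max i is Some j then x j else l.
have := p0 y; rewrite horner_muni {2}/y unlift_none => <-.
congr (_.[_]); apply: eq_map_poly => q; apply: meval_eq => i.
rewrite /y; have -> : widen_ord (leqnSn n) i = lift ord_max i.
  by apply: val_inj; rewrite /= /bump leqNgt ltn_ord.
by rewrite liftK.
Qed.

Lemma mpoly_eq0 (R : numDomainType) n (p : {mpoly R[n]}) :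
  (forall x, p.@[x] = 0) -> p = 0.
Proof. by move=> p0; apply: mpoly_eq0_nat. Qed.

Lemma mpoly_ext (R : numDomainType) n (p q : {mpoly R[n]}) :
  (forall x, p.@[x] = q.@[x]) -> p = q.
Proof.
move=> pq; apply/eqP; rewrite -subr_eq0; apply/eqP/mpoly_eq0 => x.
by rewrite mevalB pq subrr.
Qed.

Lemma mpoly_neq0P (R : numDomainType) n (p : {mpoly R[n]}) :
  p != 0 -> exists x, p.@[x] != 0.
Proof.
move=> pn0; apply: contrapT => /forallNP h; case/eqP: pn0.
by apply: mpoly_eq0 => x; apply/eqP/negPn/negP/h.
Qed.

(** * Functions given by polynomials *)

Section PolynomialFunctions.
Variables (R : comNzRingType) (m : nat).
Implicit Types f g : ('I_m -> R) -> R.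

(** Stated for functions, so that the large polynomials describing the slice are obtained from
    closure properties and never written out. *)
Definition polyfun f := exists p : {mpoly R[m]}, forall x, f x = p.@[x].

Lemma polyfunC c : polyfun (fun=> c).
Proof. by exists c%:MP => x; rewrite mevalC. Qed.

Lemma polyfunX i : polyfun (fun x => x i).
Proof. by exists 'X_i => x; rewrite mevalXU. Qed.

Lemma polyfunD f g : polyfun f -> polyfun g -> polyfun (fun x => f x + g x).
Proof. by move=> [p hp] [q hq]; exists (p + q) => x; rewrite mevalD hp hq. Qed.

Lemma polyfunM f g : polyfun f -> polyfun g -> polyfun (fun x => f x * g x).
Proof. by move=> [p hp] [q hq]; exists (p * q) => x; rewrite mevalM hp hq. Qed.

Lemma polyfunN f : polyfun f -> polyfun (fun x => - f x).
Proof. by move=> [p hp]; exists (- p) => x; rewrite mevalN hp. Qed.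

Lemma polyfunXn f k : polyfun f -> polyfun (fun x => f x ^+ k).
Proof.
by move=> [p hp]; exists (p ^+ k) => x; rewrite rmorphXn /= hp.
Qed.

Lemma polyfun_sum I (r : seq I) (P : pred I) (F : I -> ('I_m -> R) -> R) :
  (forall i, polyfun (F i)) -> polyfun (fun x => \sum_(i <- r | P i) F i x).
Proof.
move=> hF; elim: r => [|i r IHr].
  by exists 0 => x; rewrite big_nil meval0.
case: IHr => p hp; case: (hF i) => q hq; exists ((if P i then q else 0) + p) => x.
by rewrite big_cons mevalD -hp; case: (P i); rewrite ?meval0 ?add0r ?hq.
Qed.

Lemma polyfun_prod I (r : seq I) (P : pred I) (F : I -> ('I_m -> R) -> R) :
  (forall i, polyfun (F i)) -> polyfun (fun x => \prod_(i <- r | P i) F i x).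
Proof.
move=> hF; elim: r => [|i r IHr].
  by exists 1 => x; rewrite big_nil meval1.
case: IHr => p hp; case: (hF i) => q hq; exists ((if P i then q else 1) * p) => x.
by rewrite big_cons mevalM -hp; case: (P i); rewrite ?meval1 ?mul1r ?hq.
Qed.

Lemma polyfun_ext f g : f =1 g -> polyfun f -> polyfun g.
Proof. by move=> fg [p hp]; exists p => x; rewrite -fg. Qed.

Lemma polyfun_meval k (p : {mpoly R[k]}) (F : 'I_k -> ('I_m -> R) -> R) :
  (forall i, polyfun (F i)) -> polyfun (fun x => p.@[fun i => F i x]).
Proof.
move=> hF.
apply: (@polyfun_ext
  (fun x => \sum_(e <- msupp p) p@_e * \prod_i F i x ^+ e i)).
  by move=> x; rewrite mevalE.
apply: polyfun_sum => e; apply: polyfunM; first exact: polyfunC.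
by apply: polyfun_prod => i; apply: polyfunXn.
Qed.

End PolynomialFunctions.

(** Each monomial of [p] adds its degree to the exponent [N]. Nothing is said at the zeros of [d];
    [slice_pullback2] takes care of them. *)
Lemma clear_denom (R : fieldType) m k (p : {mpoly R[k]})
    (U : 'I_k -> ('I_m -> R) -> R) (d : ('I_m -> R) -> R) :
  (forall i, polyfun (U i)) -> polyfun d ->
  exists N (r : {mpoly R[m]}), forall x, d x != 0 ->
    p.@[fun i => U i x / d x] = r.@[x] / d x ^+ N.
Proof.
move=> hU hd; elim/mpolyind: p => [|c e p _ _ [N [r hr]]].
  by exists 0%N, 0 => x _; rewrite !meval0 mul0r.
have [pU hpU] : polyfun (fun x => c * (\prod_(i < k) U i x ^+ e i) * d x ^+ N).
  apply: polyfunM; last exact: polyfunXn.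
  apply: polyfunM; first exact: polyfunC.
  by apply: polyfun_prod => i; apply: polyfunXn.
have [pd hpd] : polyfun (fun x => d x ^+ (\sum_i e i)) by exact: polyfunXn.
exists ((\sum_i e i) + N)%N, (pU + r * pd) => x dn0.
rewrite !mevalD mevalM mevalZ mevalX hr // -hpU -hpd.
have -> : \prod_(i < k) (U i x / d x) ^+ e i =
    (\prod_(i < k) U i x ^+ e i) / d x ^+ (\sum_i e i).
  rewrite expr_sum -prodf_div; apply: eq_bigr => i _.
  by rewrite expr_div_n.
rewrite exprD; have h1 : d x ^+ N != 0 by rewrite expf_neq0.
have h2 : d x ^+ (\sum_i e i) != 0 by rewrite expf_neq0.
by field; rewrite h1 h2.
Qed.

(** * Tensors and harmonic decomposition *)

Section TupleSums.
Variables (F : nmodType) (I : finType).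

Lemma big_tuple_cat m n (f : seq I -> F) :
  \sum_(t : (m + n).-tuple I) f t =
  \sum_(a : m.-tuple I) \sum_(b : n.-tuple I) f (a ++ b).
Proof.
rewrite pair_big /=.
rewrite (reindex (fun p : m.-tuple I * n.-tuple I => cat_tuple p.1 p.2)) //=.
have szt (t : (m + n).-tuple I) : size (take m t) == m.
  by rewrite size_takel // size_tuple leq_addr.
have szd (t : (m + n).-tuple I) : size (drop m t) == n.
  by rewrite size_drop size_tuple addKn.
exists (fun t => (Tuple (szt t), Tuple (szd t))) => [[a b] _|t _].
  congr pair; apply: val_inj => /=.
    by rewrite take_size_cat // size_tuple.
  by rewrite drop_size_cat // size_tuple.
by apply: val_inj; rewrite /= cat_take_drop.
Qed.

Lemma big_tuple_catE k m n (f : seq I -> F) : k = (m + n)%N ->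
  \sum_(t : k.-tuple I) f t =
  \sum_(a : m.-tuple I) \sum_(b : n.-tuple I) f (a ++ b).
Proof. by move=> ->; apply: big_tuple_cat. Qed.

Lemma big_tuple_cons n (f : seq I -> F) :
  \sum_(t : n.+1.-tuple I) f t = \sum_i \sum_(t : n.-tuple I) f (i :: t).
Proof.
rewrite pair_big /= (reindex (fun p : I * n.-tuple I => cons_tuple p.1 p.2)) //=.
exists (fun t => (thead t, [tuple of behead t])) => [[i t] _|t _].
  by rewrite theadE; congr pair; apply: val_inj.
by rewrite [RHS]tuple_eta; apply: val_inj.
Qed.

Lemma big_tuple0 (f : seq I -> F) : \sum_(t : 0.-tuple I) f t = f [::].
Proof.
rewrite (big_pred1 [tuple]) // => t; apply/esym/eqP.
by rewrite [t]tuple0.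
Qed.

Lemma big_tuple1 (f : seq I -> F) : \sum_(t : 1.-tuple I) f t = \sum_i f [:: i].
Proof.
rewrite big_tuple_cons; apply: eq_bigr => i _.
exact: (big_tuple0 (fun t => f (i :: t))).
Qed.

Lemma big_tuple2 (f : seq I -> F) :
  \sum_(t : 2.-tuple I) f t = \sum_i \sum_j f [:: i; j].
Proof.
rewrite big_tuple_cons; apply: eq_bigr => i _.
exact: (big_tuple1 (fun t => f (i :: t))).
Qed.

End TupleSums.

Section TensorEntries.
Variable F : fieldType.
Local Notation tensor := (tensor F).
Implicit Types m n r : nat.

Lemma entryE n (T : tensor n) (t : n.-tuple 'I_3) : entry T t = T t.
Proof.
by congr (T _); apply: eq_from_tnth => i; rewrite tnth_mktuple (tnth_nth ord0).
Qed.

(** Components are read at lists rather than tuples, so that orders equal only up to a proof, such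
    as [n - 1 + (3 - 1) - 1] and [n - 1 + 1], need no casts. *)
Lemma entry_ext n (S T : tensor n) :
  (forall s, size s = n -> entry S s = entry T s) -> S = T.
Proof.
by move=> h; apply/ffunP => t; rewrite -!entryE h // size_tuple.
Qed.

Lemma entry0 n s : entry (0 : tensor n) s = 0.
Proof. by rewrite /entry ffunE. Qed.

Lemma entry_ffun n (f : seq 'I_3 -> F) s :
  size s = n -> entry ([ffun t : n.-tuple 'I_3 => f t] : tensor n) s = f s.
Proof.
move=> sz; rewrite /entry ffunE; congr f.
apply: (@eq_from_nth _ ord0); rewrite size_tuple // => i ltin.
by rewrite -[X in nth _ X _]/(tval _) -(tnth_nth _ _ (Ordinal ltin)) tnth_mktuple.
Qed.

Lemma innerE n (S T : tensor n) :
  inner S T = \sum_(t : n.-tuple 'I_3) entry S t * entry T t.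
Proof. by apply: eq_bigr => t _; rewrite !entryE. Qed.

Lemma entry_contr r m n (S : tensor m) (T : tensor n) a b :
  size a = (m - r)%N -> size b = (n - r)%N ->
  entry (contr r S T) (a ++ b) =
  \sum_(k : r.-tuple 'I_3) entry S (a ++ k) * entry T (k ++ b).
Proof.
move=> sa sb; rewrite /contr.
rewrite (@entry_ffun _ (fun t => \sum_(k : r.-tuple 'I_3)
     entry S (take (m - r) t ++ k) * entry T (k ++ drop (m - r) t))).
  by apply: eq_bigr => k _; rewrite take_size_cat // drop_size_cat.
by rewrite size_cat sa sb.
Qed.

Lemma entry_tprod m n (S : tensor m) (T : tensor n) a b :
  size a = m -> size b = n ->
  entry (tprod S T) (a ++ b) = entry S a * entry T b.
Proof.
move=> sa sb; rewrite /tprod.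
rewrite (@entry_ffun _ (fun t => entry S (take m t) * entry T (drop m t))).
  by rewrite take_size_cat // drop_size_cat.
by rewrite size_cat sa sb.
Qed.

Lemma entry_trace12 n (T : tensor n.+2) s :
  size s = n -> entry (trace12 T) s = \sum_(i < 3) entry T (i :: i :: s).
Proof.
move=> sz; rewrite /trace12.
transitivity (entry ([ffun t : n.-tuple 'I_3 =>
    \sum_(i < 3) entry T (i :: i :: t)] : tensor n) s).
  by congr entry; apply/ffunP => t; rewrite !ffunE; apply: eq_bigr => i _;
    rewrite -entryE.
by rewrite (@entry_ffun _ (fun t => \sum_(i < 3) entry T (i :: i :: t))).
Qed.

End TensorEntries.

(** * Symmetrization and the inner product *)

Section Symmetrization.
Variable F : fieldType.
Local Notation tensor := (tensor F).
Implicit Types m n r : nat.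

Definition permt n (s : 'S_n) (t : n.-tuple 'I_3) : n.-tuple 'I_3 :=
  [tuple tnth t (s i) | i < n].

Lemma permtM n (s u : 'S_n) t : permt u (permt s t) = permt (u * s)%g t.
Proof. by apply: eq_from_tnth => i; rewrite !tnth_mktuple permM. Qed.

Lemma permt1 n (t : n.-tuple 'I_3) : permt 1%g t = t.
Proof. by apply: eq_from_tnth => i; rewrite tnth_mktuple perm1. Qed.

Lemma permt_bij n (s : 'S_n) : bijective (permt s).
Proof.
by exists (permt s^-1%g) => t; rewrite permtM ?fingroup.mulgV ?fingroup.mulVg permt1.
Qed.

Lemma permuteE n (s : 'S_n) (T : tensor n) t : permute s T t = T (permt s t).
Proof. by rewrite ffunE. Qed.

Lemma perm_eq_permt n (s : 'S_n) t : perm_eq (permt s t) t.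
Proof. by apply/tuple_permP; exists s. Qed.

Lemma symv_perm n (T : tensor n) (t u : n.-tuple 'I_3) :
  T \in symv F n -> perm_eq t u -> T t = T u.
Proof.
move=> /symvP Ts /tuple_permP [s e].
by rewrite -[in RHS](Ts s) permuteE; congr (T _); apply: val_inj.
Qed.

Lemma symv_perm_entry n (T : tensor n) s u :
  T \in symv F n -> size s = n -> perm_eq s u -> entry T s = entry T u.
Proof.
move=> Ts sz psu; have sz' : size u == n by rewrite -(perm_size psu) sz.
move/eqP: sz => sz; rewrite -[s]/(tval (Tuple sz)) -[u]/(tval (Tuple sz')) !entryE.
exact: symv_perm.
Qed.

Lemma symvI n (T : tensor n) :
  (forall t u : n.-tuple 'I_3, perm_eq t u -> T t = T u) -> T \in symv F n.
Proof.
move=> h; apply/symvP => s; apply/ffunP => t; rewrite permuteE.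
exact/h/perm_eq_permt.
Qed.

Lemma symE n (T : tensor n) t :
  sym T t = n`!%:R^-1 * \sum_(s : 'S_n) T (permt s t).
Proof. by rewrite ffunE; congr (_ * _); apply: eq_bigr => s _; rewrite ffunE. Qed.

Lemma sym_in_symv n (T : tensor n) : sym T \in symv F n.
Proof.
apply/symvP => u; apply/ffunP => t; rewrite permuteE !symE; congr (_ * _).
rewrite (reindex_inj (mulIg u^-1%g)) /=; apply: eq_bigr => s _.
by rewrite permtM fingroup.mulgKV.
Qed.

Lemma inner_permute n (s : 'S_n) (S T : tensor n) :
  inner (permute s S) (permute s T) = inner S T.
Proof.
rewrite /inner [RHS](reindex (permt s)) /=; last exact/onW_bij/permt_bij.
by apply: eq_bigr => t _; rewrite !permuteE.
Qed.

Lemma innerC n (S T : tensor n) : inner S T = inner T S.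
Proof. by apply: eq_bigr => t _; rewrite mulrC. Qed.

Lemma innerDl n (S S' T : tensor n) : inner (S + S') T = inner S T + inner S' T.
Proof. by rewrite /inner -big_split; apply: eq_bigr => t _; rewrite ffunE mulrDl. Qed.

Lemma innerZl n c (S T : tensor n) : inner (c *: S) T = c * inner S T.
Proof. by rewrite /inner mulr_sumr; apply: eq_bigr => t _; rewrite ffunE mulrA. Qed.

Lemma innerNl n (S T : tensor n) : inner (- S) T = - inner S T.
Proof. by rewrite -scaleN1r innerZl mulN1r. Qed.

Lemma symD n (S T : tensor n) : sym (S + T) = sym S + sym T.
Proof.
apply/ffunP => t; rewrite [RHS]ffunE !symE -mulrDr -big_split.
by congr (_ * _); apply: eq_bigr => s _; rewrite ffunE.
Qed.

Lemma symZ n c (T : tensor n) : sym (c *: T) = c *: sym T.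
Proof.
apply/ffunP => t; rewrite [RHS]ffunE !symE [RHS]mulrCA; congr (_ * _).
by rewrite mulr_sumr; apply: eq_bigr => s _; rewrite ffunE.
Qed.

Hypothesis char0 : forall k, k.+1%:R != 0 :> F.

Lemma fact_neq0 n : n`!%:R != 0 :> F.
Proof. by case: n`! (fact_gt0 n). Qed.

Lemma mean_const n (x : F) : n`!%:R^-1 * \sum_(s : 'S_n) x = x.
Proof. by rewrite sumr_const card_Sn -[x *+ _]mulr_natl mulKf // fact_neq0. Qed.

Lemma sym_id n (T : tensor n) : T \in symv F n -> sym T = T.
Proof.
move=> Ts; apply/ffunP => t; rewrite symE -[RHS](mean_const n); congr (_ * _).
by apply: eq_bigr; move=> s _; apply: symv_perm => //; apply: perm_eq_permt.
Qed.

(** Permutations are isometries fixing [T], so all terms of the average are equal. The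
    symmetrizations hidden in [symprod] and [cross] can thus be dropped in pairings with symmetric
    tensors. *)
Lemma inner_sym n (S T : tensor n) :
  T \in symv F n -> inner (sym S) T = inner S T.
Proof.
move=> Ts.
have -> : inner (sym S) T = n`!%:R^-1 * \sum_(s : 'S_n) inner (permute s S) T.
  rewrite exchange_big mulr_sumr; apply: eq_bigr => t _.
  by rewrite symE -mulrA mulr_suml; congr (_ * _); apply: eq_bigr => s _; rewrite permuteE.
rewrite -[RHS](mean_const n); congr (_ * _).
by apply: eq_bigr; move=> s _; rewrite -{1}(symvP _ Ts s) inner_permute.
Qed.

End Symmetrization.

(* Orthogonality of the harmonic tensors and the multiples of q makes their sum *)
(* direct over R and over the field of rational functions alike.                *)
Definition formally_real (F : fieldType) :=
  forall (I : finType) (f : I -> F), \sum_i f i * f i = 0 -> forall i, f i = 0.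

(** * Harmonic decomposition of symmetric tensors *)

Section HarmonicDecomposition.
Variable F : fieldType.
Local Notation tensor := (tensor F).
Implicit Types m n : nat.

Hypothesis realF : formally_real F.

Lemma formally_real_char0 k : k.+1%:R != 0 :> F.
Proof.
apply/eqP => k0; suff /(_ ord0)/eqP : forall i : 'I_k.+1, 1 = 0 :> F.
  by rewrite oner_eq0.
apply: (realF (f := fun=> 1)); rewrite (eq_bigr (fun=> 1)) => [|i _].
  by rewrite sumr_const card_ord.
by rewrite mulr1.
Qed.

Local Notation char0 := formally_real_char0.

Lemma sqnorm_eq0 n (T : tensor n) : sqnorm T = 0 -> T = 0.
Proof. by move=> /realF h; apply/ffunP => t; rewrite [LHS]h ffunE. Qed.

Lemma harmonic_symv n (T : tensor n) : T \in harmonic F n -> T \in symv F n.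
Proof. by case: n T => [|[|n]] T //; rewrite memv_cap => /andP []. Qed.

Lemma trace12_symv n (T : tensor n.+2) :
  T \in symv F n.+2 -> trace12 T \in symv F n.
Proof.
move=> Ts; apply: symvI => t u ptu; rewrite !ffunE; apply: eq_bigr => i _.
by apply: symv_perm => //=; rewrite !perm_cons.
Qed.

Lemma qprod_symv n (U : tensor n) : qprod U \in symv F n.+2.
Proof. exact: sym_in_symv. Qed.

(** Multiplication by q is adjoint to the trace; this is what makes harmonic tensors orthogonal to
    the multiples of q. *)
Lemma inner_qprod n (U : tensor n) (T : tensor n.+2) :
  T \in symv F n.+2 -> inner (qprod U) T = inner U (trace12 T).
Proof.
move=> Ts; rewrite (inner_sym char0 _ Ts) innerE.
rewrite (big_tuple_cat 2 n
  (fun t => entry (tprod (qmetric F) U) t * entry T t)).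
rewrite exchange_big innerE; apply: eq_bigr => b _.
rewrite (big_tuple2 (fun a => entry (tprod (qmetric F) U) (a ++ b) *
  entry T (a ++ b))).
rewrite entry_trace12 ?size_tuple // mulr_sumr; apply: eq_bigr => i _.
have E j : entry (tprod (qmetric F) U) ([:: i; j] ++ b) =
    (i == j)%:R * entry U b.
  rewrite (@entry_tprod _ 2 n _ _ [:: i; j]) ?size_tuple //.
  by rewrite (entryE (qmetric F) [tuple i; j]) ffunE /= !(tnth_nth ord0).
rewrite (bigD1 i) //= big1 ?addr0 => [|j ji].
  by rewrite (E i) eqxx mul1r.
by rewrite (E j) eq_sym (negbTE ji) !mul0r.
Qed.

Lemma inner_qmultiples_harmonic n (D K : tensor n) :
  D \in qmultiples F n -> K \in harmonic F n -> inner D K = 0.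
Proof.
case: n D K => [|[|n]] D K; rewrite ?memv0; try
  by move/eqP=> -> _; rewrite /inner big1 // => t _; rewrite ffunE mul0r.
move=> /qmultiplesP [U _ ->] KH; rewrite inner_qprod ?harmonic_symv //.
have [_ ->] := harmonicP _ KH.
by rewrite /inner big1 // => t _; rewrite ffunE mulr0.
Qed.

Lemma harmonic_cap_qmultiples n : (harmonic F n :&: qmultiples F n = 0)%VS.
Proof.
apply/eqP; rewrite -subv0; apply/subvP => T; rewrite memv_cap memv0 => /andP [TH TQ].
by apply/eqP/sqnorm_eq0; apply: inner_qmultiples_harmonic.
Qed.

(** The way leading parts are computed below: the sum being direct, any decomposition that is
    exhibited is the right one. *)
Lemma leading_eq n (K D : tensor n) :
  K \in harmonic F n -> D \in qmultiples F n -> leading (K + D) = K.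
Proof.
move=> KH DQ; rewrite /leading raddfD /= daddv_pi_id ?harmonic_cap_qmultiples //.
rewrite -[RHS]addr0; congr (_ + _).
have cap : (qmultiples F n :&: harmonic F n = 0)%VS.
  by rewrite capvC harmonic_cap_qmultiples.
have := daddv_pi_add (w := D) (harmonic_cap_qmultiples n).
rewrite (subvP (addvSr _ _)) // => /(_ isT).
by rewrite (daddv_pi_id cap DQ) -[RHS]add0r => /addIr.
Qed.

(** A dimension count. The symmetric tensors orthogonal to a basis of [U] are harmonic, and
    orthogonality imposes at most [\dim U] linear conditions, so the direct sum has at least the
    dimension of [V]. *)
Lemma symv_decomposition n : (symv F n <= harmonic F n + qmultiples F n)%VS.
Proof.
case: n => [|[|n]]; [exact: addvSl | exact: addvSl | ].
set U := qmultiples F n.+2; set V := symv F n.+2; set d := \dim U.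
have UV : (U <= V)%VS.
  by apply/subvP => T /qmultiplesP [W _ ->]; apply: qprod_symv.
pose f (T : tensor n.+2) : 'rV[F]_d := \row_i inner T (vbasis U)`_i.
have f_lin : linear f.
  move=> a S T; apply/rowP => i; rewrite !mxE innerDl innerZl //.
pose fL : {linear tensor n.+2 -> 'rV[F]_d} :=
  HB.pack f (GRing.isLinear.Build _ _ _ _ f f_lin).
have WH : (V :&: lker (linfun fL) <= harmonic F n.+2)%VS.
  apply/subvP => T; rewrite memv_cap memv_ker lfunE /= => /andP [TV /eqP/rowP fT].
  have TU u : u \in U -> inner T u = 0.
    move=> uU; rewrite (coord_vbasis uU) innerC.
    elim: (index_enum _) => [|i r IH].
      by rewrite big_nil /inner big1 // => t _; rewrite ffunE mul0r.
    rewrite big_cons innerDl IH innerZl innerC.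
    by have := fT i; rewrite !mxE => ->; rewrite mulr0 addr0.
  apply/harmonicP; split; first by apply/symvP.
  (* By adjunction the square norm of [trace12 T] is the product of [T] with [qprod (trace12 T)], an
     element of [U]. *)
  apply: sqnorm_eq0; rewrite /sqnorm -inner_qprod // innerC; apply: TU.
  by apply/qmultiplesP; exists (trace12 T) => //; apply: trace12_symv.
have HUV : (harmonic F n.+2 + U <= V)%VS.
  apply/subvP => T /memv_addP [K KH [D DU ->]]; apply: memvD.
    exact: harmonic_symv.
  exact: (subvP UV).
suff: (V == harmonic F n.+2 + U)%VS by move/eqP => {1}->.
rewrite eq_sym eqEdim HUV /=.
rewrite (dimv_disjoint_sum (harmonic_cap_qmultiples n.+2)).
rewrite -(limg_ker_dim (linfun fL) V) leq_add ?dimvS //.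
apply: leq_trans (dimvS (subvf _)) _.
by rewrite dimvf /dim /= mul1n.
Qed.

Lemma leading_harmonic n (T : tensor n) : leading T \in harmonic F n.
Proof. exact: memv_pi. Qed.

Lemma leading_rest n (T : tensor n) :
  T \in symv F n -> exists2 D, D \in qmultiples F n & T = leading T + D.
Proof.
move=> Ts; exists (daddv_pi (qmultiples F n) (harmonic F n) T); first exact: memv_pi.
rewrite daddv_pi_add ?harmonic_cap_qmultiples //.
exact: (subvP (symv_decomposition n)).
Qed.

Lemma inner_leading n (S K : tensor n) :
  S \in symv F n -> K \in harmonic F n -> inner (leading S) K = inner S K.
Proof.
move=> /leading_rest [D DQ {2}->] KH.
by rewrite innerDl (inner_qmultiples_harmonic DQ KH) addr0.
Qed.

(** The harmonic product differs from the symmetric product by a multiple of q, to which [K] is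
    orthogonal. Harmonic products paired with harmonic tensors therefore need not be computed. *)
Lemma inner_harmprod m n (S : tensor m) (T : tensor n) K :
  K \in harmonic F (m + n) -> inner (harmprod S T) K = inner (tprod S T) K.
Proof.
move=> KH; rewrite inner_leading ?sym_in_symv // inner_sym //.
  exact: char0.
exact: harmonic_symv.
Qed.

End HarmonicDecomposition.

(** * Compatibility with extension of the field of scalars *)

Section ScalarExtension.
Variables (F F' : fieldType) (phi : {rmorphism F -> F'}).

Definition map_tensor n (T : tensor F n) : tensor F' n := [ffun t => phi (T t)].

Lemma entry_map n (T : tensor F n) s : entry (map_tensor T) s = phi (entry T s).
Proof. by rewrite /entry ffunE. Qed.

Lemma map_tensorD n (S T : tensor F n) :
  map_tensor (S + T) = map_tensor S + map_tensor T.
Proof. by apply/ffunP => t; rewrite !ffunE rmorphD. Qed.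

Lemma map_sym n (T : tensor F n) : map_tensor (sym T) = sym (map_tensor T).
Proof.
apply/ffunP => t; rewrite ffunE !symE rmorphM fmorphV rmorph_nat rmorph_sum /=.
by congr (_ * _); apply: eq_bigr => s _; rewrite ffunE.
Qed.

Lemma map_tprod m n (S : tensor F m) (T : tensor F n) :
  map_tensor (tprod S T) = tprod (map_tensor S) (map_tensor T).
Proof. by apply/ffunP => t; rewrite !ffunE rmorphM /= !entry_map. Qed.

Lemma map_qprod n (U : tensor F n) : map_tensor (qprod U) = qprod (map_tensor U).
Proof.
have e : map_tensor (qmetric F) = qmetric F'.
  by apply/ffunP => t; rewrite !ffunE rmorph_nat.
rewrite /qprod /symprod -e -map_tprod.
exact: (@map_sym (2 + n) (tprod (qmetric F) U)).
Qed.

Lemma map_symv n (T : tensor F n) :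
  T \in symv F n -> map_tensor T \in symv F' n.
Proof.
by move=> Ts; apply: symvI => t u tu; rewrite !ffunE (symv_perm Ts tu).
Qed.

Lemma map_harmonic n (T : tensor F n) :
  T \in harmonic F n -> map_tensor T \in harmonic F' n.
Proof.
case: n T => [|[|n]] T; try exact: map_symv.
move=> TH; apply/harmonicP; split; first exact/symvP/map_symv/harmonic_symv.
have [_ T0] := harmonicP _ TH; apply/ffunP => t; rewrite !ffunE.
have := congr1 (fun U : tensor F n => phi (U t)) T0.
rewrite !ffunE rmorph0 rmorph_sum /= => e; rewrite -[RHS]e.
by apply: eq_bigr => i _; rewrite ffunE.
Qed.

Lemma map_qmultiples n (T : tensor F n) :
  T \in qmultiples F n -> map_tensor T \in qmultiples F' n.
Proof.
case: n T => [|[|n]] T; try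
  by rewrite !memv0 => /eqP ->; apply/eqP/ffunP => t; rewrite !ffunE rmorph0.
move=> /qmultiplesP [U Us ->]; apply/qmultiplesP.
by exists (map_tensor U); [apply: map_symv | rewrite map_qprod].
Qed.

Hypotheses (realF : formally_real F) (realF' : formally_real F').

(** The image of a decomposition over [F] is a decomposition over [F'], where it is unique as
    well. *)
Lemma map_leading n (T : tensor F n) :
  T \in symv F n -> map_tensor (leading T) = leading (map_tensor T).
Proof.
move=> Ts; have [D DQ e] := leading_rest realF Ts.
rewrite {2}e map_tensorD leading_eq //; last exact: map_qmultiples.
exact/map_harmonic/leading_harmonic.
Qed.

End ScalarExtension.

(** * Rational functions and their values *)

Local Notation "x %:F" := (FracField.tofrac x) : ring_scope.

Lemma fraction_numden (A : idomainType) (x : {fraction A}) :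
  x = (\n_(repr x))%:F / (\d_(repr x))%:F.
Proof.
have dn0 : (\d_(repr x))%:F != 0 by rewrite tofrac_eq0 denom_ratioP.
apply: (mulIf dn0); rewrite divfK // -{1}[x]reprK.
move: (repr x) => y; unlock FracField.tofrac; rewrite -[LHS]FracField.pi_mul.
apply/eqmodP; rewrite /= FracField.equivfE /FracField.mulf.
by rewrite !numden_Ratio ?mulf_neq0 ?oner_eq0 ?denom_ratioP // ?mulr1 ?mul1r mulrC.
Qed.

Lemma divf_mulr (F : fieldType) (a b c : F) : c != 0 -> a / b = (a * c) / (b * c).
Proof. by move=> c0; rewrite -mulf_div divff // mulr1. Qed.

Lemma common_denominator (A : idomainType) (I : finType) (f : I -> {fraction A}) :
  exists D (N : I -> A), D != 0 /\ forall i, f i = (N i)%:F / D%:F.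
Proof.
pose num j := \n_(repr (f j)); pose den j := \d_(repr (f j)).
have den0 j : den j != 0 by exact: denom_ratioP.
exists (\prod_j den j), (fun j => num j * \prod_(k | k != j) den k).
split=> [|i]; first exact/prodf_neq0.
rewrite [LHS]fraction_numden [\prod_j den j](bigD1 i) //= !tofracM; apply: divf_mulr.
by rewrite tofrac_eq0; apply/prodf_neq0.
Qed.

Lemma sum_squares_frac (A : idomainType) (I : finType) (N : I -> A) (D : A) :
  D != 0 -> \sum_i ((N i)%:F / D%:F) * ((N i)%:F / D%:F) = 0 ->
  \sum_i N i * N i = 0.
Proof.
rewrite -tofrac_eq0 => D0 h; apply/eqP; rewrite -tofrac_eq0 (big_morph _ (@tofracD A) (@tofrac0 A)).
rewrite (_ : \sum_i _ = (\sum_i (N i)%:F / D%:F * ((N i)%:F / D%:F)) * (D%:F * D%:F)).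
  by rewrite h mul0r.
rewrite mulr_suml; apply: eq_bigr => j _.
by rewrite tofracM mulf_div divfK // mulf_neq0.
Qed.

(** Over a common denominator this is a vanishing sum of squares of polynomials; its values at real
    points force every numerator to vanish there, hence identically. *)
Lemma fraction_formally_real (R : realDomainType) n :
  formally_real {fraction {mpoly R[n]}}.
Proof.
move=> I f; have [D [N [D0 fN]]] := common_denominator f.
under eq_bigr do rewrite fN; move=> /(sum_squares_frac D0) NN i.
rewrite fN (_ : N i = 0) ?tofrac0 ?mul0r //; apply: mpoly_eq0 => x.
have /eqP := congr1 (meval x) NN; rewrite raddf_sum meval0 psumr_eq0 /=.
  move/allP => /(_ i (mem_index_enum _)); rewrite mevalM mulf_eq0 orbb => /eqP //.
by move=> j _; rewrite mevalM -expr2 sqr_ge0.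
Qed.

Lemma realField_formally_real (R : realFieldType) : formally_real R.
Proof.
move=> I f /eqP; rewrite psumr_eq0 => [/allP h i|i _]; last by rewrite -expr2 sqr_ge0.
by have := h i (mem_index_enum _); rewrite mulf_eq0 orbb => /eqP.
Qed.

(** * Values of rational functions at real points *)

Section Specialization.
Variables (R : realFieldType) (n : nat).
Local Notation K := {fraction {mpoly R[n]}}.
Implicit Types (f g : K) (phi psi : ('I_n -> R) -> R).

Definition frac_cst (c : R) : K := (c%:MP)%:F.

Lemma frac_cst_additive : zmod_morphism frac_cst.
Proof. by move=> a b; rewrite /frac_cst mpolyCB rmorphB. Qed.

Lemma frac_cst_multiplicative : monoid_morphism frac_cst.
Proof.
by split=> [|a b]; rewrite /frac_cst ?mpolyC1 ?rmorph1 // mpolyCM rmorphM.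
Qed.

HB.instance Definition _ := GRing.isZmodMorphism.Build R K frac_cst frac_cst_additive.
HB.instance Definition _ :=
  GRing.isMonoidMorphism.Build R K frac_cst frac_cst_multiplicative.

Section Denominator.
Variable m : {mpoly R[n]}.
Hypothesis m0 : m != 0.

(* phi gives the values of f at the points where m does not vanish. *)
Definition specializes f phi := exists N r,
  f = r%:F / m%:F ^+ N /\ forall h, m.@[h] != 0 -> phi h = r.@[h] / m.@[h] ^+ N.

Let mF0 N : m%:F ^+ N != 0 :> K.
Proof. by rewrite expf_neq0 // tofrac_eq0. Qed.

Lemma specializes_poly p : specializes p%:F (fun h => p.@[h]).
Proof. by exists 0%N, p; split=> [|h _]; rewrite expr0 divr1. Qed.

Lemma specializes_cst c : specializes (frac_cst c) (fun=> c).
Proof. by exists 0%N, c%:MP; split=> [|h _]; rewrite expr0 divr1 ?mevalC. Qed.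

Lemma specializesV : specializes (m%:F)^-1 (fun h => (m.@[h])^-1).
Proof.
by exists 1%N, 1; split=> [|h _]; rewrite expr1 ?tofrac1 ?meval1 mul1r.
Qed.

Lemma specializesD f g phi psi : specializes f phi -> specializes g psi ->
  specializes (f + g) (fun h => phi h + psi h).
Proof.
move=> [N [p [-> hp]]] [N' [q [-> hq]]]; exists (N + N')%N, (p * m ^+ N' + q * m ^+ N).
split=> [|h mh].
  by rewrite tofracD !tofracM !tofracXn exprD addf_div ?mF0.
by rewrite hp // hq // mevalD !mevalM !rmorphXn /= exprD addf_div ?expf_neq0.
Qed.

Lemma specializesM f g phi psi : specializes f phi -> specializes g psi ->
  specializes (f * g) (fun h => phi h * psi h).
Proof.
move=> [N [p [-> hp]]] [N' [q [-> hq]]]; exists (N + N')%N, (p * q).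
split=> [|h mh].
  by rewrite tofracM exprD mulf_div.
by rewrite hp // hq // mevalM exprD mulf_div.
Qed.

Lemma specializes_ext f g phi psi :
  f = g -> phi =1 psi -> specializes f phi -> specializes g psi.
Proof. by move=> -> e [N [p [-> hp]]]; exists N, p; split=> // h mh; rewrite -e hp. Qed.

Lemma specializesN f phi : specializes f phi -> specializes (- f) (fun h => - phi h).
Proof.
move=> hf; have := specializesM (specializes_cst (-1)) hf.
by apply: specializes_ext => [|h]; rewrite ?rmorphN1 mulN1r.
Qed.

Lemma specializesX f phi k : specializes f phi ->
  specializes (f ^+ k) (fun h => phi h ^+ k).
Proof.
move=> hf; elim: k => [|k IHk].
  have := specializes_cst 1.
  by apply: specializes_ext => [|h]; rewrite ?rmorph1 expr0.
have := specializesM hf IHk.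
by apply: specializes_ext => [|h]; rewrite exprS.
Qed.

Lemma specializes_sum I (r : seq I) (P : pred I) (G : I -> K) (H : I -> ('I_n -> R) -> R) :
  (forall i, specializes (G i) (H i)) ->
  specializes (\sum_(i <- r | P i) G i) (fun h => \sum_(i <- r | P i) H i h).
Proof.
move=> hG; elim: r => [|i r IHr].
  have := specializes_cst 0.
  by apply: specializes_ext => [|h]; rewrite ?rmorph0 big_nil.
case Pi: (P i); last first.
  by apply: (specializes_ext _ _ IHr) => [|h]; rewrite big_cons Pi.
by apply: (specializes_ext _ _ (specializesD (hG i) IHr)) => [|h]; rewrite big_cons Pi.
Qed.

Lemma specializes_prod I (r : seq I) (P : pred I) (G : I -> K) (H : I -> ('I_n -> R) -> R) :
  (forall i, specializes (G i) (H i)) ->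
  specializes (\prod_(i <- r | P i) G i) (fun h => \prod_(i <- r | P i) H i h).
Proof.
move=> hG; elim: r => [|i r IHr].
  have := specializes_cst 1.
  by apply: specializes_ext => [|h]; rewrite ?rmorph1 big_nil.
case Pi: (P i); last first.
  by apply: (specializes_ext _ _ IHr) => [|h]; rewrite big_cons Pi.
by apply: (specializes_ext _ _ (specializesM (hG i) IHr)) => [|h]; rewrite big_cons Pi.
Qed.

Lemma specializes_mmap k (v : 'I_k -> K) (phi : 'I_k -> ('I_n -> R) -> R)
    (P : {mpoly R[k]}) :
  (forall i, specializes (v i) (phi i)) ->
  specializes (mmap frac_cst v P) (fun h => P.@[fun i => phi i h]).
Proof.
move=> hv; have := @specializes_sum _ (msupp P) predT
  (fun e => frac_cst P@_e * \prod_i v i ^+ e i)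
  (fun e h => P@_e * \prod_i phi i h ^+ e i) _.
move=> h; apply: (specializes_ext _ _ (h _)).
- by [].
- by move=> x; rewrite mevalE.
move=> e; apply: specializesM; first exact: specializes_cst.
by apply: specializes_prod => i; apply: specializesX.
Qed.

End Denominator.

Section Tensors.
Local Notation specializes1 := (specializes 1).
Implicit Types k l : nat.

Let n10 : (1 : {mpoly R[n]}) != 0. Proof. exact: oner_neq0. Qed.

Lemma specializes1P f phi : specializes1 f phi ->
  exists p, f = p%:F /\ forall h, phi h = p.@[h].
Proof.
move=> [N [p [-> hp]]]; exists p; rewrite tofrac1 expr1n divr1; split=> // h.
by rewrite hp meval1 ?oner_eq0 // expr1n divr1.
Qed.

Lemma specializes1W m f phi : specializes1 f phi -> specializes m f phi.
Proof.
move=> /specializes1P [p [-> hp]].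
by apply: (specializes_ext _ _ (specializes_poly m p)) => // h; rewrite hp.
Qed.

(** The denominator 1 means that components are polynomials: the covariants involve division by
    constants only, and [inv_M12] enters as a denominator in the six invariants alone. *)
Definition tspecializes k (T : tensor K k) (E : ('I_n -> R) -> tensor R k) :=
  forall t, specializes1 (T t) (fun h => E h t).

Lemma tspecializes_entry k (T : tensor K k) E s :
  tspecializes T E -> specializes1 (entry T s) (fun h => entry (E h) s).
Proof. by move=> h; apply: h. Qed.

Lemma tspecializes_sym k (T : tensor K k) E :
  tspecializes T E -> tspecializes (sym T) (fun h => sym (E h)).
Proof.
move=> hT t.
have h := specializesM (specializes_cst 1 k`!%:R^-1)
  (specializes_sum n10 (index_enum _) predT (fun s => hT (permt s t))).
apply: (specializes_ext _ _ h) => [|x]; rewrite symE //.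
by rewrite fmorphV rmorph_nat.
Qed.

Lemma tspecializes_tprod k l (S : tensor K k) (T : tensor K l) E E' :
  tspecializes S E -> tspecializes T E' ->
  tspecializes (tprod S T) (fun h => tprod (E h) (E' h)).
Proof.
move=> hS hT t.
have h := specializesM (tspecializes_entry (take k t) hS)
  (tspecializes_entry (drop k t) hT).
by apply: (specializes_ext _ _ h) => [|x]; rewrite ffunE.
Qed.

Lemma tspecializes_contr r k l (S : tensor K k) (T : tensor K l) E E' :
  tspecializes S E -> tspecializes T E' ->
  tspecializes (contr r S T) (fun h => contr r (E h) (E' h)).
Proof.
move=> hS hT t.
have h := specializes_sum n10 (index_enum _) predT (fun u : r.-tuple 'I_3 =>
  specializesM (tspecializes_entry (take (k - r) t ++ u) hS)
    (tspecializes_entry (u ++ drop (k - r) t) hT)).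
by apply: (specializes_ext _ _ h) => [|x]; rewrite ffunE.
Qed.

Lemma specializes_inner k (S T : tensor K k) E E' :
  tspecializes S E -> tspecializes T E' ->
  specializes1 (inner S T) (fun h => inner (E h) (E' h)).
Proof.
by move=> hS hT; apply: specializes_sum => // t; apply: specializesM.
Qed.

Lemma tspecializes_trace13 (T : tensor K 4) E :
  tspecializes T E -> tspecializes (trace13 T) (fun h => trace13 (E h)).
Proof.
move=> hT t.
have h := specializes_sum n10 (index_enum _) predT (fun i : 'I_3 =>
  tspecializes_entry [:: i; tnth t ord0; i; tnth t ord_max] hT).
by apply: (specializes_ext _ _ h) => [|x]; rewrite ffunE.
Qed.

Lemma tspecializes_levi_civita :
  tspecializes (levi_civita K) (fun=> levi_civita R).
Proof.
move=> t; have := specializes_cst 1 (levi_civita R t).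
apply: specializes_ext => //; rewrite !ffunE -det_map_mx; congr (\det _).
by apply/matrixP => i j; rewrite !mxE rmorph_nat.
Qed.

Lemma tspecializes_cross k l (S : tensor K k) (T : tensor K l) E E' :
  tspecializes S E -> tspecializes T E' ->
  tspecializes (cross S T) (fun h => cross (E h) (E' h)).
Proof.
move=> hS hT; apply/tspecializes_sym/tspecializes_contr => //.
by apply: tspecializes_contr => //; apply: tspecializes_levi_civita.
Qed.

Definition basis_tensor k (u : k.-tuple 'I_3) : tensor R k := [ffun t => (t == u)%:R].

Lemma tensor_basis_sum (F : fieldType) k (T : tensor F k) :
  T = \sum_u T u *: [ffun t => (t == u)%:R].
Proof.
apply/ffunP => t; rewrite sum_ffunE (bigD1 t) //= big1 ?addr0 => [|u ut].
  by rewrite !ffunE eqxx [RHS]mulr1.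
by rewrite !ffunE eq_sym (negbTE ut) [LHS]mulr0.
Qed.

Let realR : formally_real R := @realField_formally_real R.
Let realK : formally_real K := @fraction_formally_real R n.

Lemma sym_basis_sum (F : fieldType) k (T : tensor F k) : formally_real F ->
  T \in symv F k -> T = \sum_u T u *: sym [ffun t => (t == u)%:R].
Proof.
move=> realF Ts; rewrite -{1}(sym_id (formally_real_char0 realF) Ts).
rewrite {1}(tensor_basis_sum T).
apply: (big_ind2 (fun x y => sym x = y)) => [|x1 x2 y1 y2 <- <-|u _].
- by rewrite -[X in sym X](scale0r (0 : tensor F k)) symZ scale0r.
- by rewrite symD.
by rewrite symZ.
Qed.

Lemma leading_sum (F : fieldType) k (I : finType) (c : I -> F) (T : I -> tensor F k) t :
  leading (\sum_u c u *: T u) t = \sum_u c u * leading (T u) t.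
Proof.
rewrite /leading linear_sum sum_ffunE; apply: eq_bigr => u _.
by rewrite linearZ ffunE.
Qed.

(** [leading] is linear, and by [map_leading] its values on the symmetrized basis tensors are the
    same real constants over both fields. *)
Lemma tspecializes_leading k (T : tensor K k) E :
  T \in symv K k -> (forall h, E h \in symv R k) ->
  tspecializes T E -> tspecializes (leading T) (fun h => leading (E h)).
Proof.
move=> Ts Es hT t.
have h := specializes_sum n10 (index_enum _) predT (fun u =>
  specializesM (hT u) (specializes_cst 1 (leading (sym (basis_tensor u)) t))).
apply: (specializes_ext _ _ h) => [|x].
  rewrite [in RHS](sym_basis_sum realK Ts) leading_sum.
  apply: eq_bigr => u _; congr (_ * _).
  have -> : [ffun t => (t == u)%:R] = map_tensor frac_cst (basis_tensor u) :> tensor K k.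
    by apply/ffunP => s; rewrite !ffunE rmorph_nat.
  by rewrite -map_sym -(map_leading _ realR realK) ?sym_in_symv // ffunE.
by rewrite [in RHS](sym_basis_sum realR (Es x)) leading_sum.
Qed.

Lemma tspecializes_harmprod k l (S : tensor K k) (T : tensor K l) E E' :
  tspecializes S E -> tspecializes T E' ->
  tspecializes (harmprod S T) (fun h => harmprod (E h) (E' h)).
Proof.
move=> hS hT; apply: tspecializes_leading; first exact: sym_in_symv.
  by move=> h; apply: sym_in_symv.
exact/tspecializes_sym/tspecializes_tprod.
Qed.

Lemma tspecializes_harmpow (w : tensor K 1) E k :
  tspecializes w E -> tspecializes (harmpow w k) (fun h => harmpow (E h) k).
Proof.
move=> hw; elim: k => [|k IHk] /=; last exact: (tspecializes_harmprod hw IHk).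
move=> t; have := specializes_cst 1 1; apply: specializes_ext => [|x].
  by rewrite ffunE rmorph1.
by rewrite ffunE.
Qed.

End Tensors.

(** * Values of the covariants and of the six invariants *)

Section Covariants.
Variables (H : tensor K 4) (E : ('I_n -> R) -> tensor R 4).
Hypothesis HE : tspecializes H E.

Lemma tspecializes_d2 : tspecializes (cov_d2 H) (fun h => cov_d2 (E h)).
Proof.
exact: (tspecializes_trace13 (T := contr 2 H H) (tspecializes_contr (r := 2) HE HE)).
Qed.

Let d2S := tspecializes_d2.

Lemma tspecializes_T6 : tspecializes (cov_T6 H) (fun h => cov_T6 (E h)).
Proof.
exact: (@tspecializes_cross 2 2 _ _ _ _ (tspecializes_contr (r := 1) d2S d2S) d2S).
Qed.

Let T6S := tspecializes_T6.

Lemma specializes_M12 : specializes 1 (inv_M12 H) (fun h => inv_M12 (E h)).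
Proof. exact: (specializes_inner T6S T6S). Qed.

Lemma tspecializes_w7 : tspecializes (cov_w7 H) (fun h => cov_w7 (E h)).
Proof. exact: (tspecializes_contr (r := 3) HE T6S). Qed.

Let w7S := tspecializes_w7.
Let TTS := tspecializes_contr (r := 1) T6S T6S.

Lemma tspecializes_leadTT :
  tspecializes (leading (symcontr 1 (cov_T6 H) (cov_T6 H)))
    (fun h => leading (symcontr 1 (cov_T6 (E h)) (cov_T6 (E h)))).
Proof.
apply: tspecializes_leading; first exact: sym_in_symv.
  by move=> h; apply: sym_in_symv.
exact: (tspecializes_sym TTS).
Qed.

Let LS := tspecializes_leadTT.

Lemma tspecializes_J18 : tspecializes (cov_J18 H) (fun h => cov_J18 (E h)).
Proof. exact: (@tspecializes_cross 4 3 _ _ _ _ LS T6S). Qed.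

Let JS := tspecializes_J18.

Variable m : {mpoly R[n]}.
Hypothesis m0 : m != 0.
Hypothesis Hm : inv_M12 H = m%:F.
Hypothesis Em : forall h, inv_M12 (E h) = m.@[h].

Lemma specializes_M12V k :
  specializes m (inv_M12 H ^- k) (fun h => inv_M12 (E h) ^- k).
Proof.
have := specializesX k (specializesV m).
by apply: specializes_ext => [|h]; rewrite ?Hm ?Em exprVn.
Qed.

Let wS k := tspecializes_harmpow (k := k) w7S.
Let innerS k (S T : tensor K k) E1 E2 :
  tspecializes S E1 -> tspecializes T E2 ->
  specializes m (inner S T) (fun h => inner (E1 h) (E2 h)).
Proof. by move=> hS hT; apply/specializes1W/specializes_inner. Qed.

Lemma specializes_natV k : specializes m (k%:R^-1 : K) (fun=> k%:R^-1).
Proof.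
have := specializes_cst m k%:R^-1.
by apply: specializes_ext; rewrite // fmorphV rmorph_nat.
Qed.

Lemma specializes_nat k : specializes m (k%:R : K) (fun=> k%:R).
Proof.
by have := specializes_cst m k%:R; apply: specializes_ext; rewrite // rmorph_nat.
Qed.

Lemma specializes_i2 : specializes m (inv_i2 H) (fun h => inv_i2 (E h)).
Proof. exact: (specializesM (innerS w7S w7S) (specializes_M12V 1)). Qed.

Lemma specializes_i3 : specializes m (inv_i3 H) (fun h => inv_i3 (E h)).
Proof. exact: (specializesM (innerS (@wS 3) T6S) (specializes_M12V 2)). Qed.

Lemma specializes_i4 : specializes m (inv_i4 H) (fun h => inv_i4 (E h)).
Proof. exact: (specializesM (innerS (@wS 4) TTS) (specializes_M12V 3)). Qed.

Let natMV a k : specializes m ((a%:R * inv_M12 H ^+ k)^-1)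
  (fun h => (a%:R * inv_M12 (E h) ^+ k)^-1).
Proof.
have := specializesM (specializes_natV a) (specializes_M12V k).
by apply: specializes_ext => [|h]; rewrite invfM.
Qed.

Lemma specializes_k4 : specializes m (inv_k4 H) (fun h => inv_k4 (E h)).
Proof.
exact: (specializesD m0 (specializesD m0
  (specializesM (natMV 5 3) (innerS (tspecializes_harmprod HE (@wS 3))
    (tspecializes_harmprod T6S LS)))
  (specializesM (natMV 7 3) (innerS (@tspecializes_cross 4 3 _ _ _ _ HE (@wS 3)) JS)))
  (specializesN (specializesM (specializesM (specializes_nat 7) (natMV 99 2))
    (innerS (tspecializes_contr (r := 2) HE (@wS 3)) T6S)))).
Qed.

Lemma specializes_k8 : specializes m (inv_k8 H) (fun h => inv_k8 (E h)).
Proof.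
exact: (specializesM (specializesM
  (innerS (@tspecializes_cross 1 4 _ _ _ _ w7S HE) TTS) (innerS (@wS 6) JS))
  (specializes_M12V 6)).
Qed.

Lemma specializes_k9 : specializes m (inv_k9 H) (fun h => inv_k9 (E h)).
Proof.
exact: (specializesM
  (specializesM (innerS (@wS 6) JS) (specializes_M12V 5))
  (specializesD m0
    (specializesM (specializesM (specializes_nat 36) (specializes_M12V 2))
      (innerS (tspecializes_harmprod (@wS 2) HE) JS))
    (specializesM (specializesM (specializes_nat 28) (natMV 5 1))
      (innerS (@tspecializes_cross 3 1 _ _ _ _
        (tspecializes_contr (r := 1) HE w7S) w7S) T6S)))).
Qed.

End Covariants.
End Specialization.

(** * Action of rotations *)

Section RotationAction.
Variable R : realType.
Local Notation tensor := (tensor R).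
Implicit Types m n r : nat.

Lemma entry_ext_cat m n (S T : tensor (m + n)) :
  (forall a b, size a = m -> size b = n -> entry S (a ++ b) = entry T (a ++ b)) ->
  S = T.
Proof.
move=> h; apply: entry_ext => s sz; rewrite -(cat_take_drop m s).
by apply: h; rewrite ?size_drop ?sz ?addKn // size_takel // sz leq_addr.
Qed.

Section Weights.
Variable g : 'M[R]_3.

(** The entries of a tensor power of [g], indexed by lists so that they factor along
    concatenations. *)
Definition weight (s u : seq 'I_3) : R := \prod_(p <- zip s u) g p.1 p.2.

Lemma weight_cat a b p q : size a = size p ->
  weight (a ++ b) (p ++ q) = weight a p * weight b q.
Proof. by move=> e; rewrite /weight zip_cat // big_cat. Qed.

Lemma weight_cons i s j u : weight (i :: s) (j :: u) = g i j * weight s u.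
Proof. by rewrite /weight big_cons. Qed.

Lemma weight_nil u : weight [::] u = 1.
Proof. by case: u => [|? ?]; rewrite /weight big_nil. Qed.

Lemma entry_act n (T : tensor n) s : size s = n ->
  entry (act g T) s = \sum_(u : n.-tuple 'I_3) weight s u * entry T u.
Proof.
move/eqP => sz; rewrite -[s]/(tval (Tuple sz)) entryE ffunE.
apply: eq_bigr => u _; rewrite entryE /weight; congr (_ * _).
rewrite -[zip _ _]/(tval (zip_tuple (Tuple sz) u)) big_tuple.
by apply: eq_bigr => i _; rewrite !(tnth_nth (ord0, ord0)) nth_zip ?size_tuple //= !(tnth_nth ord0).
Qed.

Lemma weight_act_entry m n k (T : tensor k) a b :
  k = (m + n)%N -> size a = m -> size b = n -> entry (act g T) (a ++ b) =
  \sum_(p : m.-tuple 'I_3) weight a p *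
    \sum_(q : n.-tuple 'I_3) weight b q * entry T (p ++ q).
Proof.
move=> ek sa sb; rewrite entry_act ?size_cat ?sa ?sb //.
rewrite (big_tuple_catE (fun u => weight (a ++ b) u * entry T u) ek).
apply: eq_bigr => p _; rewrite mulr_sumr; apply: eq_bigr => q _.
by rewrite weight_cat ?size_tuple // mulrA.
Qed.

End Weights.

Section Orthogonal.
Variable g : 'M[R]_3.
Hypothesis gO : g *m g^T = 1%:M.

Lemma orthogonal_tr : g^T *m g = 1%:M.
Proof. exact: mulmx1C. Qed.

Lemma orthogonal_col x y : \sum_i g i x * g i y = (x == y)%:R.
Proof.
have := congr1 (fun M : 'M[R]_3 => M x y) orthogonal_tr; rewrite !mxE => <-.
by apply: eq_bigr => i _; rewrite mxE.
Qed.

Lemma orthogonal_row x y : \sum_i g x i * g y i = (x == y)%:R.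
Proof.
have := congr1 (fun M : 'M[R]_3 => M x y) gO; rewrite !mxE => <-.
by apply: eq_bigr => i _; rewrite mxE.
Qed.

Lemma weight_orthogonal n u u' : size u = n -> size u' = n ->
  \sum_(t : n.-tuple 'I_3) weight g t u * weight g t u' = (u == u')%:R.
Proof.
elim: n u u' => [|n IHn] u u'.
  move=> /size0nil -> /size0nil ->.
  by rewrite (big_tuple0 (fun t => weight g t [::] * weight g t [::])) weight_nil mulr1.
case: u => [|x u] //= [su]; case: u' => [|y u'] //= [su'].
rewrite (big_tuple_cons n (fun t => weight g t (x :: u) * weight g t (y :: u'))).
rewrite eqseq_cons -mulnb natrM -IHn // -orthogonal_col big_distrlr /=.
apply: eq_bigr => i _; apply: eq_bigr => t _.
by rewrite !weight_cons mulrACA.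
Qed.

(** Tensor powers of an orthogonal matrix are orthogonal. The arguments are functions of lists, so
    that [act_contr] can apply this to the contracted indices while the free ones stay fixed. *)
Lemma weight_isometry n (x y : seq 'I_3 -> R) :
  \sum_(t : n.-tuple 'I_3) (\sum_(u : n.-tuple 'I_3) weight g t u * x u) *
     (\sum_(u : n.-tuple 'I_3) weight g t u * y u) =
  \sum_(u : n.-tuple 'I_3) x u * y u.
Proof.
have E (u u' : n.-tuple 'I_3) : \sum_(t : n.-tuple 'I_3)
    (weight g t u * x u) * (weight g t u' * y u') = (u == u')%:R * (x u * y u').
  rewrite -[u == u']/(tval u == u') -(@weight_orthogonal n) ?size_tuple //.
  by rewrite mulr_suml; apply: eq_bigr => t _; rewrite mulrACA.
under eq_bigr do rewrite big_distrlr /=.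
rewrite exchange_big; apply: eq_bigr => u _ /=.
rewrite exchange_big /= (bigD1 u) //= E eqxx mul1r big1 ?addr0 // => u' ne.
by rewrite E eq_sym (negbTE ne) mul0r.
Qed.

Lemma actD n (S T : tensor n) : act g (S + T) = act g S + act g T.
Proof.
by apply/ffunP => t; rewrite !ffunE -big_split; apply: eq_bigr => u _; rewrite ffunE mulrDr.
Qed.

Lemma actZ n c (T : tensor n) : act g (c *: T) = c *: act g T.
Proof.
apply/ffunP => t; rewrite !ffunE [RHS]mulr_sumr.
by apply: eq_bigr => u _; rewrite ffunE [LHS]mulrCA.
Qed.

Lemma act_inner n (S T : tensor n) : inner (act g S) (act g T) = inner S T.
Proof.
rewrite !innerE -[RHS](weight_isometry n (entry S) (entry T)).
by apply: eq_bigr => t _; rewrite !entry_act ?size_tuple.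
Qed.

Lemma act_contr r m n (S : tensor m) (T : tensor n) : (r <= m)%N -> (r <= n)%N ->
  act g (contr r S T) = contr r (act g S) (act g T).
Proof.
move=> rm rn; apply: entry_ext_cat => a b sa sb.
rewrite entry_contr // (weight_act_entry g _ erefl sa sb).
have E1 (k : r.-tuple _) : entry (act g S) (a ++ tval k) = \sum_(p : (m - r).-tuple 'I_3)
    weight g a p * \sum_(l : r.-tuple 'I_3) weight g (tval k) l * entry S (p ++ l).
  by apply: (@weight_act_entry _ (m - r) r); rewrite ?subnK ?size_tuple.
have E2 (k : r.-tuple _) : entry (act g T) (tval k ++ b) = \sum_(q : (n - r).-tuple 'I_3)
    weight g b q * \sum_(l : r.-tuple 'I_3) weight g (tval k) l * entry T (l ++ q).
  rewrite (@weight_act_entry _ r (n - r)) ?size_tuple ?subnKC //.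
  under eq_bigr do rewrite mulr_sumr.
  rewrite exchange_big; apply: eq_bigr => q _; rewrite mulr_sumr.
  by apply: eq_bigr => l _; rewrite mulrCA.
under [RHS]eq_bigr => k _ do rewrite (E1 k) (E2 k) big_distrlr /=.
rewrite [RHS]exchange_big; apply: eq_bigr => p _ /=.
rewrite [RHS]exchange_big mulr_sumr; apply: eq_bigr => q _ /=.
rewrite entry_contr ?size_tuple //.
rewrite -(weight_isometry r (fun l => entry S (p ++ l)) (fun l => entry T (l ++ q))).
by rewrite mulrA mulr_sumr; apply: eq_bigr => k _; rewrite mulrACA.
Qed.

Lemma act_tprod m n (S : tensor m) (T : tensor n) :
  act g (tprod S T) = tprod (act g S) (act g T).
Proof.
apply: entry_ext_cat => a b sa sb; rewrite entry_tprod //.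
rewrite (weight_act_entry g _ erefl sa sb) !entry_act // big_distrlr /=.
apply: eq_bigr => p _; rewrite mulr_sumr; apply: eq_bigr => q _.
by rewrite entry_tprod ?size_tuple // mulrACA mulrA.
Qed.

Lemma act_permute n (s : 'S_n) (T : tensor n) :
  act g (permute s T) = permute s (act g T).
Proof.
apply/ffunP => t; rewrite permuteE !ffunE.
rewrite [RHS](reindex (permt s)) /=; last exact/onW_bij/permt_bij.
apply: eq_bigr => u _; rewrite permuteE; congr (_ * _).
rewrite (reindex_inj (@perm_inj _ s)) /=.
by apply: eq_bigr => i _; rewrite !tnth_mktuple.
Qed.

Lemma act_sym n (T : tensor n) : act g (sym T) = sym (act g T).
Proof.
have symE' (U : tensor n) : sym U = n`!%:R^-1 *: \sum_(s : 'S_n) permute s U.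
  apply/ffunP => t; rewrite symE ffunE sum_ffunE; congr (_ * _).
  by apply: eq_bigr => s _; rewrite permuteE.
rewrite !symE' actZ; congr (_ *: _).
apply: (big_ind2 (fun x y => act g x = y)) => [|x1 x2 y1 y2 <- <-|s _].
- by rewrite -[X in act g X](scale0r (0 : tensor n)) actZ scale0r.
- exact: actD.
exact: act_permute.
Qed.

Lemma act_symv n (T : tensor n) : T \in symv R n -> act g T \in symv R n.
Proof. by move=> /symvP Ts; apply/symvP => s; rewrite -act_permute Ts. Qed.

Lemma act_trace12 n (T : tensor n.+2) : trace12 (act g T) = act g (trace12 T).
Proof.
apply: entry_ext => s sz; rewrite entry_trace12 // entry_act //.
have E i : entry (act g T) ([:: i; i] ++ s) = \sum_x \sum_y g i x * g i y *
    \sum_(q : n.-tuple 'I_3) weight g s q * entry T ([:: x; y] ++ q).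
  rewrite (@weight_act_entry _ 2 n) //.
  rewrite (big_tuple2 (fun p => weight g [:: i; i] p *
    \sum_(q : n.-tuple 'I_3) weight g s q * entry T (p ++ q))).
  apply: eq_bigr => x _; apply: eq_bigr => y _.
  by rewrite !weight_cons weight_nil mulr1.
under eq_bigr => i _ do rewrite (E i).
rewrite exchange_big /=.
under eq_bigr do rewrite exchange_big /=.
under eq_bigr do under eq_bigr do rewrite -mulr_suml orthogonal_col.
transitivity (\sum_x \sum_(q : n.-tuple 'I_3) weight g s q * entry T ([:: x; x] ++ q)).
  apply: eq_bigr => x _; rewrite (bigD1 x) //= eqxx mul1r [X in _ + X]big1 ?addr0 //.
  by move=> y /negbTE ne; rewrite eq_sym ne mul0r.
rewrite exchange_big; apply: eq_bigr => q _.
by rewrite entry_trace12 ?size_tuple // mulr_sumr.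
Qed.

Lemma act_qmetric : act g (qmetric R) = qmetric R.
Proof.
apply/ffunP => t; rewrite -[LHS]entryE entry_act ?size_tuple //.
rewrite (big_tuple2 (fun u => weight g t u * entry (qmetric R) u)).
case: t => [[|i [|j [|k t]]]] // sz.
rewrite ffunE !(tnth_nth ord0) /= -orthogonal_row; apply: eq_bigr => x _.
rewrite (bigD1 x) //= big1 ?addr0 => [|y yx].
  rewrite (entryE (qmetric R) [tuple x; x]) ffunE !(tnth_nth ord0) /= eqxx.
  by rewrite !weight_cons weight_nil !mulr1.
rewrite (entryE (qmetric R) [tuple x; y]) ffunE !(tnth_nth ord0) /=.
by rewrite eq_sym (negbTE yx) mulr0.
Qed.

Lemma act_qprod n (U : tensor n) : act g (qprod U) = qprod (act g U).
Proof.
rewrite /qprod /symprod -{2}act_qmetric -act_tprod.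
exact: (@act_sym (2 + n) (tprod (qmetric R) U)).
Qed.

Lemma act_harmonic n (T : tensor n) :
  T \in harmonic R n -> act g T \in harmonic R n.
Proof.
case: n T => [|[|n]] T; try exact: act_symv.
move=> TH; apply/harmonicP; split; first exact/symvP/act_symv/harmonic_symv.
have [_ T0] := harmonicP _ TH; rewrite act_trace12 T0.
by rewrite -[X in act g X](scale0r (0 : tensor n)) actZ scale0r.
Qed.

Lemma act_qmultiples n (T : tensor n) :
  T \in qmultiples R n -> act g T \in qmultiples R n.
Proof.
case: n T => [|[|n]] T; try
  by rewrite !memv0 => /eqP ->; rewrite -[X in act g X](scale0r 0) actZ scale0r.
move=> /qmultiplesP [U Us ->]; apply/qmultiplesP.
by exists (act g U); [apply: act_symv | rewrite act_qprod].
Qed.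

Let realR : formally_real R := @realField_formally_real R.

Lemma act_leading n (T : tensor n) :
  T \in symv R n -> act g (leading T) = leading (act g T).
Proof.
move=> Ts; have [D DQ e] := leading_rest realR Ts.
rewrite {2}e actD leading_eq //; last exact: act_qmultiples.
exact/act_harmonic/leading_harmonic.
Qed.

Lemma act_harmprod m n (S : tensor m) (T : tensor n) :
  act g (harmprod S T) = harmprod (act g S) (act g T).
Proof. by rewrite act_leading ?sym_in_symv // act_sym act_tprod. Qed.

Lemma act_harmpow (w : tensor 1) k : act g (harmpow w k) = harmpow (act g w) k.
Proof.
elim: k => [|k IHk] /=; last by rewrite -IHk -[RHS]act_harmprod.
apply/ffunP => t; rewrite -[LHS]entryE entry_act ?size_tuple //.
rewrite (big_tuple0 (fun u => weight g t u * entry _ u)).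
by rewrite [t]tuple0 weight_nil mul1r /entry !ffunE.
Qed.

Lemma act_trace13 (T : tensor 4) : trace13 (act g T) = act g (trace13 T).
Proof.
apply: entry_ext => -[|i [|j []]] // _.
pose G x y (a b : 'I_3) := g x a * g y b.
have E k : entry (act g T) [:: k; i; k; j] =
    \sum_a \sum_b \sum_c \sum_d g k a * g k c * (g i b * g j d * entry T [:: a; b; c; d]).
  rewrite entry_act // (big_tuple_cons 3 (fun u => weight g _ u * entry T u)).
  apply: eq_bigr => a _.
  rewrite (big_tuple_cons 2 (fun u => weight g _ (a :: u) * entry T (a :: u))).
  apply: eq_bigr => b _.
  rewrite (big_tuple2 (fun u => weight g _ [:: a, b & u] * entry T [:: a, b & u])).
  apply: eq_bigr => c _; apply: eq_bigr => d _.
  rewrite !weight_cons weight_nil; ring.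
have trE (U : tensor 4) x y : entry (trace13 U) [:: x; y] = \sum_k entry U [:: k; x; k; y].
  by rewrite (entryE (trace13 U) [tuple x; y]) ffunE.
rewrite trE entry_act // (big_tuple2 (fun u => weight g _ u * entry _ u)).
under eq_bigr => k _ do rewrite (E k).
rewrite exchange_big /=.
under eq_bigr do rewrite exchange_big /=.
under eq_bigr do under eq_bigr do rewrite exchange_big /=.
under eq_bigr do under eq_bigr do under eq_bigr do rewrite exchange_big /=.
rewrite exchange_big; apply: eq_bigr => b _ /=.
transitivity (\sum_a \sum_d g i b * g j d * entry T [:: a; b; a; d]).
  apply: eq_bigr => a _; rewrite exchange_big; apply: eq_bigr => d _ /=.
  rewrite (bigD1 a) //= [X in _ + X]big1 ?addr0 => [|c ca].
    by rewrite -mulr_suml orthogonal_col eqxx mul1r.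
  by rewrite -mulr_suml orthogonal_col eq_sym (negbTE ca) mul0r.
rewrite exchange_big; apply: eq_bigr => d _ /=.
by rewrite trE !weight_cons weight_nil mulr1 mulr_sumr.
Qed.

(** The rows of [M t] are the basis vectors with indices [t]. Expanding the determinant of
    [M t *m g] yields the action of [g], and [\det g = 1] makes it the determinant of [M t]. Here
    rotations are told apart from reflections. *)
Lemma act_levi_civita : \det g = 1 -> act g (levi_civita R) = levi_civita R.
Proof.
move=> g1; apply/ffunP => t; rewrite !ffunE.
pose M (s : 3.-tuple 'I_3) : 'M[R]_3 := \matrix_(a, b) (tnth s a == b)%:R.
have rowM s (A : 'M[R]_3) a b : (M s *m A) a b = A (tnth s a) b.
  rewrite !mxE (bigD1 (tnth s a)) //= mxE eqxx mul1r big1 ?addr0 // => c ne.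
  by rewrite mxE eq_sym (negbTE ne) mul0r.
rewrite -/(M t) (_ : \det (M t) = \det (M t *m g)); last by rewrite det_mulmx g1 mulr1.
rewrite [RHS]/determinant.
under eq_bigr => u _ do rewrite ffunE -/(M u) [\det (M u)]/determinant mulr_sumr.
rewrite exchange_big; apply: eq_bigr => s _ /=.
under eq_bigr do rewrite mulrCA -big_split /=.
rewrite -mulr_sumr; congr (_ * _).
(* For a fixed permutation [s] the sum over all index triples factors over the three positions, and
   in each of them only [j = s a] contributes. *)
transitivity (\prod_(a < 3) \sum_(j < 3) g (tnth t a) j * (j == s a)%:R).
  rewrite bigA_distr_bigA /=.
  rewrite (reindex (fun f : {ffun 'I_3 -> 'I_3} => [tuple f a | a < 3])) /=.
    apply: eq_bigr => f _; apply: eq_bigr => a _.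
    by rewrite mxE tnth_mktuple.
  exists (fun u : 3.-tuple 'I_3 => [ffun a => tnth u a]) => [f _|u _].
    by apply/ffunP => a; rewrite ffunE tnth_mktuple.
  by apply: eq_from_tnth => a; rewrite tnth_mktuple ffunE.
apply: eq_bigr => a _; rewrite rowM (bigD1 (s a)) //= eqxx mulr1 big1 ?addr0 //.
by move=> j /negbTE ->; rewrite mulr0.
Qed.

End Orthogonal.

Section Invariance.
Variable g : 'M[R]_3.
Hypothesis gSO : SO3 g.
Let gO := gSO.1.

Lemma act_cross m n (S : tensor m) (T : tensor n) : (0 < m)%N -> (0 < n)%N ->
  act g (cross S T) = cross (act g S) (act g T).
Proof.
move=> m0 n0; have e : (0 < n - 1 + (3 - 1))%N by rewrite addn2.
rewrite act_sym // act_contr // act_contr // act_levi_civita //.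
by case: gSO.
Qed.

Variable H : tensor 4.

Lemma act_d2 : cov_d2 (act g H) = act g (cov_d2 H).
Proof.
rewrite /cov_d2 -act_trace13 //; congr trace13.
by rewrite [RHS](@act_contr _ gO 2 4 4).
Qed.

Lemma act_T6 : cov_T6 (act g H) = act g (cov_T6 H).
Proof.
by rewrite /cov_T6 act_d2 [RHS](@act_cross 2 2) // (@act_contr _ gO 1 2 2).
Qed.

Lemma act_M12 : inv_M12 (act g H) = inv_M12 H.
Proof. by rewrite /inv_M12 act_T6 /sqnorm act_inner. Qed.

Lemma act_w7 : cov_w7 (act g H) = act g (cov_w7 H).
Proof. by rewrite /cov_w7 act_T6 [RHS](@act_contr _ gO 3 4 3). Qed.

Lemma act_TT :
  contr 1 (cov_T6 (act g H)) (cov_T6 (act g H)) = act g (contr 1 (cov_T6 H) (cov_T6 H)).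
Proof. by rewrite act_T6 (@act_contr _ gO 1 3 3). Qed.

Lemma act_leadTT :
  leading (symcontr 1 (cov_T6 (act g H)) (cov_T6 (act g H))) =
  act g (leading (symcontr 1 (cov_T6 H) (cov_T6 H))).
Proof. by rewrite /symcontr act_TT -act_sym // act_leading // sym_in_symv. Qed.

Lemma act_J18 : cov_J18 (act g H) = act g (cov_J18 H).
Proof. by rewrite /cov_J18 act_leadTT act_T6 [RHS](@act_cross 4 3). Qed.

Let innerA k (S T : tensor k) S' T' :
  S' = act g S -> T' = act g T -> inner S' T' = inner S T.
Proof. by move=> -> ->; apply: act_inner. Qed.

Let wA k : harmpow (cov_w7 (act g H)) k = act g (harmpow (cov_w7 H) k).
Proof. by rewrite act_w7 act_harmpow. Qed.

Lemma act_i2 : inv_i2 (act g H) = inv_i2 H.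
Proof.
exact: (f_equal2 (fun x y => x / y) (innerA act_w7 act_w7) act_M12).
Qed.

Lemma act_i3 : inv_i3 (act g H) = inv_i3 H.
Proof.
exact: (f_equal2 (fun x y => x / y ^+ 2) (innerA (wA 3) act_T6) act_M12).
Qed.

Lemma act_i4 : inv_i4 (act g H) = inv_i4 H.
Proof.
exact: (f_equal2 (fun x y => x / y ^+ 3) (innerA (wA 4) act_TT) act_M12).
Qed.

Lemma act_k4 : inv_k4 (act g H) = inv_k4 H.
Proof.
have e1 : harmprod (act g H) (harmpow (cov_w7 (act g H)) 3) =
    act g (harmprod H (harmpow (cov_w7 H) 3)) by rewrite wA act_harmprod.
have e2 : harmprod (cov_T6 (act g H))
      (leading (symcontr 1 (cov_T6 (act g H)) (cov_T6 (act g H)))) =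
    act g (harmprod (cov_T6 H) (leading (symcontr 1 (cov_T6 H) (cov_T6 H)))).
  by rewrite act_leadTT act_T6 act_harmprod.
have e3 : cross (act g H) (harmpow (cov_w7 (act g H)) 3) =
    act g (cross H (harmpow (cov_w7 H) 3)) by rewrite wA [RHS]act_cross.
have e4 : contr 2 (act g H) (harmpow (cov_w7 (act g H)) 3) =
    act g (contr 2 H (harmpow (cov_w7 H) 3)) by rewrite wA [RHS]act_contr.
exact: (f_equal2 (fun x y => x - y)
  (f_equal2 (fun x y => x + y)
    (f_equal2 (fun x y => (5%:R * x ^+ 3)^-1 * y) act_M12 (innerA e1 e2))
    (f_equal2 (fun x y => (7%:R * x ^+ 3)^-1 * y) act_M12 (innerA e3 act_J18)))
  (f_equal2 (fun x y => 7%:R / (99%:R * x ^+ 2) * y) act_M12 (innerA e4 act_T6))).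
Qed.

Lemma act_k8 : inv_k8 (act g H) = inv_k8 H.
Proof.
have e1 : cross (cov_w7 (act g H)) (act g H) = act g (cross (cov_w7 H) H).
  by rewrite act_w7 [RHS]act_cross.
exact: (f_equal2 (fun x y => x / y ^+ 6)
  (f_equal2 (fun x y => x * y) (innerA e1 act_TT) (innerA (wA 6) act_J18)) act_M12).
Qed.

Lemma act_k9 : inv_k9 (act g H) = inv_k9 H.
Proof.
have e1 : harmprod (harmpow (cov_w7 (act g H)) 2) (act g H) =
    act g (harmprod (harmpow (cov_w7 H) 2) H) by rewrite wA act_harmprod.
have e2 : cross (contr 1 (act g H) (cov_w7 (act g H))) (cov_w7 (act g H)) =
    act g (cross (contr 1 H (cov_w7 H)) (cov_w7 H)).
  by rewrite act_w7 [RHS]act_cross // act_contr.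
exact: (f_equal2 (fun x y => x * y)
  (f_equal2 (fun x y => x / y ^+ 5) (innerA (wA 6) act_J18) act_M12)
  (f_equal2 (fun x y => x + y)
    (f_equal2 (fun x y => 36%:R / x ^+ 2 * y) act_M12 (innerA e1 act_J18))
    (f_equal2 (fun x y => 28%:R / (5%:R * x) * y) act_M12 (innerA e2 act_T6)))).
Qed.

End Invariance.
End RotationAction.

(** * The generic tensor, its real points, and pullbacks by rotations *)

Section GenericTensor.
Variable R : realType.
Local Notation H4 := (harmonic R 4).
Local Notation dimH4 := (\dim H4).
Local Notation basisH4 := (vbasis H4).
Local Notation K := (ratfun R).
Implicit Types h : 'I_dimH4 -> R.

Definition point h : tensor R 4 := \sum_i h i *: basisH4`_i.

Lemma point_harmonic h : point h \in H4.
Proof.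
apply: memv_suml => i _; apply: memvZ; apply: vbasis_mem.
by apply: mem_nth; rewrite size_tuple.
Qed.

Lemma point_coord T : T \in H4 -> point (fun i => coord basisH4 i T) = T.
Proof. by move/coord_vbasis => {2}->. Qed.

Lemma coord_point h i : coord basisH4 i (point h) = h i.
Proof.
rewrite /point linear_sum (bigD1 i) //= big1 ?addr0 => [|j ji].
  by rewrite linearZ /= coord_free ?eqxx ?[LHS]mulr1 // (basis_free (vbasisP _)).
rewrite linearZ /= coord_free ?(basis_free (vbasisP _)) //.
by rewrite (negbTE ji) [LHS]mulr0.
Qed.

Lemma tspecializes_generic : tspecializes (generic R : tensor K 4) point.
Proof.
move=> t.
have h := specializes_sum (oner_neq0 _) (index_enum _) predT (fun i : 'I_dimH4 =>
  specializesM (specializes_cst 1 (basisH4`_i t)) (specializes_poly 1 'X_i)).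
apply: (specializes_ext _ _ h) => [|x]; first by rewrite ffunE.
rewrite /point sum_ffunE; apply: eq_bigr => i _.
by rewrite ffunE mevalXU [RHS]mulrC.
Qed.

Section Pullback.
Variable g : 'M[R]_3.
Hypothesis gSO : SO3 g.
Let gO := gSO.1.

Definition act_point h (i : 'I_dimH4) : R := \sum_(j < dimH4) coord basisH4 i (act g basisH4`_j) * h j.

Lemma act_pointE h : point (act_point h) = act g (point h).
Proof.
rewrite -[RHS]point_coord ?act_harmonic ?point_harmonic //.
have e : act g (point h) = \sum_(j < dimH4) h j *: act g basisH4`_j.
  apply: (big_ind2 (fun x y => act g x = y)) => [|x1 x2 y1 y2 <- <-|j _].
  - by rewrite -[X in act g X](scale0r (0 : tensor R 4)) actZ scale0r.
  - exact: actD.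
  exact: actZ.
congr point; apply: funext => i; rewrite e /act_point.
by rewrite linear_sum; apply: eq_bigr => j _; rewrite linearZ [RHS]mulrC.
Qed.

Definition act_poly (p : {mpoly R[dimH4]}) : {mpoly R[dimH4]} :=
  p \mPo [tuple \sum_(j < dimH4) (coord basisH4 i (act g basisH4`_j))%:MP * 'X_j | i < dimH4].

Lemma meval_act_poly p h : (act_poly p).@[h] = p.@[act_point h].
Proof.
rewrite comp_mpoly_meval; apply: meval_eq => i; rewrite tnth_mktuple raddf_sum.
by apply: eq_bigr => j _; rewrite /= mevalM mevalC mevalXU.
Qed.

(** Both sides are polynomials, hence equal once they agree at all real points. *)
Lemma rateval_act_coord p : rateval (act_coord g) p = FracField.tofrac (act_poly p).
Proof.
have h : specializes 1 (rateval (act_coord g) p)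
    (fun h => p.@[fun i => act_point h i]).
  apply: (specializes_mmap (oner_neq0 _)) => i.
  apply: (specializes_sum (oner_neq0 _)) => j.
  have hX : specializes 1 (ratcoord j) (fun h => h j).
    by apply: (specializes_ext _ _ (specializes_poly 1 'X_j)) => // x; rewrite mevalXU.
  exact: (specializesM (specializes_cst 1 _) hX).
have [q [-> hq]] := specializes1P h; congr FracField.tofrac.
by apply: mpoly_ext => x; rewrite -hq meval_act_poly.
Qed.

End Pullback.

Lemma SO3_tr (g : 'M[R]_3) : SO3 g -> SO3 g^T.
Proof. by case=> gO g1; split; rewrite ?det_tr // trmxK; apply: mulmx1C. Qed.

Lemma act_mul n (g g' : 'M[R]_3) (T : tensor R n) : act g (act g' T) = act (g *m g') T.
Proof.
apply: entry_ext => s sz; rewrite !entry_act //.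
have wM u : size u = n -> weight (g *m g') s u =
    \sum_(v : n.-tuple 'I_3) weight g s v * weight g' v u.
  move=> su; move: s u sz su => {T}; elim: n => [|n IHn] s u.
    move=> /size0nil -> /size0nil ->; rewrite (big_tuple0 (fun v => weight g [::] v * weight g' v [::])).
    by rewrite !weight_nil mulr1.
  case: s => [|i s] //= [ss]; case: u => [|j u] //= [su].
  rewrite (big_tuple_cons n (fun v => weight g (i :: s) v * weight g' v (j :: u))).
  rewrite weight_cons (IHn s u) // mxE big_distrlr /=; apply: eq_bigr => k _.
  by apply: eq_bigr => v _; rewrite !weight_cons mulrACA.
under [RHS]eq_bigr => u _ do rewrite wM ?size_tuple // mulr_suml.
rewrite [RHS]exchange_big; apply: eq_bigr => v _ /=.
rewrite entry_act ?size_tuple // mulr_sumr.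
by apply: eq_bigr => u _; rewrite mulrA.
Qed.

Lemma act1 n (T : tensor R n) : act 1%:M T = T.
Proof.
apply: entry_ext => s /eqP sz; rewrite -[s]/(tval (Tuple sz)); move: (Tuple sz) => {s sz} t.
rewrite entry_act ?size_tuple // (bigD1 t) //= [X in _ + X]big1 ?addr0 => [|u ut].
  suff -> : weight (1%:M : 'M[R]_3) t t = 1 by rewrite mul1r.
  by elim: (tval t) => [|i s IHs]; rewrite ?weight_nil // weight_cons mxE eqxx mul1r.
suff -> : weight (1%:M : 'M[R]_3) t u = 0 by rewrite mul0r.
have : tval u != tval t by []; have : size (tval t) = size (tval u) by rewrite !size_tuple.
elim: (tval t) (tval u) => [|i s IHs] [|j v] //= [sz].
rewrite weight_cons mxE eqseq_cons negb_and eq_sym; case: eqP => [_ /= vs|_ _].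
  by rewrite IHs ?mulr0.
by rewrite mul0r.
Qed.

Lemma act_trK n (g : 'M[R]_3) (T : tensor R n) : SO3 g -> act g^T (act g T) = T.
Proof. by case=> gO _; rewrite act_mul (mulmx1C gO) act1. Qed.

Lemma act_pointK (g : 'M[R]_3) h : SO3 g -> act_point g^T (act_point g h) = h.
Proof.
move=> gSO; apply: funext => i; rewrite -[LHS]coord_point -[RHS]coord_point.
by rewrite (act_pointE (SO3_tr gSO)) act_pointE // act_trK.
Qed.

Lemma act_poly_neq0 (g : 'M[R]_3) p : SO3 g -> p != 0 -> act_poly g p != 0.
Proof.
move=> gSO /mpoly_neq0P [x px]; apply/eqP => /(congr1 (meval (act_point g^T x))).
rewrite meval_act_poly meval0 -{1}[g]trmxK (act_pointK _ (SO3_tr gSO)).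
by apply/eqP.
Qed.


Lemma frac_eq (A : idomainType) (a c b d : A) : b != 0 -> d != 0 ->
  (a%:F / b%:F = c%:F / d%:F) <-> a * d = c * b.
Proof.
move=> b0 d0; have bF : b%:F != 0 by rewrite tofrac_eq0.
have dF : d%:F != 0 by rewrite tofrac_eq0.
split=> [/eqP|e].
  by rewrite eqr_div // -!tofracM tofrac_eq => /eqP.
by apply/eqP; rewrite eqr_div // -!tofracM tofrac_eq e.
Qed.

Lemma act_polyM (g : 'M[R]_3) p q : act_poly g (p * q) = act_poly g p * act_poly g q.
Proof. by apply: mpoly_ext => x; rewrite mevalM !meval_act_poly mevalM. Qed.

Lemma act_frac (g : 'M[R]_3) p d p' d' : SO3 g -> d != 0 -> d' != 0 ->
  p' * d = p * d' ->
  (act_poly g p')%:F / (act_poly g d')%:F = (act_poly g p)%:F / (act_poly g d)%:F.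
Proof.
move=> gSO d0 d0' e.
apply/(frac_eq _ _ (act_poly_neq0 gSO d0') (act_poly_neq0 gSO d0)).
by rewrite -!act_polyM e.
Qed.

(** [pullback] is defined on the representative chosen by [repr]. Composition with the invertible
    map [act_point g] keeps denominators nonzero, so by [act_frac] every other representative gives
    the same result. *)
Lemma pullback_frac (g : 'M[R]_3) p d : SO3 g -> d != 0 ->
  pullback g (p%:F / d%:F : K) = (act_poly g p)%:F / (act_poly g d)%:F.
Proof.
move=> gSO d0.
have [f ef] : exists f : K, f = p%:F / d%:F by exists (p%:F / d%:F).
rewrite -ef; have dr0 : \d_(repr f) != 0 by apply: denom_ratioP.
apply: (etrans (f_equal2 (fun x y => x / y) (rateval_act_coord g _)
  (rateval_act_coord g _))).
apply: act_frac => //; apply/(frac_eq _ _ dr0 d0).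
by rewrite -fraction_numden ef.
Qed.

(** Cross-multiplication turns invariance into an identity that holds at every real point, zeros of
    the denominator included. *)
Lemma rational_invariantP (p d : {mpoly R[dimH4]}) : d != 0 ->
  rational_invariant (p%:F / d%:F : K) <->
  forall g, SO3 g -> forall h,
    p.@[act_point g h] * d.@[h] = p.@[h] * d.@[act_point g h].
Proof.
move=> d0; split=> [inv g gSO h|inv g gSO].
  have := inv g gSO; rewrite pullback_frac //.
  move/(frac_eq _ _ (act_poly_neq0 gSO d0) d0)/(congr1 (meval h)).
  by rewrite !mevalM !meval_act_poly.
rewrite pullback_frac //; apply/(frac_eq _ _ (act_poly_neq0 gSO d0) d0).
by apply: mpoly_ext => h; rewrite !mevalM !meval_act_poly inv.
Qed.

End GenericTensor.

(** * Values of the covariants on the slice *)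

Section SymmetricTensors.
Variable R : realFieldType.
Local Notation tensor := (tensor R).
Implicit Types (m n : nat) (f : nat -> nat -> nat -> R) (x : 'I_3 -> R).

Let realR : formally_real R := @realField_formally_real R.
Let char0 := formally_real_char0 realR.

Definition o0 : 'I_3 := Ordinal (isT : (0 < 3)%N).
Definition o1 : 'I_3 := Ordinal (isT : (1 < 3)%N).
Definition o2 : 'I_3 := Ordinal (isT : (2 < 3)%N).

Lemma sum3E (V : nmodType) (F : 'I_3 -> V) : \sum_i F i = F o0 + F o1 + F o2.
Proof.
rewrite !big_ord_recl big_ord0 addr0 addrA; congr (F _ + F _ + F _); exact: val_inj.
Qed.

Lemma ord3P (P : 'I_3 -> Prop) : P o0 -> P o1 -> P o2 -> forall i, P i.
Proof.
move=> P0 P1 P2 [[|[|[|i]]] lti] //.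
- by rewrite (_ : Ordinal lti = o0) //; apply: val_inj.
- by rewrite (_ : Ordinal lti = o1) //; apply: val_inj.
by rewrite (_ : Ordinal lti = o2) //; apply: val_inj.
Qed.

Definition cnt (s : seq 'I_3) (k : nat) := count (fun i : 'I_3 => (i : nat) == k) s.

Lemma cnt_perm s t k : perm_eq s t -> cnt s k = cnt t k.
Proof. by move/seq.permP => e; apply: e. Qed.

Lemma perm_cnt s t : (forall k, cnt s k = cnt t k) -> perm_eq s t.
Proof.
move=> h; apply/allP => i _ /=; rewrite -[count_mem i s]/(count _ s).
have e u : count_mem i u = cnt u i by apply: eq_count => j /=; rewrite -val_eqE.
by rewrite !e h.
Qed.

Lemma cnt_size s : (cnt s 0 + cnt s 1 + cnt s 2)%N = size s.
Proof.
elim: s => //= i s <-; rewrite /cnt /=; elim/ord3P: i => /=;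
  by rewrite ?add0n ?add1n ?addSn ?addnS.
Qed.

(* The component of symt n f with a indices 1, b indices 2, c indices 3 is f a b c. *)
Definition symt n f : tensor n := [ffun t : n.-tuple 'I_3 => f (cnt t 0) (cnt t 1) (cnt t 2)].

Lemma entry_symt n f s :
  size s = n -> entry (symt n f) s = f (cnt s 0) (cnt s 1) (cnt s 2).
Proof.
exact: (@entry_ffun _ n (fun t => f (cnt t 0) (cnt t 1) (cnt t 2))).
Qed.

Lemma symt_symv n f : symt n f \in symv R n.
Proof. by apply: symvI => t u tu; rewrite !ffunE !(cnt_perm _ tu). Qed.

Lemma symt_ext n f g : (forall a b c, (a + b + c)%N = n -> f a b c = g a b c) ->
  symt n f = symt n g.
Proof. by move=> h; apply/ffunP => t; rewrite !ffunE h // cnt_size size_tuple. Qed.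

Lemma symtZ n c f : c *: symt n f = symt n (fun i j k => c * f i j k).
Proof. by apply/ffunP => t; rewrite !ffunE. Qed.

Definition shift (i : 'I_3) f := match nat_of_ord i with
  | 0 => fun a b c => f a.+1 b c
  | 1 => fun a b c => f a b.+1 c
  | _ => fun a b c => f a b c.+1
  end.

Lemma shiftE i f s :
  f (cnt (i :: s) 0) (cnt (i :: s) 1) (cnt (i :: s) 2) =
  shift i f (cnt s 0) (cnt s 1) (cnt s 2).
Proof. by elim/ord3P: i. Qed.

Lemma trace12_symt n f : trace12 (symt n.+2 f) =
  symt n (fun a b c => f a.+2 b c + f a b.+2 c + f a b c.+2).
Proof.
apply: entry_ext => s sz; rewrite entry_trace12 // entry_symt // sum3E.
by rewrite !entry_symt /= ?sz.
Qed.

Lemma harmonic_symt n f :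
  (forall a b c, (a + b + c)%N = n -> f a.+2 b c + f a b.+2 c + f a b c.+2 = 0) ->
  symt n.+2 f \in harmonic R n.+2.
Proof.
move=> h; apply/harmonicP; split; first exact/symvP/symt_symv.
rewrite trace12_symt; apply/ffunP => t; rewrite !ffunE h //.
by rewrite cnt_size size_tuple.
Qed.

Definition xpow n x : tensor n := [ffun t : n.-tuple 'I_3 => \prod_(i <- t) x i].

Lemma entry_xpow n x s : size s = n -> entry (xpow n x) s = \prod_(i <- s) x i.
Proof. exact: (@entry_ffun _ n (fun t => \prod_(i <- t) x i)). Qed.

Lemma xpow_symv n x : xpow n x \in symv R n.
Proof. by apply: symvI => t u tu; rewrite !ffunE; apply: perm_big. Qed.

Definition peval n (T : tensor n) x := inner T (xpow n x).

Lemma pevalE n (T : tensor n) x :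
  peval T x = \sum_(t : n.-tuple 'I_3) entry T t * \prod_(i <- t) x i.
Proof. by rewrite /peval innerE; apply: eq_bigr => t _; rewrite entry_xpow ?size_tuple. Qed.

Lemma peval_sym n (T : tensor n) x : peval (sym T) x = peval T x.
Proof. by rewrite /peval inner_sym // xpow_symv. Qed.

Lemma pevalD n (S T : tensor n) x : peval (S + T) x = peval S x + peval T x.
Proof. exact: innerDl. Qed.

Lemma pevalZ n c (T : tensor n) x : peval (c *: T) x = c * peval T x.
Proof. exact: innerZl. Qed.

(** The coefficient of a monomial in the polynomial of [T] is a component of [T] times the number of
    index tuples yielding that monomial, and this number is not zero. Through [peval_inj],
    identities between symmetric tensors become polynomial identities. *)
Lemma peval_eq0 n (T : tensor n) :
  T \in symv R n -> (forall x, peval T x = 0) -> T = 0.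
Proof.
move=> Ts T0.
pose mon (s : seq 'I_3) : 'X_{1..3} := [multinom cnt s i | i < 3].
pose p : {mpoly R[3]} := \sum_(t : n.-tuple 'I_3) entry T t *: 'X_[mon t].
have p0 : p = 0.
  apply: mpoly_eq0 => x; rewrite -(T0 x) pevalE raddf_sum; apply: eq_bigr => t _.
  rewrite /= mevalZ mevalX; congr (_ * _).
  elim: (tval t) => [|i s IHs].
    by rewrite big_nil big1 // => i _; rewrite mnmE expr0.
  rewrite big_cons -IHs [in RHS](bigD1 i) //= (bigD1 i) //= !mnmE /cnt /= eqxx.
  rewrite mulrA -exprS; congr (_ * _); apply: eq_bigr => j ji.
  by rewrite !mnmE /= val_eqE eq_sym (negbTE ji).
apply/ffunP => t; rewrite ffunE; have := congr1 (mcoeff (mon t)) p0.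
rewrite mcoeff0 raddf_sum /=.
have E (u : n.-tuple 'I_3) : (entry T (tval u) *: 'X_[mon (tval u)])@_(mon t) =
    T t * (mon (tval u) == mon (tval t))%:R.
  rewrite mcoeffZ mcoeffX; case: eqP => [e|]; rewrite ?mulr0 // !mulr1 entryE.
  apply: symv_perm => //; apply: perm_cnt => k.
  case: (ltnP k 3) => [lt3|ge3].
    by have := congr1 (fun m : 'X_{1..3} => m (Ordinal lt3)) e; rewrite !mnmE.
  rewrite /cnt !(eq_count (a2 := pred0)) ?count_pred0 // => j /=;
    by apply/negbTE; rewrite neq_ltn (leq_trans (ltn_ord j)).
under eq_bigr => u _ do rewrite E.
rewrite -mulr_sumr -natr_sum => /eqP; rewrite mulf_eq0 => /orP [/eqP //|].
rewrite (bigD1 t) //= eqxx; set N := (\sum_(_ | _) _)%N.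
by rewrite add1n (negbTE (char0 N)).
Qed.

Lemma peval_inj n (S T : tensor n) :
  S \in symv R n -> T \in symv R n -> (forall x, peval S x = peval T x) -> S = T.
Proof.
move=> Ss Ts h; apply/eqP; rewrite -subr_eq0; apply/eqP/peval_eq0.
  exact: memvB.
by move=> x; rewrite -scaleN1r pevalD pevalZ h mulN1r subrr.
Qed.

Lemma peval_tprod m n (S : tensor m) (T : tensor n) x :
  peval (tprod S T) x = peval S x * peval T x.
Proof.
rewrite !pevalE big_distrlr /=.
rewrite (big_tuple_cat m n (fun t => entry (tprod S T) t * \prod_(i <- t) x i)).
apply: eq_bigr => a _; apply: eq_bigr => b _.
by rewrite entry_tprod ?size_tuple // big_cat mulrACA.
Qed.

Lemma peval_qprod n (U : tensor n) x :
  peval (qprod U) x = (x o0 ^+ 2 + x o1 ^+ 2 + x o2 ^+ 2) * peval U x.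
Proof.
rewrite [LHS](@peval_sym (2 + n)) peval_tprod; congr (_ * _).
rewrite pevalE (big_tuple2 (fun t => entry (qmetric R) t * \prod_(i <- t) x i)) !sum3E.
have E i j : entry (qmetric R) [:: i; j] = (i == j)%:R.
  by rewrite (entryE (qmetric R) [tuple i; j]) ffunE !(tnth_nth ord0).
by rewrite !E !big_cons !big_nil /=; ring.
Qed.

(* pe n f x = peval (symt n f) x *)
Fixpoint pe n f x : R := match n with
  | 0 => f 0%N 0%N 0%N
  | n'.+1 => x o0 * pe n' (fun a b c => f a.+1 b c) x +
             x o1 * pe n' (fun a b c => f a b.+1 c) x +
             x o2 * pe n' (fun a b c => f a b c.+1) x
  end.

Lemma sum_cnt n f x :
  \sum_(t : n.-tuple 'I_3) f (cnt t 0) (cnt t 1) (cnt t 2) * \prod_(i <- t) x i =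
  pe n f x.
Proof.
elim: n f => [|n IHn] f.
  rewrite (big_tuple0 (fun t => f (cnt t 0) (cnt t 1) (cnt t 2) * \prod_(i <- t) x i)).
  by rewrite big_nil mulr1.
rewrite (big_tuple_cons n (fun t => f (cnt t 0) (cnt t 1) (cnt t 2) * \prod_(i <- t) x i)).
rewrite sum3E /= -!IHn !mulr_sumr; congr (_ + _ + _); apply: eq_bigr => t _;
  by rewrite big_cons mulrCA.
Qed.

Lemma peval_symt n f x : peval (symt n f) x = pe n f x.
Proof.
rewrite pevalE -sum_cnt; apply: eq_bigr => t _; rewrite entry_symt //.
exact: size_tuple.
Qed.

Definition slice n (i : 'I_3) (T : tensor n.+1) : tensor n :=
  [ffun t : n.-tuple 'I_3 => entry T (i :: t)].

Lemma entry_slice n i (T : tensor n.+1) s :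
  size s = n -> entry (slice i T) s = entry T (i :: s).
Proof. exact: (@entry_ffun _ n (fun t => entry T (i :: t))). Qed.

Lemma slice_symt n i f : slice i (symt n.+1 f) = symt n (shift i f).
Proof.
apply: entry_ext => s sz; rewrite entry_slice // !entry_symt ?shiftE //=.
by rewrite sz.
Qed.

Lemma slice_symv n i (T : tensor n.+1) : T \in symv R n.+1 -> slice i T \in symv R n.
Proof.
move=> Ts; apply: symvI => t u tu; rewrite !ffunE.
by apply: symv_perm_entry; rewrite //= ?size_tuple // perm_cons.
Qed.

Lemma slice_harmonic n i (T : tensor n.+1) :
  T \in harmonic R n.+1 -> slice i T \in harmonic R n.
Proof.
case: n T => [|[|n]] T TH; try exact/slice_symv/harmonic_symv.
have Ts := harmonic_symv TH; have [_ T0] := harmonicP _ TH.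
apply/harmonicP; split; first exact/symvP/slice_symv.
apply: entry_ext => s sz; rewrite entry_trace12 //.
have := congr1 (fun U : tensor n.+1 => entry U (i :: s)) T0.
rewrite !entry0 /= entry_trace12 /= ?sz // => e; rewrite -[RHS]e.
apply: eq_bigr => j _; rewrite entry_slice /= ?sz //.
apply: symv_perm_entry; rewrite //= ?sz //.
by apply/permPl; apply: (perm_catCA [:: i] [:: j; j] s).
Qed.

Lemma inner_tprod_slice n (w : tensor 1) (S : tensor n) (K : tensor n.+1) :
  inner (tprod w S : tensor n.+1) K = \sum_i entry w [:: i] * inner S (slice i K).
Proof.
rewrite innerE (big_tuple_cons n (fun t => entry (tprod w S : tensor n.+1) t * entry K t)).
apply: eq_bigr => i _; rewrite innerE mulr_sumr; apply: eq_bigr => t _.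
rewrite (@entry_tprod _ 1 n w S [:: i]) ?size_tuple // entry_slice ?size_tuple //.
by rewrite mulrA.
Qed.

Lemma harmpow_harmonic (w : tensor 1) k : harmpow w k \in harmonic R k.
Proof.
case: k => [|k]; last exact: (@leading_harmonic _ (1 + k)).
by apply: symvI => t u _; rewrite !ffunE.
Qed.

(** The harmonic power differs from the ordinary power of the vector by a multiple of q, to which
    [K] is orthogonal. The induction peels off one factor, the slices of [K] being harmonic
    again. *)
Lemma inner_harmpow (w : tensor 1) n (K : tensor n) :
  K \in harmonic R n -> inner (harmpow w n) K = peval K (fun i => entry w [:: i]).
Proof.
elim: n K => [|n IHn] K KH.
  rewrite /peval [RHS]innerC; congr (inner _ _); apply/ffunP => t; rewrite !ffunE [t]tuple0.
  by rewrite /= big_nil.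
rewrite [LHS](inner_harmprod realR (m := 1) (n := n)) // [LHS]inner_tprod_slice.
rewrite pevalE (big_tuple_cons n (fun t => entry K t * \prod_(i <- t) entry w [:: i])).
apply: eq_bigr => i _; rewrite IHn ?slice_harmonic // pevalE mulr_sumr.
apply: eq_bigr => t _; rewrite entry_slice ?size_tuple // big_cons.
by rewrite mulrCA.
Qed.

Lemma inner_harmonic_leading n (K S : tensor n) :
  K \in harmonic R n -> inner K S = inner K (leading (sym S)).
Proof.
move=> KH; rewrite [RHS]innerC inner_leading ?sym_in_symv //.
by rewrite inner_sym ?harmonic_symv // innerC.
Qed.

Definition eps (a b c : 'I_3) : R := entry (levi_civita R) [:: a; b; c].

Lemma epsE a b c : eps a b c =
  (a == o0)%:R * ((b == o1)%:R * (c == o2)%:R - (b == o2)%:R * (c == o1)%:R)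
  - (a == o1)%:R * ((b == o0)%:R * (c == o2)%:R - (b == o2)%:R * (c == o0)%:R)
  + (a == o2)%:R * ((b == o0)%:R * (c == o1)%:R - (b == o1)%:R * (c == o0)%:R).
Proof.
rewrite /eps (entryE (levi_civita R) [tuple a; b; c]) ffunE.
rewrite (expand_det_row _ ord0) !big_ord_recl big_ord0 /cofactor.
rewrite !(expand_det_row _ ord0) !big_ord_recl !big_ord0 /cofactor !det_mx11.
rewrite !mxE /= !(tnth_nth ord0) /=.
have e0 (x : 'I_3) (y : 'I_3) : (x == y) = ((x : nat) == y) by [].
by rewrite !e0 /= /bump /= !expr0 !expr1 !expr2 ?addn0 /=; ring.
Qed.

Lemma eps_sum (F : 'I_3 -> 'I_3 -> 'I_3 -> R) :
  \sum_a \sum_b \sum_c eps a b c * F a b c =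
  F o0 o1 o2 + F o1 o2 o0 + F o2 o0 o1 - F o0 o2 o1 - F o1 o0 o2 - F o2 o1 o0.
Proof. by rewrite !sum3E !epsE /=; ring. Qed.

(** [K] absorbs the symmetrization. The indices of [K] are laid out as [t], [b], [s]: the free
    indices of [T], of the Levi-Civita tensor and of [S]. *)
Lemma inner_cross m n (S : tensor m) (T : tensor n)
    (K : tensor ((n - 1 + (3 - 1) - 1) + (m - 1))) :
  (0 < n)%N -> K \in symv R _ -> inner (cross S T) K =
  \sum_a \sum_b \sum_c eps a b c *
    \sum_(t : (n - 1).-tuple 'I_3) \sum_(s : (m - 1).-tuple 'I_3)
      entry T (t ++ [:: a]) * entry S (c :: s) * entry K (t ++ b :: s).
Proof.
move=> n0 Ks; rewrite (inner_sym char0 _ Ks) innerE.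
set P := contr 1 T _.
have e1 : (n - 1 + (3 - 1) - 1 = (n - 1) + 1)%N by rewrite addn2 subn1 addn1.
have EP t b c : size t = (n - 1)%N ->
    entry P (t ++ [:: b; c]) = \sum_a entry T (t ++ [:: a]) * eps a b c.
  move=> st; rewrite entry_contr //.
  by rewrite (big_tuple1 (fun k => entry T (t ++ k) * entry (levi_civita R) (k ++ [:: b; c]))).
have EC t b s : size t = (n - 1)%N -> size s = (m - 1)%N ->
    entry (contr 1 P S) (t ++ b :: s) =
    \sum_c (\sum_a entry T (t ++ [:: a]) * eps a b c) * entry S (c :: s).
  move=> st ss; rewrite -cat1s catA entry_contr ?size_cat ?st //.
  rewrite (big_tuple1 (fun k => entry P ((t ++ [:: b]) ++ k) * entry S (k ++ s))).
  by apply: eq_bigr => c _; rewrite -catA EP.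
rewrite (big_tuple_cat _ _ (fun u => entry (contr 1 P S) u * entry K u)).
rewrite (big_tuple_catE (fun u => \sum_(s : (m - 1).-tuple 'I_3)
   entry (contr 1 P S) (u ++ s) * entry K (u ++ s)) e1).
under eq_bigr => t _ do rewrite (big_tuple1 (fun b => \sum_(s : (m - 1).-tuple 'I_3)
   entry (contr 1 P S) ((t ++ b) ++ s) * entry K ((t ++ b) ++ s))).
rewrite exchange_big [RHS]exchange_big; apply: eq_bigr => b _ /=.
transitivity (\sum_(t : (n - 1).-tuple 'I_3) \sum_c \sum_(s : (m - 1).-tuple 'I_3) \sum_a
    eps a b c * (entry T (t ++ [:: a]) * entry S (c :: s) * entry K (t ++ b :: s))).
  apply: eq_bigr => t _; rewrite exchange_big; apply: eq_bigr => s _ /=.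
  rewrite -catA EC ?size_tuple // mulr_suml; apply: eq_bigr => c _.
  rewrite mulr_suml mulr_suml; apply: eq_bigr => a _.
  by rewrite -!mulrA mulrCA.
rewrite exchange_big [RHS]exchange_big; apply: eq_bigr => c _ /=.
under eq_bigr do rewrite exchange_big /=.
rewrite exchange_big; apply: eq_bigr => a _ /=.
rewrite mulr_sumr; apply: eq_bigr => t _.
by rewrite mulr_sumr.
Qed.

End SymmetricTensors.

(** * Pairings and contractions in terms of component functions *)

Section SymmetricContractions.
Variable R : realFieldType.
Local Notation tensor := (tensor R).
Local Notation one := (fun _ : 'I_3 => 1 : R).
Implicit Types (m n : nat) (f g : nat -> nat -> nat -> R) (x w : 'I_3 -> R).

Let realR : formally_real R := @realField_formally_real R.
Let char0 := formally_real_char0 realR.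

Lemma sum_cnt1 n f :
  \sum_(t : n.-tuple 'I_3) f (cnt t 0) (cnt t 1) (cnt t 2) = pe n f one.
Proof.
rewrite -sum_cnt; apply: eq_bigr => t _.
by rewrite big1 ?mulr1 // => i _.
Qed.

(** The length [n.+1 - 1] is the form in which [contr] and [cross] leave the free indices of a
    tensor of order [n.+1]. *)
Lemma pe_sum1 n f : pe n f one =
  \sum_(t : (n.+1 - 1).-tuple 'I_3) f (cnt t 0) (cnt t 1) (cnt t 2).
Proof. by rewrite sum_cnt1 subn1. Qed.

Lemma pe_sum n f x : pe n f x = \sum_(t : (n.+1 - 1).-tuple 'I_3)
  f (cnt t 0) (cnt t 1) (cnt t 2) * \prod_(i <- t) x i.
Proof. by rewrite sum_cnt subn1. Qed.

Lemma cnt_cat s t k : cnt (s ++ t) k = (cnt s k + cnt t k)%N.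
Proof. exact: count_cat. Qed.

Lemma shift_rcons i f s :
  f (cnt (s ++ [:: i]) 0) (cnt (s ++ [:: i]) 1) (cnt (s ++ [:: i]) 2) =
  shift i f (cnt s 0) (cnt s 1) (cnt s 2).
Proof. by rewrite -shiftE !cnt_cat /cnt /= !addn0 ![(count _ s + _)%N]addnC. Qed.

(** The components that remain once [i] indices equal to 1, [j] equal to 2 and [k] equal to 3 are
    fixed. *)
Definition plus i j k f : nat -> nat -> nat -> R :=
  fun a b c => f (i + a)%N (j + b)%N (k + c)%N.

Lemma inner_symt n f g : inner (symt n f) (symt n g) =
  pe n (fun a b c => f a b c * g a b c) one.
Proof.
rewrite -(sum_cnt1 n (fun a b c => f a b c * g a b c)) innerE.
by apply: eq_bigr => t _; rewrite !entry_symt ?size_tuple.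
Qed.

Lemma plus_harmonic n g (s : seq 'I_3) : symt (size s + n) g \in harmonic R _ ->
  symt n (plus (cnt s 0) (cnt s 1) (cnt s 2) g) \in harmonic R n.
Proof.
elim: s g => [|i s IHs] g; first by [].
move=> /(@slice_harmonic _ (size s + n) i); rewrite slice_symt => /IHs.
by elim/ord3P: i.
Qed.

Lemma inner_harmpow_plus m n g (s : seq 'I_3) (w : tensor 1) : size s = m ->
  symt (m + n) g \in harmonic R _ ->
  \sum_(u : n.-tuple 'I_3) entry (harmpow w n) u * entry (symt (m + n) g) (s ++ u) =
  pe n (plus (cnt s 0) (cnt s 1) (cnt s 2) g) (fun i => entry w [:: i]).
Proof.
move=> <- gH; rewrite -peval_symt -inner_harmpow ?plus_harmonic // innerE.
apply: eq_bigr => u _; rewrite !entry_symt ?size_cat ?size_tuple //.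
by rewrite !cnt_cat.
Qed.

(** With the first [m] indices fixed the second tensor is still harmonic, so its pairing with the
    harmonic power is the value of its polynomial at [w]. *)
Lemma inner_tprod_harmpow m n f g (w : tensor 1) :
  symt (m + n) g \in harmonic R _ ->
  inner (tprod (symt m f) (harmpow w n)) (symt (m + n) g) =
  pe m (fun a b c => f a b c * pe n (plus a b c g) (fun i => entry w [:: i])) one.
Proof.
move=> gH; rewrite innerE (big_tuple_cat m n (fun t =>
  entry (tprod (symt m f) (harmpow w n)) t * entry (symt (m + n) g) t)).
rewrite -sum_cnt1; apply: eq_bigr => s _.
rewrite -(@inner_harmpow_plus m) ?size_tuple // mulr_sumr; apply: eq_bigr => u _.
by rewrite entry_tprod ?size_tuple // entry_symt ?size_tuple // mulrA.
Qed.

Lemma inner_harmpow_tprod m n f g (w : tensor 1) :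
  symt (m + n) g \in harmonic R _ ->
  inner (tprod (harmpow w n) (symt m f)) (symt (n + m) g) =
  pe m (fun a b c => f a b c * pe n (plus a b c g) (fun i => entry w [:: i])) one.
Proof.
move=> gH; rewrite innerE (big_tuple_cat n m (fun t =>
  entry (tprod (harmpow w n) (symt m f)) t * entry (symt (n + m) g) t)).
rewrite exchange_big -sum_cnt1; apply: eq_bigr => s _ /=.
rewrite -(@inner_harmpow_plus m) ?size_tuple // mulr_sumr; apply: eq_bigr => u _.
rewrite entry_tprod ?size_tuple // !entry_symt ?size_cat ?size_tuple //.
by rewrite !cnt_cat -mulrA mulrCA ![(cnt s _ + _)%N]addnC.
Qed.

Lemma inner_cross_symt m n f g k : inner (cross (symt m.+1 f) (symt n.+1 g)) 
    (symt (n.+1 - 1 + (3 - 1) - 1 + (m.+1 - 1)) k) =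
  \sum_a \sum_b \sum_c eps R a b c *
    pe n (fun i1 i2 i3 => shift a g i1 i2 i3 *
       pe m (fun j1 j2 j3 => shift c f j1 j2 j3 * plus i1 i2 i3 (shift b k) j1 j2 j3) one) one.
Proof.
rewrite inner_cross ?symt_symv //.
apply: eq_bigr => a _; apply: eq_bigr => b _; apply: eq_bigr => c _; congr (_ * _).
rewrite pe_sum1; apply: eq_bigr => t _.
rewrite pe_sum1 mulr_sumr; apply: eq_bigr => s _.
rewrite -mulrA; congr (_ * (_ * _)).
- by rewrite entry_symt ?shift_rcons // size_cat size_tuple subn1 addn1.
- by rewrite entry_symt ?shiftE //= size_tuple subn1.
rewrite entry_symt ?size_cat /= ?size_tuple; last by rewrite addn2 !subn1 /= addnS.
rewrite /plus -!cnt_cat -shiftE; congr k; rewrite ?cnt_cat /cnt /= ?cnt_cat;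
  by rewrite addnCA count_cat.
Qed.

Lemma peval_cross_symt m n f g x : peval (cross (symt m.+1 f) (symt n.+1 g)) x =
  \sum_a \sum_b \sum_c eps R a b c *
    (pe n (shift a g) x * x b * pe m (shift c f) x).
Proof.
rewrite /peval inner_cross ?xpow_symv //.
apply: eq_bigr => a _; apply: eq_bigr => b _; apply: eq_bigr => c _; congr (_ * _).
rewrite !pe_sum mulr_suml mulr_suml.
apply: eq_bigr => t _; rewrite mulr_sumr; apply: eq_bigr => s _.
rewrite entry_symt ?shift_rcons; last by rewrite size_cat size_tuple subn1 addn1.
rewrite entry_symt ?shiftE; last by rewrite /= size_tuple subn1.
rewrite entry_xpow; last by rewrite size_cat /= !size_tuple addn2 !subn1 /= addnS.
by rewrite big_cat big_cons /=; ring.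
Qed.

Lemma peval_contr1 m n f g x : peval (contr 1 (symt m.+1 f) (symt n.+1 g)) x =
  \sum_a pe m (shift a f) x * pe n (shift a g) x.
Proof.
rewrite pevalE (big_tuple_cat (m.+1 - 1) (n.+1 - 1) (fun t =>
  entry (contr 1 (symt m.+1 f) (symt n.+1 g)) t * \prod_(i <- t) x i)).
under [RHS]eq_bigr => a _ do
  rewrite !pe_sum big_distrlr /=.
rewrite [RHS]exchange_big; apply: eq_bigr => t _ /=.
rewrite [RHS]exchange_big; apply: eq_bigr => s _ /=.
rewrite entry_contr ?size_tuple // mulr_suml.
rewrite (big_tuple1 (fun k => entry (symt m.+1 f) (t ++ k) *
  entry (symt n.+1 g) (k ++ s) * \prod_(i <- t ++ s) x i)).
apply: eq_bigr => a _; rewrite big_cat entry_symt ?shift_rcons; last first.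
  by rewrite size_cat size_tuple subn1 addn1.
rewrite entry_symt ?shiftE; last by rewrite /= size_tuple subn1.
by rewrite /=; ring.
Qed.

End SymmetricContractions.

(** * Parameters of harmonic tensors of order four *)

Section SliceTensors.
Variable R : realFieldType.
Local Notation tensor := (tensor R).
Local Notation one := (fun _ : 'I_3 => 1 : R).
Let realR : formally_real R := @realField_formally_real R.
Let char0 := formally_real_char0 realR.

Definition vec3 (x y z : R) (i : 'I_3) : R := match nat_of_ord i with 0 => x | 1 => y | _ => z end.

(* Parameters of a harmonic tensor H of order 4: L1 = H_2233, A1 = H_1123 and *)
(* B1 = (H_2223 - H_2333) / 2, with cyclic permutations.                      *)
Definition harm4 (L A B : 'I_3 -> R) (a b c : nat) : R :=
  match a, b, c with
  | 4, 0, 0 => - (L o1 + L o2)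
  | 0, 4, 0 => - (L o0 + L o2)
  | 0, 0, 4 => - (L o0 + L o1)
  | 0, 2, 2 => L o0
  | 2, 0, 2 => L o1
  | 2, 2, 0 => L o2
  | 2, 1, 1 => A o0
  | 1, 2, 1 => A o1
  | 1, 1, 2 => A o2
  | 0, 3, 1 => - (A o0 / 2) + B o0
  | 0, 1, 3 => - (A o0 / 2) - B o0
  | 1, 0, 3 => - (A o1 / 2) + B o1
  | 3, 0, 1 => - (A o1 / 2) - B o1
  | 3, 1, 0 => - (A o2 / 2) + B o2
  | 1, 3, 0 => - (A o2 / 2) - B o2
  | _, _, _ => 0
  end.

Lemma harm4_harmonic L A B : symt 4 (harm4 L A B) \in harmonic R 4.
Proof.
apply: harmonic_symt => -[|[|[|a]]] [|[|[|b]]] [|[|[|c]]] //= _; lra.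
Qed.

Section Param.
Variable H : tensor 4.
Definition parL := vec3 (entry H [:: o1; o1; o2; o2]) (entry H [:: o0; o0; o2; o2])
  (entry H [:: o0; o0; o1; o1]).
Definition parA := vec3 (entry H [:: o0; o0; o1; o2]) (entry H [:: o0; o1; o1; o2])
  (entry H [:: o0; o1; o2; o2]).
Definition parB := vec3
  ((entry H [:: o1; o1; o1; o2] - entry H [:: o1; o2; o2; o2]) / 2)
  ((entry H [:: o0; o2; o2; o2] - entry H [:: o0; o0; o0; o2]) / 2)
  ((entry H [:: o0; o0; o0; o1] - entry H [:: o0; o1; o1; o1]) / 2).

(** A symmetric tensor of order 4 has 15 components and the trace gives 6 relations, which leaves
    the 9 parameters. [E] sorts the indices; every component is then a linear consequence of the six
    relations. *)
Lemma harmonic4_param : H \in harmonic R 4 -> H = symt 4 (harm4 parL parA parB).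
Proof.
move=> HH; have Hs := harmonic_symv HH; have [_ H0] := harmonicP _ HH.
have tr i j : entry H [:: o0; o0; i; j] + entry H [:: o1; o1; i; j] +
    entry H [:: o2; o2; i; j] = 0.
  have := congr1 (fun T : tensor 2 => entry T [:: i; j]) H0.
  by rewrite entry_trace12 // entry0 sum3E.
have E : H = symt 4 (fun a b c => entry H (nseq a o0 ++ nseq b o1 ++ nseq c o2)).
  apply: entry_ext => s sz; rewrite entry_symt //; apply: symv_perm_entry => //.
  apply: perm_cnt => k; rewrite /cnt !count_cat !count_nseq /=.
  move: k => [|[|[|k]]] /=; rewrite ?mul1n ?mul0n ?addn0 //.
  by apply/eqP; rewrite -leqn0 leqNgt -has_count; apply/hasPn => -[[|[|[|i]]]].
have P s t : size s = 4 -> perm_eq s t -> entry H s = entry H t.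
  by move=> sz; apply: symv_perm_entry.
rewrite [LHS]E; apply: symt_ext => a b c abc.
rewrite /parL /parA /parB /vec3 /=.
have t00 := tr o0 o0; have t11 := tr o1 o1; have t22 := tr o2 o2.
have t01 := tr o0 o1; have t02 := tr o0 o2; have t12 := tr o1 o2.
have p1 : entry H [:: o1; o1; o0; o0] = entry H [:: o0; o0; o1; o1] by apply: P.
have p2 : entry H [:: o2; o2; o0; o0] = entry H [:: o0; o0; o2; o2] by apply: P.
have p3 : entry H [:: o2; o2; o1; o1] = entry H [:: o1; o1; o2; o2] by apply: P.
have p4 : entry H [:: o1; o1; o0; o1] = entry H [:: o0; o1; o1; o1] by apply: P.
have p5 : entry H [:: o2; o2; o0; o1] = entry H [:: o0; o1; o2; o2] by apply: P.
have p6 : entry H [:: o1; o1; o0; o2] = entry H [:: o0; o1; o1; o2] by apply: P.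
have p7 : entry H [:: o2; o2; o0; o2] = entry H [:: o0; o2; o2; o2] by apply: P.
have p8 : entry H [:: o2; o2; o1; o2] = entry H [:: o1; o2; o2; o2] by apply: P.
move: a b c abc => [|[|[|[|[|a]]]]] [|[|[|[|[|b]]]]] [|[|[|[|[|c]]]]] //= _;
  rewrite ?p1 ?p2 ?p3 ?p4 ?p5 ?p6 ?p7 ?p8 in t00 t11 t22 t01 t02 t12 *; lra.
Qed.

End Param.

(** For symmetric [H] the contraction in [cov_d2] runs over three indices of both factors, which
    makes it an explicit polynomial in the components. *)
Definition d2f (f : nat -> nat -> nat -> R) (i j : 'I_3) : R :=
  pe 3 (fun a b c => shift i f a b c * shift j f a b c) one.

Lemma entry_d2 f i j : entry (cov_d2 (symt 4 f)) [:: i; j] = d2f f i j.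
Proof.
rewrite (entryE (cov_d2 _) [tuple i; j]) ffunE.
rewrite /d2f -(sum_cnt1 3 (fun a b c => shift i f a b c * shift j f a b c)).
rewrite (big_tuple_cons 2 (fun t => shift i f (cnt t 0) (cnt t 1) (cnt t 2) *
  shift j f (cnt t 0) (cnt t 1) (cnt t 2))).
apply: eq_bigr => k _; rewrite !(tnth_nth ord0).
apply: (etrans (@entry_contr _ 2 4 4 _ _ [:: k; i] [:: k; j] erefl erefl)).
apply: eq_bigr => u _; rewrite !entry_symt ?size_cat ?size_tuple // -!shiftE.
rewrite !cnt_cat; congr (f _ _ _ * f _ _ _); rewrite /cnt /=; ring.
Qed.

End SliceTensors.

(** * Covariants built from a diagonal second-order tensor *)

Section SliceValues.
Variable R : realFieldType.
Local Notation tensor := (tensor R).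
Local Notation one := (fun _ : 'I_3 => 1 : R).
Let realR : formally_real R := @realField_formally_real R.
Let char0 := formally_real_char0 realR.

(* For d_2 = diag x, of Vandermonde product v: T_6 is xyz v, symTT and leadTT are *)
(* the symmetrization of T_6 . T_6 and its leading part, jac6 is J_18, lead7 is   *)
(* the harmonic product of T_6 and leadTT, and rest5 is the cofactor of q in      *)
(* their symmetric product; cube3 w is the third harmonic power of w.             *)
Definition diag2 (x : 'I_3 -> R) (a b c : nat) : R :=
  match a, b, c with
  | 2, 0, 0 => x o0 | 0, 2, 0 => x o1 | 0, 0, 2 => x o2 | _, _, _ => 0
  end.

Definition xyz (v : R) (a b c : nat) : R :=
  match a, b, c with 1, 1, 1 => v / 6 | _, _, _ => 0 end.

Definition vec1 (x : 'I_3 -> R) (a b c : nat) : R :=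
  match a, b, c with 1, 0, 0 => x o0 | 0, 1, 0 => x o1 | 0, 0, 1 => x o2 | _, _, _ => 0 end.

Definition symTT (v : R) (a b c : nat) : R :=
  match a, b, c with
  | 2, 2, 0 | 2, 0, 2 | 0, 2, 2 => v ^+ 2 / 54
  | _, _, _ => 0
  end.

Definition leadTT (v : R) (a b c : nat) : R :=
  match a, b, c with
  | 4, 0, 0 | 0, 4, 0 | 0, 0, 4 => - (v ^+ 2 / 45)
  | 2, 2, 0 | 2, 0, 2 | 0, 2, 2 => v ^+ 2 / 90
  | _, _, _ => 0
  end.

Definition jac6 (v : R) (a b c : nat) : R :=
  match a, b, c with
  | 4, 2, 0 | 0, 4, 2 | 2, 0, 4 => v ^+ 3 / 810
  | 2, 4, 0 | 0, 2, 4 | 4, 0, 2 => - (v ^+ 3 / 810)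
  | _, _, _ => 0
  end.

Definition lead7 (v : R) (a b c : nat) : R :=
  match a, b, c with
  | 5, 1, 1 | 1, 5, 1 | 1, 1, 5 => - (v ^+ 3 / 1386)
  | 3, 3, 1 | 3, 1, 3 | 1, 3, 3 => v ^+ 3 / 2772
  | _, _, _ => 0
  end.

Definition rest5 (v : R) (a b c : nat) : R :=
  match a, b, c with
  | 3, 1, 1 | 1, 3, 1 | 1, 1, 3 => v ^+ 3 / 2475
  | _, _, _ => 0
  end.

Definition sq3 (w : 'I_3 -> R) := w o0 ^+ 2 + w o1 ^+ 2 + w o2 ^+ 2.

Definition cube3 (w : 'I_3 -> R) (a b c : nat) : R :=
  match a, b, c with
  | 3, 0, 0 => w o0 ^+ 3 - 3 / 5 * sq3 w * w o0
  | 0, 3, 0 => w o1 ^+ 3 - 3 / 5 * sq3 w * w o1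
  | 0, 0, 3 => w o2 ^+ 3 - 3 / 5 * sq3 w * w o2
  | 2, 1, 0 => w o0 ^+ 2 * w o1 - sq3 w * w o1 / 5
  | 2, 0, 1 => w o0 ^+ 2 * w o2 - sq3 w * w o2 / 5
  | 1, 2, 0 => w o1 ^+ 2 * w o0 - sq3 w * w o0 / 5
  | 0, 2, 1 => w o1 ^+ 2 * w o2 - sq3 w * w o2 / 5
  | 1, 0, 2 => w o2 ^+ 2 * w o0 - sq3 w * w o0 / 5
  | 0, 1, 2 => w o2 ^+ 2 * w o1 - sq3 w * w o1 / 5
  | 1, 1, 1 => w o0 * w o1 * w o2
  | _, _, _ => 0
  end.

Ltac expand := cbv [pe shift plus val o0 o1 o2 isSub.val_subdef nat_of_ord
  addn addn_rec Nat.add diag2 xyz vec1 symTT leadTT jac6 lead7 rest5 cube3 harm4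
  fintype_ordinal__canonical__eqtype_SubType].

Lemma leadTT_harmonic v : symt 4 (leadTT v) \in harmonic R 4.
Proof.
by apply: harmonic_symt => -[|[|[|a]]] [|[|[|b]]] [|[|[|c]]] //= _; field.
Qed.

Lemma jac6_harmonic v : symt 6 (jac6 v) \in harmonic R 6.
Proof.
by apply: harmonic_symt => -[|[|[|[|[|a]]]]] [|[|[|[|[|b]]]]] [|[|[|[|[|c]]]]] //= _; field.
Qed.

Lemma lead7_harmonic v : symt 7 (lead7 v) \in harmonic R 7.
Proof.
by apply: harmonic_symt => -[|[|[|[|[|[|a]]]]]] [|[|[|[|[|[|b]]]]]] [|[|[|[|[|[|c]]]]]] //= _; field.
Qed.

Lemma xyz_harmonic v : symt 3 (xyz v) \in harmonic R 3.
Proof.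
by apply: harmonic_symt => -[|[|a]] [|[|b]] [|[|c]] //= _; field.
Qed.

Lemma cube3_harmonic w : symt 3 (cube3 w) \in harmonic R 3.
Proof.
by apply: harmonic_symt => -[|[|a]] [|[|b]] [|[|c]] //= _; rewrite /sq3; field.
Qed.

Definition vdm (x : 'I_3 -> R) : R := (x o0 - x o1) * (x o1 - x o2) * (x o0 - x o2).

(** In terms of polynomials this is the determinant with rows [y_i], [x_i^2 y_i], [x_i y_i]: a
    Vandermonde determinant times [y_0 y_1 y_2]. The order of the last two rows explains the signs
    in [vdm]. *)
Lemma cross_diag2 x : cross (contr 1 (symt 2 (diag2 x)) (symt 2 (diag2 x)))
  (symt 2 (diag2 x)) = symt 3 (xyz (vdm x)).
Proof.
have -> : contr 1 (symt 2 (diag2 x)) (symt 2 (diag2 x)) =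
    symt 2 (diag2 (fun i => x i ^+ 2)).
  apply: entry_ext => -[|i [|j []]] // _.
  apply: (etrans (@entry_contr _ 1 2 2 _ _ [:: i] [:: j] erefl erefl)).
  rewrite (big_tuple1 (fun k => entry (symt 2 (diag2 x)) ([:: i] ++ k) *
    entry (symt 2 (diag2 x)) (k ++ [:: j]))) sum3E !entry_symt //.
  by elim/ord3P: i; elim/ord3P: j; rewrite /=; ring.
apply: (@peval_inj _ 3); rewrite ?symt_symv // ?sym_in_symv // => y.
rewrite [LHS](@peval_cross_symt _ 1 1) eps_sum (@peval_symt _ 3) /vdm.
by expand; field.
Qed.

Lemma sym_contr_xyz v :
  sym (contr 1 (symt 3 (xyz v)) (symt 3 (xyz v))) = symt 4 (symTT v).
Proof.
apply: (@peval_inj _ 4); rewrite ?symt_symv // ?sym_in_symv // => y.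
rewrite [LHS](@peval_sym _ 4) (@peval_contr1 _ 2 2) sum3E (@peval_symt _ 4).
by expand; field.
Qed.

(** The polynomial of [symTT v] is [v^2 / 9] times the sum of the [y_i^2 y_j^2]; it becomes harmonic
    after subtraction of [v^2 / 45] times the square of [|y|^2]. *)
Lemma leading_symTT v : leading (symt 4 (symTT v)) = symt 4 (leadTT v).
Proof.
pose U := symt 2 (diag2 (fun=> v ^+ 2 / 45)).
have -> : symt 4 (symTT v) = symt 4 (leadTT v) + qprod U.
  apply: peval_inj; rewrite ?memvD ?symt_symv ?qprod_symv // => y.
  rewrite pevalD peval_qprod !peval_symt.
  by expand; field.
apply: leading_eq; rewrite ?leadTT_harmonic //.
by apply/qmultiplesP; exists U; rewrite ?symt_symv.
Qed.

Lemma cross_leadTT v : cross (symt 4 (leadTT v)) (symt 3 (xyz v)) = symt 6 (jac6 v).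
Proof.
apply: (@peval_inj _ 6); rewrite ?symt_symv // ?sym_in_symv // => y.
rewrite [LHS](@peval_cross_symt _ 3 2) eps_sum (@peval_symt _ 6).
by expand; field.
Qed.

Lemma harmprod_leadTT v :
  harmprod (symt 3 (xyz v)) (symt 4 (leadTT v)) = symt 7 (lead7 v).
Proof.
pose U := symt 5 (rest5 v).
have e : symprod (symt 3 (xyz v)) (symt 4 (leadTT v)) = symt 7 (lead7 v) + qprod U.
  apply: (@peval_inj _ 7); rewrite ?memvD ?symt_symv ?qprod_symv // ?sym_in_symv // => y.
  rewrite [LHS](@peval_sym _ 7) (@peval_tprod _ 3 4) pevalD peval_qprod !peval_symt.
  by expand; field.
rewrite /harmprod e; apply: (@leading_eq _ _ 7); rewrite ?lead7_harmonic //.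
by apply/(@qmultiplesP _ 5); exists U; rewrite ?symt_symv.
Qed.

(** In k_4 the harmonic cube also enters a cross product and a partial contraction, so its
    components are needed. Both sides are harmonic and have the same products with harmonic tensors;
    their difference is orthogonal to itself. *)
Lemma harmpow3 w : harmpow (symt 1 (vec1 w)) 3 = symt 3 (cube3 w).
Proof.
set W := symt 1 _; have We : (fun i => entry W [:: i]) = w.
  by apply: funext => i; rewrite entry_symt //; elim/ord3P: i.
have inW K : K \in harmonic R 3 -> inner (harmpow W 3) K = inner (symt 3 (cube3 w)) K.
  move=> KH; rewrite inner_harmpow // We /peval innerC.
  (* The factor 3/5 is the one for which the cube of [w] minus q times this vector is traceless. *)
  have -> : xpow 3 w = symt 3 (cube3 w) + qprod (3 / 5 * sq3 w *: W).
    apply: peval_inj; rewrite ?memvD ?symt_symv ?qprod_symv ?xpow_symv // => y.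
    rewrite pevalD peval_qprod pevalZ !peval_symt.
    have -> : peval (xpow 3 w) y = (w o0 * y o0 + w o1 * y o1 + w o2 * y o2) ^+ 3.
      rewrite /peval (_ : xpow 3 w = symt 3 (fun a b c => w o0 ^+ a * w o1 ^+ b * w o2 ^+ c)).
        by rewrite -[LHS]/(peval _ y) peval_symt; expand; ring.
      apply: entry_ext => -[|i [|j [|k []]]] // _.
      rewrite entry_xpow // entry_symt // !big_cons big_nil.
      by elim/ord3P: i; elim/ord3P: j; elim/ord3P: k; rewrite /cnt /=; ring.
    by rewrite /sq3; expand; rewrite /sq3; field.
  rewrite innerDl [X in _ + X](@inner_qmultiples_harmonic _ realR 3 _ _ _ KH) ?addr0 //.
  by apply/qmultiplesP; exists (3 / 5 * sq3 w *: W); rewrite ?memvZ ?symt_symv.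
apply/eqP; rewrite -subr_eq0; apply/eqP; apply: (sqnorm_eq0 realR).
rewrite /sqnorm innerDl innerNl inW ?subrr // memvB ?cube3_harmonic //.
exact: harmpow_harmonic.
Qed.

End SliceValues.

(** * The six invariants on the slice *)

Section SliceInvariants.
Variable R : realFieldType.
Local Notation tensor := (tensor R).
Local Notation one := (fun _ : 'I_3 => 1 : R).
Let realR : formally_real R := @realField_formally_real R.
Let char0 := formally_real_char0 realR.

Ltac expand := cbv [pe shift plus val o0 o1 o2 isSub.val_subdef nat_of_ord
  addn addn_rec Nat.add diag2 xyz vec1 symTT leadTT jac6 lead7 rest5 cube3 harm4
  fintype_ordinal__canonical__eqtype_SubType].

Variables L A B : 'I_3 -> R.
Local Notation f := (harm4 L A B).
Local Notation H := (symt 4 f).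

Hypothesis off01 : d2f f o0 o1 = 0.
Hypothesis off02 : d2f f o0 o2 = 0.
Hypothesis off12 : d2f f o1 o2 = 0.

Definition slice_vdm : R := vdm (fun i => d2f f i i).
Local Notation v := slice_vdm.
Definition slice_w (i : 'I_3) : R := v * A i.
Local Notation w := slice_w.

Lemma d2f_sym g i j : d2f g i j = d2f g j i :> R.
Proof.
rewrite /d2f; congr (pe 3 _ _); apply: funext => a; apply: funext => b.
by apply: funext => c; rewrite mulrC.
Qed.

Lemma slice_d2 : cov_d2 H = symt 2 (diag2 (fun i => d2f f i i)).
Proof.
apply: entry_ext => -[|i [|j []]] // _; rewrite entry_d2 entry_symt //.
elim/ord3P: i; elim/ord3P: j; rewrite //= ?off01 ?off02 ?off12 //;
  by rewrite d2f_sym ?off01 ?off02 ?off12.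
Qed.

Lemma slice_T6 : cov_T6 H = symt 3 (xyz v).
Proof. by rewrite /cov_T6 slice_d2 -cross_diag2. Qed.

Lemma slice_M12 : inv_M12 H = v ^+ 2 / 6.
Proof.
rewrite /inv_M12 slice_T6 /sqnorm inner_symt; move: v => u.
by expand; field.
Qed.

(** T_6 has six nonzero components, each equal to [v / 6], at the permutations of 1, 2, 3. Hence
    component [i] of w_7 is [v] times the component of [H] with indices i, 1, 2, 3, which is
    [A i]. *)
Lemma slice_w7 : cov_w7 H = symt 1 (vec1 w).
Proof.
rewrite /cov_w7 slice_T6 /slice_w; move: v => u.
apply: (@entry_ext _ 1) => -[|i []] // _.
apply: (etrans (@entry_contr _ 3 4 3 _ _ [:: i] [::] erefl erefl)).
rewrite (eq_bigr (fun t : 3.-tuple 'I_3 => shift i f (cnt t 0) (cnt t 1) (cnt t 2) *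
  xyz u (cnt t 0) (cnt t 1) (cnt t 2))); last first.
  move=> t _; rewrite cats0 !entry_symt ?size_cat ?size_tuple //.
  by rewrite -shiftE.
rewrite (sum_cnt1 3 (fun a b c => shift i f a b c * xyz u a b c)) entry_symt //.
by elim/ord3P: i; rewrite /cnt /=; expand; field.
Qed.

Lemma slice_wE : (fun i => entry (symt 1 (vec1 w)) [:: i]) = w.
Proof. by apply: funext => i; rewrite entry_symt //; elim/ord3P: i. Qed.

Lemma slice_leadTT : leading (symcontr 1 (cov_T6 H) (cov_T6 H)) = symt 4 (leadTT v).
Proof. by rewrite /symcontr slice_T6 sym_contr_xyz leading_symTT. Qed.

Lemma slice_J18 : cov_J18 H = symt 6 (jac6 v).
Proof. by rewrite /cov_J18 slice_leadTT slice_T6 cross_leadTT. Qed.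

Hypothesis v0 : v != 0.

Definition sum_sq (a : 'I_3 -> R) : R := a o0 ^+ 2 + a o1 ^+ 2 + a o2 ^+ 2.
Definition sum_sq2 (a : 'I_3 -> R) : R :=
  a o0 ^+ 2 * a o1 ^+ 2 + a o0 ^+ 2 * a o2 ^+ 2 + a o1 ^+ 2 * a o2 ^+ 2.
Definition prod3 (a : 'I_3 -> R) : R := a o0 * a o1 * a o2.
Definition disc (a : 'I_3 -> R) : R :=
  (a o0 ^+ 2 - a o1 ^+ 2) * (a o1 ^+ 2 - a o2 ^+ 2) * (a o2 ^+ 2 - a o0 ^+ 2).
Definition lin1 (a b : 'I_3 -> R) : R :=
  a o0 * (a o1 ^+ 2 - a o2 ^+ 2) * b o0 + a o1 * (a o2 ^+ 2 - a o0 ^+ 2) * b o1 +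
  a o2 * (a o0 ^+ 2 - a o1 ^+ 2) * b o2.
(** Permuting the axes also multiplies [B] by the sign of the permutation, so the sums of products
    here and in [lin3] are alternating; the alternating factor [disc] makes them invariant. In
    [lin1] the coefficients of [B] compensate the sign themselves. *)
Definition lin2 (a b : 'I_3 -> R) : R := disc a * (a o0 * b o0 + a o1 * b o1 + a o2 * b o2).
Definition lin3 (a b : 'I_3 -> R) : R := disc a *
  (a o1 * a o2 * b o0 + a o2 * a o0 * b o1 + a o0 * a o1 * b o2).

Lemma slice_i2 : inv_i2 H = 6 * sum_sq A.
Proof.
rewrite /inv_i2 slice_M12 slice_w7 /sqnorm inner_symt /sum_sq /slice_w.
by move: v v0 => u u0; expand; field.
Qed.

Lemma slice_i3 : inv_i3 H = 36 * prod3 A.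
Proof.
rewrite /inv_i3 slice_M12 slice_w7 slice_T6 inner_harmpow ?xyz_harmonic //.
rewrite slice_wE peval_symt /prod3 /slice_w.
by move: v v0 => u u0; expand; field.
Qed.

(** The harmonic fourth power only sees the leading part of the symmetrized contraction, so the
    pairing is the polynomial of [leadTT v] at [w]. *)
Lemma slice_i4 : inv_i4 H = 24 * (sum_sq2 A - sum_sq A ^+ 2 / 5).
Proof.
rewrite /inv_i4 slice_M12 slice_w7 slice_T6.
have e : inner (harmpow (symt 1 (vec1 w)) 4)
    (contr 1 (symt 3 (xyz v)) (symt 3 (xyz v))) = peval (symt 4 (leadTT v)) w.
  rewrite [LHS](@inner_harmonic_leading _ 4) ?harmpow_harmonic //.
  by rewrite [sym _]sym_contr_xyz leading_symTT inner_harmpow ?leadTT_harmonic ?slice_wE.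
rewrite [X in X / _]e peval_symt /sum_sq /sum_sq2 /slice_w.
by move: v v0 => u u0; expand; field.
Qed.

Lemma slice_w6 : inner (harmpow (cov_w7 H) 6) (cov_J18 H) = v ^+ 9 / 54 * - disc A.
Proof.
rewrite slice_w7 slice_J18 inner_harmpow ?jac6_harmonic // slice_wE peval_symt.
by rewrite /disc /slice_w; move: v => u; expand; field.
Qed.

Lemma slice_k4a : inner (harmprod H (harmpow (cov_w7 H) 3))
    (harmprod (cov_T6 H) (leading (symcontr 1 (cov_T6 H) (cov_T6 H)))) =
  pe 4 (fun a b c => f a b c * pe 3 (plus a b c (lead7 v)) w) one.
Proof.
rewrite slice_leadTT slice_T6 slice_w7 harmprod_leadTT.
rewrite (@inner_harmprod _ realR 4 3) ?lead7_harmonic // inner_tprod_harmpow ?lead7_harmonic //.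
by rewrite slice_wE.
Qed.

Lemma slice_k4b : inner (cross H (harmpow (cov_w7 H) 3)) (cov_J18 H) =
  \sum_a \sum_b \sum_c eps R a b c *
    pe 2 (fun i1 i2 i3 => shift a (cube3 w) i1 i2 i3 *
       pe 3 (fun j1 j2 j3 => shift c f j1 j2 j3 * plus i1 i2 i3 (shift b (jac6 v)) j1 j2 j3) one) one.
Proof. by rewrite slice_J18 slice_w7 harmpow3 (@inner_cross_symt _ 3 2). Qed.

Lemma slice_k4c : inner (contr 2 H (harmpow (cov_w7 H) 3)) (cov_T6 H) =
  pe 2 (fun a b c => \sum_i pe 2 (fun a' b' c' => plus a b c f a' b' c' *
    shift i (cube3 w) a' b' c') one * shift i (xyz v) a b c) one.
Proof.
rewrite slice_w7 harmpow3 slice_T6 innerE.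
rewrite (big_tuple_cat 2 1 (fun t => entry (contr 2 H (symt 3 (cube3 w))) t *
  entry (symt 3 (xyz v)) t)).
rewrite -sum_cnt1; apply: eq_bigr => s _.
rewrite (big_tuple1 (fun b => entry (contr 2 H (symt 3 (cube3 w))) (s ++ b) *
  entry (symt 3 (xyz v)) (s ++ b))); apply: eq_bigr => i _.
rewrite (entry_symt (xyz v)) ?size_cat ?size_tuple // shift_rcons; congr (_ * _).
rewrite [LHS](@entry_contr _ 2 4 3) ?size_tuple // -sum_cnt1; apply: eq_bigr => t _.
rewrite !entry_symt ?size_cat ?size_tuple // shift_rcons.
by rewrite /plus -!cnt_cat.
Qed.

(** For given [w] the three pairings are linear in [H]. Their weights are such that the
    contributions of the [L] and [A] components of [H] cancel and only [B] remains. *)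
Lemma slice_k4 : inv_k4 H = - (8 / 5) * lin1 A B.
Proof.
rewrite /inv_k4 slice_k4a slice_k4b slice_k4c slice_M12 eps_sum.
rewrite /lin1 /slice_w; move: v v0 => u u0.
cbv [pe]; rewrite !sum3E; expand; rewrite /sq3.
by field.
Qed.

(** The first factor is [v^3 / 9] times the alternating form [A . B]; the second, computed in
    [slice_w6], supplies [disc A]. *)
Lemma slice_k8 : inv_k8 H = - 96 * lin2 A B.
Proof.
have e : inner (cross (cov_w7 H) H) (contr 1 (cov_T6 H) (cov_T6 H)) =
    v ^+ 3 / 9 * (A o0 * B o0 + A o1 * B o1 + A o2 * B o2).
  have -> : inner (cross (cov_w7 H) H) (contr 1 (cov_T6 H) (cov_T6 H)) =
      inner (cross (symt 1 (vec1 w)) H) (symt 4 (symTT v)).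
    rewrite slice_w7 slice_T6 -sym_contr_xyz [LHS]innerC [RHS]innerC.
    by rewrite [RHS](@inner_sym _ char0 4) ?sym_in_symv.
  rewrite (@inner_cross_symt _ 0 3) eps_sum /slice_w.
  by move: v v0 => u u0; expand; field.
rewrite /inv_k8 e slice_w6 slice_M12 /lin2 /disc.
by move: v v0 => u u0; field.
Qed.

Lemma slice_k9a : inner (harmprod (harmpow (cov_w7 H) 2) H) (cov_J18 H) =
  pe 4 (fun a b c => f a b c * pe 2 (plus a b c (jac6 v)) w) one.
Proof.
rewrite slice_J18 slice_w7 (@inner_harmprod _ realR 2 4) ?jac6_harmonic //.
by rewrite (@inner_harmpow_tprod _ 4 2) ?jac6_harmonic // slice_wE.
Qed.

Lemma slice_k9b : inner (cross (contr 1 H (cov_w7 H)) (cov_w7 H)) (cov_T6 H) =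
  \sum_a \sum_b \sum_c eps R a b c * pe 0 (fun i1 i2 i3 => shift a (vec1 w) i1 i2 i3 *
    pe 2 (fun j1 j2 j3 => shift c (fun i j k => \sum_l shift l f i j k * w l) j1 j2 j3 *
      plus i1 i2 i3 (shift b (xyz v)) j1 j2 j3) one) one.
Proof.
rewrite slice_T6 slice_w7 -(@inner_cross_symt _ 2 0); congr (inner (cross _ _) _).
apply: (@entry_ext _ 3) => s sz; rewrite entry_symt // -[s]cats0.
rewrite [LHS](@entry_contr _ 1 4 1) //.
rewrite (big_tuple1 (fun k => entry H (s ++ k) * entry (symt 1 (vec1 w)) (k ++ [::]))).
apply: eq_bigr => l _; rewrite !entry_symt ?shift_rcons ?size_cat ?sz // cats0.
by rewrite cats0; congr (_ * _); elim/ord3P: l.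
Qed.

Lemma slice_k9 : inv_k9 H = - 6912 * lin3 A B.
Proof.
rewrite /inv_k9 slice_k9a slice_k9b slice_w6 slice_M12 eps_sum /lin3 /disc /slice_w.
move: v v0 => u u0; expand; rewrite !sum3E; expand.
by field.
Qed.

End SliceInvariants.

(** * Invariants of the tetrahedral group *)

Section TetrahedralAveraging.
Variable R : rcfType.
Implicit Types (a k x y : 'I_3 -> R).

Definition join3 x y (i : 'I_6) : R :=
  match split (i : 'I_(3 + 3)) with inl j => x j | inr j => y j end.

Definition fst3 (z : 'I_6 -> R) (i : 'I_3) : R := z (lshift 3 i).
Definition snd3 (z : 'I_6 -> R) (i : 'I_3) : R := z (rshift 3 i).

Lemma fst3_join x y : fst3 (join3 x y) = x.
Proof.
by apply: funext => i; rewrite /fst3 /join3 -[lshift 3 i]/(unsplit (inl i)) unsplitK.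
Qed.

Lemma snd3_join x y : snd3 (join3 x y) = y.
Proof.
by apply: funext => i; rewrite /snd3 /join3 -[rshift 3 i]/(unsplit (inr i)) unsplitK.
Qed.

Lemma join3_fst_snd z : join3 (fst3 z) (snd3 z) = z.
Proof.
apply: funext => i; rewrite /join3 -[in RHS](splitK (i : 'I_(3 + 3))).
by case: split.
Qed.

(* The sign changes (e1, e2, e1 e2) and the permutations generate T_d. *)
Definition td_type : finType := (bool * bool * 'S_3)%type.

Definition td_sign (t : td_type) (i : 'I_3) : R :=
  vec3 ((-1) ^+ t.1.1) ((-1) ^+ t.1.2) ((-1) ^+ t.1.1 * (-1) ^+ t.1.2) i.

Definition td_act (t : td_type) a (i : 'I_3) : R := td_sign t i * a (t.2 i).

Definition td_inv a : 'I_3 -> R := vec3 (sum_sq a) (prod3 a) (sum_sq2 a).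

(** Vieta's formulas for the cubic with roots [x]. *)
Lemma meval_mesym x : (forall i : 'I_3, (mesym 3 R i.+1).@[x] =
  vec3 (x o0 + x o1 + x o2) (x o0 * x o1 + x o0 * x o2 + x o1 * x o2)
    (x o0 * x o1 * x o2) i).
Proof.
pose cs := [tuple x i | i < 3].
have cx : tnth cs =1 x by move=> i; rewrite tnth_mktuple.
have E (i : 'I_3) : (mesym 3 R i.+1).@[x] =
    (-1) ^+ i.+1 * (\prod_(c <- cs) ('X - c%:P))`_(3 - i.+1).
  have := mroots_coeff cs (lift ord0 i); rewrite lift0 => ->.
  rewrite mulrA -exprD addnn -muln2 exprM sqrr_sign ?expr1n mul1r.
  by apply: meval_eq => j; rewrite cx.
have Q : \prod_(c <- cs) ('X - c%:P) = 'X^3 - (x o0 + x o1 + x o2) *: 'X^2 +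
    (x o0 * x o1 + x o0 * x o2 + x o1 * x o2) *: 'X - (x o0 * x o1 * x o2)%:P.
  rewrite big_tuple (eq_bigr (fun i => 'X - (x i)%:P)); last by move=> i _; rewrite cx.
  rewrite -!mul_polyC !polyCD !polyCM.
  rewrite !big_ord_recl big_ord0.
  have -> : lift ord0 ord0 = o1 :> 'I_3 by apply: val_inj.
  have -> : lift ord0 (lift ord0 ord0) = o2 :> 'I_3 by apply: val_inj.
  have -> : ord0 = o0 :> 'I_3 by apply: val_inj.
  by ring.
move=> i; rewrite E Q !(coefB, coefD, coefZ, coefXn, coefX, coefC).
by elim/ord3P: i; rewrite /vec3 /= ?subSS ?subn0 /=; ring.
Qed.

Lemma meval_msym n (u : 'S_n) (p : {mpoly R[n]}) (x : 'I_n -> R) :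
  (msym u p).@[x] = p.@[fun i => x (u i)].
Proof.
rewrite -[msym u p]comp_mpoly_id msym_mPo comp_mpoly_meval.
by apply: meval_eq => i; rewrite !tnth_mktuple mevalXU.
Qed.

(** The sum over sign changes vanishes unless the three exponents have the same parity [b]. Then the
    monomial is [prod3 a ^+ b] times a monomial in the squares, and the fundamental theorem on
    symmetric polynomials applies: [sum_sq], [sum_sq2] and [prod3 a ^+ 2] are the elementary
    symmetric functions of the squares. *)
Lemma td_sum_monomial (m : 'I_3 -> nat) : exists P : {mpoly R[3]}, forall a,
  \sum_(t : td_type) \prod_i td_act t a i ^+ m i = P.@[td_inv a].
Proof.
have E a : \sum_(t : td_type) \prod_i td_act t a i ^+ m i =
    (1 + (-1) ^+ (m o0 + m o2)) * (1 + (-1) ^+ (m o1 + m o2)) *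
    \sum_(s : 'S_3) \prod_i a (s i) ^+ m i.
  rewrite -(pair_big predT predT (fun e s => \prod_i td_act (e, s) a i ^+ m i)) /=.
  rewrite (eq_bigr (fun e : bool * bool => (\prod_i td_sign (e, 1%g) i ^+ m i) *
    \sum_(s : 'S_3) \prod_i a (s i) ^+ m i)); last first.
    move=> e _; rewrite mulr_sumr; apply: eq_bigr => s _.
    by rewrite -big_split; apply: eq_bigr => i _; rewrite exprMn.
  rewrite -mulr_suml; congr (_ * _).
  rewrite -(pair_big predT predT (fun e1 e2 => \prod_i td_sign (e1, e2, 1%g) i ^+ m i)) /=.
  rewrite !big_bool /= !big_ord_recl !big_ord0 /td_sign /vec3 /=.
  have -> : lift ord0 ord0 = o1 :> 'I_3 by apply: val_inj.
  have -> : lift ord0 (lift ord0 ord0) = o2 :> 'I_3 by apply: val_inj.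
  have -> : ord0 = o0 :> 'I_3 by apply: val_inj.
  rewrite !expr0 !expr1 !mulr1 !mul1r mulrNN mulr1 !expr1n !exprD.
  have := sqrr_sign R (m o2); rewrite expr2.
  set p := _ ^+ m o0; set q := _ ^+ m o1; set r := _ ^+ m o2 => r2.
  have -> : (1 + p * r) * (1 + q * r) = 1 + q * r + p * r + p * q * (r * r) by ring.
  by rewrite r2; ring.
have [/andP [e02 e12]|odd_case] :=
    boolP ((odd (m o0) == odd (m o2)) && (odd (m o1) == odd (m o2))); last first.
  exists 0 => a; rewrite E meval0.
  suff -> : (1 + (-1) ^+ (m o0 + m o2)) * (1 + (-1) ^+ (m o1 + m o2)) = 0 :> R.
    by rewrite mul0r.
  rewrite -signr_odd oddD -[X in _ * (1 + X)]signr_odd oddD.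
  by move: odd_case; case: odd; case: odd; case: odd; rewrite //= ?expr1 ?subrr ?mulr0 ?mul0r.
pose n i := (m i)./2; pose b := odd (m o2).
have mE i : m i = (b + n i * 2)%N.
  rewrite muln2 -[LHS]odd_double_half; congr (nat_of_bool _ + _)%N.
  by rewrite /b; elim/ord3P: i; rewrite ?(eqP e02) ?(eqP e12).
pose s : {mpoly R[3]} := \sum_(u : 'S_3) msym u 'X_[[multinom n i | i < 3]].
have ss : s \is symmetric.
  apply/issymP => u; rewrite /s raddf_sum /=.
  rewrite [RHS](reindex_inj (mulIg u)) /=.
  by apply: eq_bigr => w _; rewrite msymMm.
have [q [qs _]] := sym_fundamental ss.
(* The factor 4 counts the sign changes. [td_inv] lists its values by degree, with [prod3] in the
   middle, hence the order of the arguments of [q]. *)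
pose F (z : 'I_3 -> R) := 4 * z o1 ^+ b *
  q.@[fun i => vec3 (z o0) (z o2) (z o1 ^+ 2) i].
have [P hP] : polyfun F.
  apply: polyfunM; first by apply/polyfunM/polyfunXn/polyfunX; exact: polyfunC.
  apply: polyfun_meval => i; elim/ord3P: i; rewrite /vec3 /=.
  - exact: polyfunX.
  - exact: polyfunX.
  exact/polyfunXn/polyfunX.
exists P => a; rewrite E -hP /F /td_inv /vec3 /=.
have -> : (1 + (-1) ^+ (m o0 + m o2)) * (1 + (-1) ^+ (m o1 + m o2)) = 4 :> R.
  by rewrite -signr_odd oddD (eqP e02) addbb -[in X in _ * (1 + X)]signr_odd oddD
    (eqP e12) addbb expr0; ring.
rewrite -mulrA; congr (_ * _).
pose x i := a i ^+ 2.
have -> : \sum_(u : 'S_3) \prod_i a (u i) ^+ m i = prod3 a ^+ b * s.@[x].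
  rewrite /s raddf_sum mulr_sumr; apply: eq_bigr => u _ /=.
  rewrite meval_msym mevalX (_ : prod3 a = \prod_i a (u i)).
    rewrite -prodrXl -big_split; apply: eq_bigr => i _.
    by rewrite mE exprD mnmE /x mulnC exprM.
  transitivity (\prod_i a i); last by rewrite [LHS](reindex_inj (@perm_inj _ u)).
  by rewrite /prod3 !big_ord_recl big_ord0 mulr1 mulrA; congr (a _ * a _ * a _);
    apply: val_inj.
rewrite -qs comp_mpoly_meval; congr (_ * _); apply: meval_eq => i.
rewrite tnth_mktuple meval_mesym /x /sum_sq /sum_sq2 /prod3 /vec3.
by elim/ord3P: i => //=; ring.
Qed.

Lemma td_sum (p : {mpoly R[6]}) : exists P : {mpoly R[6]}, forall a k,
  \sum_(t : td_type) p.@[join3 (td_act t a) k] = P.@[join3 (td_inv a) k].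
Proof.
elim/mpolyind: p => [|c m p _ _ [P hP]].
  by exists 0 => a k; rewrite meval0 big1 // => t _; rewrite meval0.
have [Q hQ] := td_sum_monomial (fun i => m (lshift 3 i)).
have [Q' hQ'] : polyfun (fun z : 'I_6 -> R => c * Q.@[fst3 z] *
    \prod_i snd3 z i ^+ m (rshift 3 i)).
  apply: polyfunM; last first.
    by apply: polyfun_prod => i; apply/polyfunXn/polyfunX.
  apply: polyfunM; first exact: polyfunC.
  by apply: polyfun_meval => i; apply: polyfunX.
exists (Q' + P) => a k; rewrite mevalD -hP -hQ' fst3_join snd3_join -hQ.
rewrite mulr_sumr mulr_suml -big_split; apply: eq_bigr => t _ /=.
rewrite mevalD mevalZ mevalX -mulrA; congr (c * _ + _).
rewrite (@big_split_ord _ _ _ 3 3) /=; congr (_ * _); apply: eq_bigr => i _.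
  by rewrite -[join3 _ _ _]/(fst3 _ i) fst3_join.
by rewrite -[join3 _ _ _]/(snd3 _ i) snd3_join.
Qed.

(** Split [P] into parts even and odd in the variable standing for [prod3]. Replacing [a] by its
    opposite changes only the sign of [prod3], so both parts vanish; what is left is the
    independence of the elementary symmetric polynomials, taken at the squares. *)
Lemma td_inv_independent (P : {mpoly R[3]}) :
  (forall a, P.@[td_inv a] = 0) -> P = 0.
Proof.
move=> P0.
have [U [V hUV]] : exists U V : {mpoly R[3]}, forall z, P.@[z] =
    U.@[vec3 (z o0) (z o2) (z o1 ^+ 2)] + z o1 * V.@[vec3 (z o0) (z o2) (z o1 ^+ 2)].
  elim/mpolyind: (P) => [|c m p _ _ [U [V hUV]]].
    by exists 0, 0 => z; rewrite !meval0 mulr0 addr0.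
  have [M hM] : polyfun (fun w : 'I_3 -> R =>
      c * w o0 ^+ m o0 * w o1 ^+ m o2 * w o2 ^+ (m o1)./2).
    by do ?[apply: polyfunM | exact: polyfunC | apply/polyfunXn/polyfunX].
  exists (if odd (m o1) then U else M + U), (if odd (m o1) then M + V else V) => z.
  rewrite mevalD mevalZ mevalX hUV !big_ord_recl big_ord0 mulr1.
  have -> : lift ord0 ord0 = o1 :> 'I_3 by apply: val_inj.
  have -> : lift ord0 (lift ord0 ord0) = o2 :> 'I_3 by apply: val_inj.
  have -> : ord0 = o0 :> 'I_3 by apply: val_inj.
  have e : z o1 ^+ m o1 = z o1 ^+ odd (m o1) * (z o1 ^+ 2) ^+ (m o1)./2.
    by rewrite -exprM -exprD mul2n odd_double_half.
  rewrite e; case: odd; rewrite mevalD -hM /vec3 /= ?expr1 ?expr0; ring.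
have meval_S x T : (T \mPo [tuple mesym 3 R i.+1 | i < 3]).@[x] =
    T.@[vec3 (x o0 + x o1 + x o2) (x o0 * x o1 + x o0 * x o2 + x o1 * x o2)
      (x o0 * x o1 * x o2)].
  rewrite comp_mpoly_meval; apply: meval_eq => i.
  by rewrite tnth_mktuple meval_mesym.
have UV0 a : U.@[vec3 (sum_sq a) (sum_sq2 a) (prod3 a ^+ 2)] = 0 /\
    prod3 a * V.@[vec3 (sum_sq a) (sum_sq2 a) (prod3 a ^+ 2)] = 0.
  have := P0 a; have := P0 (fun i => - a i); rewrite !hUV /td_inv /vec3 /=.
  have -> : sum_sq (fun i => - a i) = sum_sq a by rewrite /sum_sq !sqrrN.
  have -> : sum_sq2 (fun i => - a i) = sum_sq2 a by rewrite /sum_sq2 !sqrrN.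
  have -> : prod3 (fun i => - a i) = - prod3 a by rewrite /prod3; ring.
  rewrite sqrrN mulNr; set u := U.@[_]; set w := prod3 a * _ => h1 h2.
  by split; lra.
(* With these values of [a] the squares are arbitrary natural numbers, which suffices to test a
   polynomial. *)
pose rt (x : 'I_3 -> nat) (i : 'I_3) : R := Num.sqrt (x i)%:R.
have rtE (x : 'I_3 -> nat) i : rt x i ^+ 2 = (x i)%:R by rewrite sqr_sqrtr // ler0n.
have arg (x : 'I_3 -> nat) : vec3 (sum_sq (rt x)) (sum_sq2 (rt x)) (prod3 (rt x) ^+ 2) =
    vec3 ((x o0)%:R + (x o1)%:R + (x o2)%:R)
      ((x o0)%:R * (x o1)%:R + (x o0)%:R * (x o2)%:R + (x o1)%:R * (x o2)%:R)
      ((x o0)%:R * (x o1)%:R * (x o2)%:R).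
  by rewrite /sum_sq /sum_sq2 /prod3 !exprMn !rtE.
have U0 : U = 0.
  apply: msym_fundamental_un0; apply: mpoly_eq0_nat => x.
  by rewrite meval_S -arg; case: (UV0 (rt x)).
have V0 : V = 0.
  apply: msym_fundamental_un0; apply/eqP.
  (* Only [prod3] times [V] is known to vanish. Another factor [prod3] makes this a polynomial in
     the squares, from which the three variables can be cancelled. *)
  have : 'X_o0 * 'X_o1 * 'X_o2 * (V \mPo [tuple mesym 3 R i.+1 | i < 3]) = 0.
    apply: mpoly_eq0_nat => x; rewrite !mevalM !mevalXU meval_S -arg -!rtE.
    have [_ e] := UV0 (rt x).
    rewrite -!exprMn -/(prod3 (rt x)) expr2 -mulrA e mulr0 //.
  move/eqP; rewrite !mulf_eq0 => /orP [/orP [/orP [|]|]|] //;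
    by move/eqP/(congr1 (meval (fun=> 1))); rewrite mevalXU meval0 => /eqP;
      rewrite oner_eq0.
by apply: mpoly_eq0 => z; rewrite hUV U0 V0 !meval0 mulr0 addr0.
Qed.

End TetrahedralAveraging.

(** * Geometry of the slice *)

Section Diagonalization.
Variable R : realType.

Definition mat3 (a b c d e f g h i : R) : 'M[R]_3 :=
  \matrix_(x, y) vec3 (vec3 a b c y) (vec3 d e f y) (vec3 g h i y) x.

Lemma det3 (M : 'M[R]_3) : \det M =
  M o0 o0 * (M o1 o1 * M o2 o2 - M o1 o2 * M o2 o1)
  - M o0 o1 * (M o1 o0 * M o2 o2 - M o1 o2 * M o2 o0)
  + M o0 o2 * (M o1 o0 * M o2 o1 - M o1 o1 * M o2 o0).
Proof.
rewrite (expand_det_row _ o0) !big_ord_recl big_ord0 /cofactor.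
rewrite !(expand_det_row _ ord0) !big_ord_recl !big_ord0 /cofactor !det_mx11 !mxE.
have e0 : ord0 = o0 :> 'I_3 by apply: val_inj.
have e1 : lift ord0 ord0 = o1 :> 'I_3 by apply: val_inj.
have e2 : lift ord0 (lift ord0 ord0) = o2 :> 'I_3 by apply: val_inj.
rewrite !(e1, e2, e0).
have l00 : lift o0 (ord0 : 'I_2) = o1 by apply: val_inj.
have l01 : lift o0 (lift ord0 ord0 : 'I_2) = o2 by apply: val_inj.
have l10 : lift o1 (ord0 : 'I_2) = o0 by apply: val_inj.
have l11 : lift o1 (lift ord0 ord0 : 'I_2) = o2 by apply: val_inj.
have l20 : lift o2 (ord0 : 'I_2) = o0 by apply: val_inj.
have l21 : lift o2 (lift ord0 ord0 : 'I_2) = o1 by apply: val_inj.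
have k0 (j : 'I_1) : lift (ord0 : 'I_2) j = lift ord0 ord0 by rewrite [j]ord1.
have k1 (j : 'I_1) : lift (lift ord0 ord0 : 'I_2) j = ord0.
  by rewrite [j]ord1; apply: val_inj.
rewrite ?(k0, k1) !(l00, l01, l10, l11, l20, l21) /= /bump /= !addn0 ?expr0 ?expr1 ?expr2.
by ring.
Qed.

Lemma mat3_SO3 (a b c d e f g h i : R) (M := mat3 a b c d e f g h i) :
  a * a + b * b + c * c = 1 -> d * d + e * e + f * f = 1 -> g * g + h * h + i * i = 1 ->
  a * d + b * e + c * f = 0 -> a * g + b * h + c * i = 0 -> d * g + e * h + f * i = 0 ->
  a * (e * i - f * h) - b * (d * i - f * g) + c * (d * h - e * g) = 1 -> SO3 M.
Proof.
move=> e1 e2 e3 e4 e5 e6 e7; split; last by rewrite det3 !mxE /vec3 /=.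
apply/matrixP => x y; rewrite !mxE sum3E !mxE.
elim/ord3P: x; elim/ord3P: y; rewrite /vec3 /= ?e1 ?e2 ?e3 ?e4 ?e5 ?e6 //; lra.
Qed.

(** Unless the vector lies on the third axis, the second row is a unit vector orthogonal to it and
    to that axis, and the third row is the cross product of the first two. *)
Lemma unit_row_rotation (x y z : R) : x * x + y * y + z * z = 1 ->
  exists g, SO3 g /\ [/\ g o0 o0 = x, g o0 o1 = y & g o0 o2 = z].
Proof.
move=> u1; have [n0|nn0] := eqVneq (x ^+ 2 + y ^+ 2) 0.
  move/eqP: n0; rewrite paddr_eq0 ?sqr_ge0 // !sqrf_eq0 => /andP [/eqP x0 /eqP y0].
  have z1 : z * z = 1 by rewrite -u1 x0 y0; ring.
  exists (mat3 x y z 1 0 0 0 z 0); split; last by rewrite !mxE.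
  by apply: mat3_SO3; subst x y; lra.
pose n := Num.sqrt (x ^+ 2 + y ^+ 2).
have nE : n ^+ 2 = x ^+ 2 + y ^+ 2 by rewrite sqr_sqrtr // addr_ge0 ?sqr_ge0.
have n0 : n != 0 by rewrite -sqrf_eq0 nE.
have xE : x * x = n ^+ 2 - y * y by rewrite nE; ring.
exists (mat3 x y z (- y / n) (x / n) 0 (- (z * x) / n) (- (z * y) / n) n).
split; last by rewrite !mxE.
have zE : z * z = 1 - n ^+ 2 by rewrite nE -u1; ring.
have yE : y ^+ 2 = n ^+ 2 - x ^+ 2 by rewrite nE; ring.
have zE2 : z ^+ 2 = 1 - n ^+ 2 by rewrite -zE; ring.
apply: mat3_SO3 => //.
- by field: yE.
- by field: yE zE2.
- by field.
- by field: yE zE2.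
- by field.
- by field: yE zE2.
Qed.

(** A Jacobi rotation: the tangent [t] of the angle solves a quadratic equation whose discriminant
    [D] is a sum of squares. *)
Lemma rotate2 (p q r : R) : exists c s : R,
  c * c + s * s = 1 /\ r * (c * c - s * s) + c * s * (q - p) = 0.
Proof.
have [->|r0] := eqVneq r 0.
  by exists 1, 0; split; ring.
pose D := (q - p) ^+ 2 + 4 * r ^+ 2.
have D0 : 0 <= D by rewrite addr_ge0 ?sqr_ge0 // mulr_ge0 ?sqr_ge0.
pose sD := Num.sqrt D; have sDE : sD ^+ 2 = D by rewrite sqr_sqrtr.
pose t := (q - p + sD) / (2 * r).
have tE : r * (1 - t ^+ 2) + t * (q - p) = 0.
  rewrite /t; have -> : r * (1 - ((q - p + sD) / (2 * r)) ^+ 2) + (q - p + sD) / (2 * r) * (q - p)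
    = (4 * r ^+ 2 + (q - p) ^+ 2 - sD ^+ 2) / (4 * r) by field.
  by rewrite sDE /D; field.
pose N := Num.sqrt (1 + t ^+ 2).
have NE : N ^+ 2 = 1 + t ^+ 2 by rewrite sqr_sqrtr // addr_ge0 ?sqr_ge0.
have N0 : N != 0 by rewrite -sqrf_eq0 NE; apply/lt0r_neq0/ltr_pwDl; rewrite ?sqr_ge0.
exists (N^-1), (t / N); split.
  have -> : N^-1 * N^-1 + t / N * (t / N) = (1 + t ^+ 2) / N ^+ 2 by field.
  by rewrite NE divff // -NE expf_neq0.
have -> : r * (N^-1 * N^-1 - t / N * (t / N)) + N^-1 * (t / N) * (q - p) =
  (r * (1 - t ^+ 2) + t * (q - p)) / N ^+ 2 by field.
by rewrite tE mul0r.
Qed.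

Lemma SO3_mul (g h : 'M[R]_3) : SO3 g -> SO3 h -> SO3 (g *m h).
Proof.
move=> [gO g1] [hO h1]; split; last by rewrite det_mulmx g1 h1 mulr1.
by rewrite trmx_mul mulmxA -(mulmxA g) hO mulmx1.
Qed.

(** The characteristic polynomial has odd degree, hence a real root. A unit eigenvector as first row
    of a rotation splits off by symmetry, and a plane rotation diagonalizes the remaining block. *)
Lemma symmetric3_diagonalization (S : 'M[R]_3) : S^T = S ->
  exists2 g, SO3 g & forall i j, i != j -> (g *m S *m g^T) i j = 0.
Proof.
move=> ST.
have [l /eigenvalueP [v0 vS vn0]] : exists l, eigenvalue S l.
  have [l rl] : {l | root (char_poly S) l}.
    by apply: odd_poly_root; rewrite size_char_poly.
  by exists l; rewrite eigenvalue_root_char.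
pose n2 := \sum_i v0 ord0 i ^+ 2.
have n2gt0 : 0 < n2.
  rewrite lt_def sumr_ge0 ?andbT => [|i _]; last exact: sqr_ge0.
  apply: contraNneq vn0 => /eqP; rewrite psumr_eq0 => [/allP h|i _]; last exact: sqr_ge0.
  apply/eqP/rowP => i; rewrite mxE; apply/eqP.
  by have := h i (mem_index_enum _); rewrite sqrf_eq0.
pose u := (Num.sqrt n2)^-1 *: v0.
have uS : u *m S = l *: u by rewrite -scalemxAl vS !scalerA mulrC.
have u1 : u ord0 o0 * u ord0 o0 + u ord0 o1 * u ord0 o1 + u ord0 o2 * u ord0 o2 = 1.
  rewrite !mxE; transitivity ((Num.sqrt n2)^-1 ^+ 2 * n2).
    by rewrite /n2 sum3E; ring.
  by rewrite exprVn sqr_sqrtr ?ltW // mulVf // gt_eqF.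
have [g1 [g1SO [r0 r1 r2]]] := unit_row_rotation u1.
have rowg : row o0 g1 = u.
  by apply/rowP => i; rewrite mxE; elim/ord3P: i.
pose S1 := g1 *m S *m g1^T.
have S1T : S1^T = S1 by rewrite !trmx_mul trmxK ST mulmxA.
have S1_0 j : j != o0 -> S1 o0 j = 0.
  move=> j0; have : row o0 S1 = l *: row o0 (g1 *m g1^T).
    by rewrite !row_mul rowg uS -scalemxAl.
  move/rowP/(_ j); rewrite g1SO.1 !mxE => ->.
  by rewrite eq_sym (negbTE j0) mulr0.
have S1s i j : S1 i j = S1 j i by rewrite -[in LHS]S1T mxE.
have [c [s [cs1 cs2]]] := rotate2 (S1 o1 o1) (S1 o2 o2) (S1 o1 o2).
pose g2 := mat3 1 0 0 0 c s 0 (- s) c.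
have g2SO : SO3 g2 by apply: mat3_SO3; lra.
exists (g2 *m g1); first exact: SO3_mul.
have e : g2 *m g1 *m S *m (g2 *m g1)^T = g2 *m S1 *m g2^T.
  by rewrite trmx_mul /S1 !mulmxA.
have E i j : (g2 *m S1 *m g2^T) i j =
    \sum_k \sum_m g2 i m * S1 m k * g2 j k.
  move: S1 g2 {S1T S1_0 S1s e cs2 g2SO} => X Y.
  rewrite mxE; apply: eq_bigr => k _; rewrite [Y^T k j]mxE mxE mulr_suml.
  by apply: eq_bigr.
have z01 : S1 o0 o1 = 0 by apply: S1_0.
have z02 : S1 o0 o2 = 0 by apply: S1_0.
have z10 : S1 o1 o0 = 0 by rewrite S1s.
have z20 : S1 o2 o0 = 0 by rewrite S1s.
have z21 : S1 o2 o1 = S1 o1 o2 by rewrite S1s.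
have G i j : g2 i j = vec3 (vec3 1 0 0 j) (vec3 0 c s j) (vec3 0 (- s) c j) i.
  by rewrite mxE.
move=> i j; rewrite e E !sum3E !G z01 z02 z10 z20 z21.
elim/ord3P: i; elim/ord3P: j => // _; rewrite /vec3 /=; lra.
Qed.

Lemma diagonalize_d2 (H : tensor R 4) : H \in harmonic R 4 -> exists2 g, SO3 g &
  forall i j, i != j -> entry (cov_d2 (act g H)) [:: i; j] = 0.
Proof.
move=> HH; pose S : 'M[R]_3 := \matrix_(i, j) entry (cov_d2 H) [:: i; j].
have ST : S^T = S.
  apply/matrixP => i j; rewrite !mxE.
  rewrite (entryE (cov_d2 H) [tuple i; j]) (entryE (cov_d2 H) [tuple j; i]) !ffunE.
  apply: eq_bigr => k _; rewrite !(tnth_nth ord0).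
  apply: (etrans (@entry_contr _ 2 4 4 _ _ [:: k; j] [:: k; i] erefl erefl)).
  apply: esym; apply: (etrans (@entry_contr _ 2 4 4 _ _ [:: k; i] [:: k; j] erefl erefl)).
  apply: eq_bigr => t _; rewrite mulrC; congr (_ * _).
    by apply: symv_perm_entry; rewrite ?harmonic_symv ?size_cat ?size_tuple // perm_catC.
  by apply: symv_perm_entry; rewrite ?harmonic_symv ?size_cat ?size_tuple // perm_catC.
have [g gSO gd] := symmetric3_diagonalization ST; exists g => // i j ij.
rewrite -(gd i j ij) act_d2 // entry_act //.
rewrite (big_tuple2 (fun u => weight g [:: i; j] u * entry (cov_d2 H) u)).
rewrite mxE exchange_big; apply: eq_bigr => k _ /=.
rewrite mxE mulr_suml; apply: eq_bigr => m _.
by rewrite !mxE !weight_cons weight_nil; ring.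
Qed.

End Diagonalization.

(** * Rational parametrization of the slice by [A] and [k] *)

Section SliceParametrization.
Variable R : realFieldType.
Implicit Types (L A B k x y : 'I_3 -> R) (M : 'I_3 -> 'I_3 -> R).

Definition det3f M : R :=
  M o0 o0 * (M o1 o1 * M o2 o2 - M o1 o2 * M o2 o1)
  - M o0 o1 * (M o1 o0 * M o2 o2 - M o1 o2 * M o2 o0)
  + M o0 o2 * (M o1 o0 * M o2 o1 - M o1 o1 * M o2 o0).

Definition app3 M x (i : 'I_3) : R := M i o0 * x o0 + M i o1 * x o1 + M i o2 * x o2.

(** The numerators of Cramer's rule. Free of division, they are polynomial, and the two lemmas that
    follow hold for singular [M] too. *)
Definition cramer M y (j : 'I_3) : R := det3f (fun i l => if l == j then y i else M i l).

Lemma cramer_sol M x y : (forall i, app3 M x i = y i) ->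
  forall j, cramer M y j = det3f M * x j.
Proof.
move=> h; elim/ord3P; rewrite /cramer /det3f /= -!h /app3; ring.
Qed.

Lemma cramer_app M y i : app3 M (cramer M y) i = det3f M * y i.
Proof. by elim/ord3P: i; rewrite /app3 /cramer /det3f /=; ring. Qed.

(* The off-diagonal components of d_2 are affine in L. *)
Definition offmx A B (i j : 'I_3) : R := vec3
  (vec3 (- (2 * A o0)) (7 / 2 * A o0 + B o0) (7 / 2 * A o0 - B o0) j)
  (vec3 (7 / 2 * A o1 - B o1) (- (2 * A o1)) (7 / 2 * A o1 + B o1) j)
  (vec3 (7 / 2 * A o2 + B o2) (7 / 2 * A o2 - B o2) (- (2 * A o2)) j) i.

Definition offcst A B : 'I_3 -> R := vec3
  (13 / 4 * A o1 * A o2 - 7 / 2 * A o1 * B o2 + 7 / 2 * A o2 * B o1 - B o1 * B o2)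
  (13 / 4 * A o0 * A o2 + 7 / 2 * A o0 * B o2 - 7 / 2 * A o2 * B o0 - B o0 * B o2)
  (13 / 4 * A o0 * A o1 - 7 / 2 * A o0 * B o1 + 7 / 2 * A o1 * B o0 - B o0 * B o1).

Definition offdiag L A B : 'I_3 -> R := vec3 (d2f (harm4 L A B) o1 o2)
  (d2f (harm4 L A B) o0 o2) (d2f (harm4 L A B) o0 o1).

Lemma offdiagE L A B i : offdiag L A B i = app3 (offmx A B) L i + offcst A B i.
Proof.
elim/ord3P: i; rewrite /offdiag /offcst /app3 /offmx /vec3 /d2f;
  cbv [pe shift nat_of_ord o0 o1 o2 harm4]; by field.
Qed.

(* k_4, k_8 and k_9 are linear in B. *)
Definition kmx A (i j : 'I_3) : R := vec3
  (- (8 / 5) * vec3 (A o0 * (A o1 ^+ 2 - A o2 ^+ 2)) (A o1 * (A o2 ^+ 2 - A o0 ^+ 2))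
      (A o2 * (A o0 ^+ 2 - A o1 ^+ 2)) j)
  (- 96 * disc A * A j)
  (- 6912 * disc A * vec3 (A o1 * A o2) (A o2 * A o0) (A o0 * A o1) j) i.

Definition kvec A B : 'I_3 -> R := app3 (kmx A) B.

Lemma kvecE A B i : kvec A B i =
  vec3 (- (8 / 5) * lin1 A B) (- 96 * lin2 A B) (- 6912 * lin3 A B) i.
Proof.
by elim/ord3P: i; rewrite /kvec /app3 /kmx /vec3 /lin1 /lin2 /lin3 /=; ring.
Qed.

(** Let n be [det3f (kmx A)]. Then [numA] and [numB] are n times [A] and [B]. As [offmx] and
    [offcst] are homogeneous of degrees 1 and 2, the system for [L] can be written at [numA] and
    [numB], where its solution is n times [L]; so [numL] is [slice_den] times [L], and all of these
    are polynomials. *)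
Definition numB A k := cramer (kmx A) k.
Definition numA A (i : 'I_3) : R := det3f (kmx A) * A i.
Definition offdet A k : R := det3f (offmx (numA A) (numB A k)).
Definition numL A k := cramer (offmx (numA A) (numB A k))
  (fun i => - offcst (numA A) (numB A k) i).
Definition slice_den A k : R := det3f (kmx A) * offdet A k.

Lemma offmx_scale c A B i j :
  offmx (fun l => c * A l) (fun l => c * B l) i j = c * offmx A B i j.
Proof. by elim/ord3P: i; elim/ord3P: j; rewrite /offmx /vec3 /=; ring. Qed.

Lemma offcst_scale c A B i :
  offcst (fun l => c * A l) (fun l => c * B l) i = c ^+ 2 * offcst A B i.
Proof. by elim/ord3P: i; rewrite /offcst /vec3 /=; ring. Qed.

Lemma app3_ext M M' x x' i : (forall j l, M j l = M' j l) -> (forall j, x j = x' j) ->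
  app3 M x i = app3 M' x' i.
Proof. by move=> eM ex; rewrite /app3 !eM !ex. Qed.

(* Written over the common denominator slice_den, also parA_of, which is A. *)
Definition parL_of A k (i : 'I_3) : R := numL A k i / slice_den A k.
Definition parA_of A k (i : 'I_3) : R := A i * slice_den A k / slice_den A k.
Definition parB_of A k (i : 'I_3) : R := numB A k i * offdet A k / slice_den A k.

Section Nonvanishing.
Variables A k : 'I_3 -> R.
Hypothesis d0 : slice_den A k != 0.
Let n0 : det3f (kmx A) != 0. Proof. by move: d0; rewrite mulf_eq0 negb_or => /andP []. Qed.
Let D0 : offdet A k != 0. Proof. by move: d0; rewrite mulf_eq0 negb_or => /andP []. Qed.

Lemma parA_ofE i : parA_of A k i = A i.
Proof. by rewrite /parA_of mulfK. Qed.

Lemma parB_ofE i : parB_of A k i = (det3f (kmx A))^-1 * numB A k i.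
Proof. by rewrite /parB_of /slice_den; field; rewrite n0 D0. Qed.

Lemma kvec_parB_of i : kvec A (parB_of A k) i = k i.
Proof.
rewrite /kvec (app3_ext (x' := fun i => (det3f (kmx A))^-1 * numB A k i) _ (fun _ _ => erefl) parB_ofE).
transitivity ((det3f (kmx A))^-1 * app3 (kmx A) (numB A k) i).
  by rewrite /app3; ring.
by rewrite cramer_app mulKf.
Qed.

Lemma offdiag_par_of i : offdiag (parL_of A k) (parA_of A k) (parB_of A k) i = 0.
Proof.
rewrite offdiagE; set n := det3f (kmx A).
have eA : parA_of A k = fun l => n^-1 * numA A l.
  by apply: funext => l; rewrite parA_ofE /numA mulKf.
have eB : parB_of A k = fun l => n^-1 * numB A k l.
  by apply: funext => l; rewrite parB_ofE.
rewrite eA eB offcst_scale.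
rewrite (app3_ext (M' := fun i j => n^-1 * offmx (numA A) (numB A k) i j)
  (x' := fun j => (slice_den A k)^-1 * numL A k j)) => [|j l|j].
- transitivity (n^-1 * (slice_den A k)^-1 * app3 (offmx (numA A) (numB A k)) (numL A k) i
    + n^-1 ^+ 2 * offcst (numA A) (numB A k) i).
    by congr (_ + _); rewrite /app3; ring.
  rewrite cramer_app -/(offdet A k) /slice_den -/n.
  by field; rewrite n0 D0.
- exact: offmx_scale.
by rewrite /parL_of mulrC.
Qed.

(** Together with [kvec_parB_of] and [offdiag_par_of], this makes the slice birational to the space
    of pairs of [A] and [k]. *)
Lemma par_of_unique L B : (forall i, offdiag L A B i = 0) -> (forall i, kvec A B i = k i) ->
  [/\ parL_of A k = L, parA_of A k = A & parB_of A k = B].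
Proof.
move=> off kB; have eB i : numB A k i = det3f (kmx A) * B i.
  exact: (cramer_sol kB).
have eBf : parB_of A k = B.
  by apply: funext => i; rewrite parB_ofE eB mulKf.
split=> //; last by apply: funext => i; rewrite parA_ofE.
apply: funext => i; rewrite /parL_of.
have e : (fun l => numB A k l) = fun l => det3f (kmx A) * B l by apply: funext.
have h j : app3 (offmx (numA A) (numB A k)) (fun l => det3f (kmx A) * L l) j =
    - offcst (numA A) (numB A k) j.
  rewrite -[numB A k]/(fun l => numB A k l) e offcst_scale.
  have := off j; rewrite offdiagE => /eqP; rewrite addr_eq0 => /eqP hj.
  transitivity (det3f (kmx A) ^+ 2 * app3 (offmx A B) L j).
    rewrite /app3 /numA !(offmx_scale (det3f (kmx A)) A B); ring.
  by rewrite hj; ring.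
by rewrite /numL (cramer_sol h) -/(offdet A k) /slice_den; field; rewrite n0 D0.
Qed.

End Nonvanishing.

Lemma harm4_scale c L A B a b e : harm4 (fun i => L i / c) (fun i => A i / c)
  (fun i => B i / c) a b e = harm4 L A B a b e / c.
Proof.
by move: a b e => [|[|[|[|[|a]]]]] [|[|[|[|[|b]]]]] [|[|[|[|[|e]]]]]; rewrite /harm4 /=; ring.
Qed.

Lemma d2f_scale c (f g : nat -> nat -> nat -> R) i j :
  (forall a b e, f a b e = g a b e / c) -> d2f f i j = d2f g i j / c ^+ 2.
Proof.
move=> fg; rewrite /d2f -exprVn.
have pe_scale n (f1 f2 : nat -> nat -> nat -> R) (s : R) x :
    (forall a b e, f1 a b e = f2 a b e * s) -> pe n f1 x = pe n f2 x * s.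
  elim: n f1 f2 => [|n IHn] f1 f2 h /=; first exact: h.
  rewrite (IHn (fun a b e => f1 a.+1 b e) (fun a b e => f2 a.+1 b e)) //.
  rewrite (IHn (fun a b e => f1 a b.+1 e) (fun a b e => f2 a b.+1 e)) //.
  by rewrite (IHn (fun a b e => f1 a b e.+1) (fun a b e => f2 a b e.+1)) //; ring.
apply: pe_scale => a b e.
by elim/ord3P: i; elim/ord3P: j; rewrite /shift /= !fg; ring.
Qed.

Definition num4 A k := harm4 (numL A k) (fun i => A i * slice_den A k)
  (fun i => numB A k i * offdet A k).

Definition num_vdm A k : R := vdm (fun i => d2f (num4 A k) i i).

(** [vdm] is cubic in the eigenvalues and these are quadratic in the tensor, whence the exponent
    6. *)
Lemma slice_vdm_par_of A k : slice_vdm (parL_of A k) (parA_of A k) (parB_of A k) =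
  num_vdm A k / slice_den A k ^+ 6.
Proof.
rewrite /slice_vdm /num_vdm /vdm.
have E i : d2f (harm4 (parL_of A k) (parA_of A k) (parB_of A k)) i i =
    d2f (num4 A k) i i / slice_den A k ^+ 2.
  by apply: d2f_scale => a b e; rewrite -harm4_scale.
rewrite !E; move: (d2f _ _ _) (d2f _ _ _) (d2f _ _ _) => x y z.
have -> : slice_den A k ^- 6 = slice_den A k ^- 2 * slice_den A k ^- 2 * slice_den A k ^- 2.
  by rewrite -!invfM -!exprD.
move: (slice_den A k ^- 2) => s; ring.
Qed.

(** A single point shows that the polynomials [slice_den] and [num_vdm] are not zero, which every
    genericity argument relies on. *)
Lemma slice_witness : exists A k, slice_den A k != 0 /\ num_vdm A k != 0.
Proof.
(* [L] is the solution of the linear system for the chosen [A] and [B], as [off] verifies. *)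
pose L := vec3 (- 7 / 5) (- 2 / 5) (- 2 / 5) : 'I_3 -> R.
pose A := vec3 2 4 12 : 'I_3 -> R.
pose B := vec3 2 (- 2) 6 : 'I_3 -> R.
have off i : offdiag L A B i = 0.
  rewrite offdiagE /offcst /app3 /offmx /L /A /B.
  by elim/ord3P: i; rewrite /vec3 /=; field.
have n0 : det3f (kmx A) != 0.
  by apply: ltr0_neq0; rewrite /det3f /kmx /disc /A /vec3 /=; lra.
have D0 : det3f (offmx A B) != 0.
  by apply: lt0r_neq0; rewrite /det3f /offmx /A /B /vec3 /=; lra.
have v0 : slice_vdm L A B != 0.
  apply: ltr0_neq0; rewrite /slice_vdm /vdm /d2f.
  by cbv [pe shift nat_of_ord o0 o1 o2 harm4 L A B vec3]; lra.
have eB i : numB A (kvec A B) i = det3f (kmx A) * B i by exact: cramer_sol.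
have d0 : slice_den A (kvec A B) != 0.
  rewrite /slice_den /offdet (_ : numB _ _ = fun i => det3f (kmx A) * B i); last exact: funext.
  rewrite mulf_neq0 //.
  have -> : det3f (offmx (numA A) (fun i => det3f (kmx A) * B i)) =
      det3f (kmx A) ^+ 3 * det3f (offmx A B).
    rewrite /numA; move: (det3f (kmx A)) => c.
    by rewrite /det3f !offmx_scale; ring.
  by rewrite mulf_neq0 // expf_neq0.
exists A, (kvec A B); split=> //.
have [eL eA eB'] := par_of_unique d0 off (fun _ => erefl).
have := slice_vdm_par_of A (kvec A B); rewrite eL eA eB' => e.
by apply: contraNneq v0 => h; rewrite e h mul0r.
Qed.

End SliceParametrization.

(** * The tetrahedral group on the slice *)

Section SliceInvariance.
Variable R : realType.
Local Notation tensor := (tensor R).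
Implicit Types (H : tensor 4) (t : td_type).

Definition diag_d2 H := forall i j, i != j -> entry (cov_d2 H) [:: i; j] = 0.

(* The sign of the permutation makes the determinant 1 and does not matter for *)
(* tensors of even order.                                                      *)
Definition td_mx t : 'M[R]_3 :=
  \matrix_(i, j) ((-1) ^+ t.2 * td_sign R t i * (t.2 i == j)%:R).

Definition td_coef t (i : 'I_3) : R := (-1) ^+ t.2 * td_sign R t i.

Lemma td_sign_sq t i : td_sign R t i * td_sign R t i = 1.
Proof.
rewrite /td_sign; elim/ord3P: i; rewrite /vec3 /=; case: t.1.1; case: t.1.2;
  by rewrite ?expr1 ?expr0; ring.
Qed.

Lemma td_sign_prod t : td_sign R t o0 * td_sign R t o1 * td_sign R t o2 = 1.
Proof.
by rewrite /td_sign /vec3 /=; case: t.1.1; case: t.1.2; rewrite ?expr1 ?expr0; ring.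
Qed.

Lemma td_coef_sq t i : td_coef t i * td_coef t i = 1.
Proof. by rewrite /td_coef mulrACA -expr2 sqrr_sign mul1r td_sign_sq. Qed.

(** In the determinant the sign of the permutation occurs four times: three times through the scalar
    factor and once through the permutation matrix. The sign changes have product 1. *)
Lemma td_mx_SO3 t : SO3 (td_mx t).
Proof.
split.
  apply/matrixP => i j; rewrite !mxE (bigD1 (t.2 i)) //= [X in _ + X]big1 ?addr0.
    rewrite !mxE eqxx mulr1 (inj_eq (@perm_inj _ t.2)) eq_sym.
    case: eqP => [->|_]; last by rewrite !mulr0.
    by rewrite mulr1 [LHS]td_coef_sq.
  by move=> k /negbTE ne; rewrite !mxE eq_sym ne mulr0 mul0r.
have -> : td_mx t = (-1) ^+ t.2 *: (diag_mx (\row_i td_sign R t i) *m perm_mx t.2).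
  by apply/matrixP => i j; rewrite mul_diag_mx !mxE mulrA.
rewrite detZ det_mulmx det_diag det_perm.
have -> : \prod_i (\row_i td_sign R t i) ord0 i = 1 :> R.
  rewrite -[RHS](td_sign_prod t) !big_ord_recl big_ord0 !mxE mulr1 mulrA.
  by congr (td_sign R t _ * td_sign R t _ * td_sign R t _); apply: val_inj.
have := sqrr_sign R t.2; set e := _ ^+ t.2 => e2.
by transitivity ((e ^+ 2) ^+ 2); [ring | rewrite e2 expr1n].
Qed.

Lemma entry_td_act t n (T : tensor n) s : size s = n ->
  entry (act (td_mx t) T) s = (\prod_(i <- s) td_coef t i) * entry T (map t.2 s).
Proof.
move=> sz; rewrite entry_act //.
have szm : size (map t.2 s) == n by rewrite size_map sz.
rewrite (bigD1 (Tuple szm)) //= [X in _ + X]big1 ?addr0 => [|u ut].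
  congr (_ * _); elim: s {sz szm} => [|i s IHs]; first by rewrite weight_nil big_nil.
  by rewrite /= weight_cons IHs big_cons mxE eqxx mulr1.
suff -> : weight (td_mx t) s u = 0 by rewrite mul0r.
have: tval u != map t.2 s by []; have: size (tval u) = size s by rewrite size_tuple sz.
move: (tval u) => v {ut}; elim: s v {u szm sz} => [|i s IHs] [|j v] //= [sv].
rewrite weight_cons mxE eqseq_cons negb_and eq_sym; case: eqP => [_ /= vs|_ _].
  by rewrite IHs ?mulr0.
by rewrite mulr0 mul0r.
Qed.

Lemma td_diag_d2 t H : diag_d2 H -> diag_d2 (act (td_mx t) H).
Proof.
move=> dH i j ij; rewrite act_d2; last exact: td_mx_SO3.
by rewrite entry_td_act //= dH ?mulr0 // (inj_eq (@perm_inj _ t.2)).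
Qed.

(** [A] collects the components in which all three axes occur, one of them twice. Their sign is the
    product of the three sign changes, which is 1, times that of the repeated axis. *)
Lemma td_parA t H : H \in harmonic R 4 -> parA (act (td_mx t) H) = td_act t (parA H).
Proof.
move=> HH; rewrite {1}(harmonic4_param HH); set L := parL H; set A := parA H; set B := parB H.
have c4 a b c d : \prod_(i <- [:: a; b; c; d]) td_coef t i =
    td_sign R t a * td_sign R t b * td_sign R t c * td_sign R t d.
  rewrite !big_cons big_nil /td_coef; have := sqrr_sign R t.2; rewrite expr2.
  set e := _ ^+ t.2 => e2; transitivity ((e * e) * (e * e) *
    (td_sign R t a * td_sign R t b * td_sign R t c * td_sign R t d)); first by ring.
  by rewrite e2; ring.
have sg : td_sign R t o0 * td_sign R t o1 * td_sign R t o2 = 1 := td_sign_prod t.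
have x01 : t.2 o0 != t.2 o1 by rewrite (inj_eq (@perm_inj _ t.2)).
have x02 : t.2 o0 != t.2 o2 by rewrite (inj_eq (@perm_inj _ t.2)).
have x12 : t.2 o1 != t.2 o2 by rewrite (inj_eq (@perm_inj _ t.2)).
have h4 x y z : x != y -> x != z -> y != z ->
    [/\ entry (symt 4 (harm4 L A B)) [:: x; x; y; z] = A x,
      entry (symt 4 (harm4 L A B)) [:: x; y; y; z] = A y &
      entry (symt 4 (harm4 L A B)) [:: x; y; z; z] = A z].
  by elim/ord3P: x; elim/ord3P: y; elim/ord3P: z => // _ _ _; rewrite !entry_symt.
have [h1 h2 h3] := h4 _ _ _ x01 x02 x12.
apply: funext; elim/ord3P; rewrite /parA /vec3 /td_act /=;
  rewrite entry_td_act //= c4 ?h1 ?h2 ?h3; congr (_ * _); rewrite -[RHS]mulr1 -sg; ring.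
Qed.

Lemma offdiag_eq0 H : H \in harmonic R 4 -> diag_d2 H ->
  forall i, offdiag (parL H) (parA H) (parB H) i = 0.
Proof.
move=> HH dH; elim/ord3P; rewrite /offdiag /vec3 /=;
  by rewrite -entry_d2 -(harmonic4_param HH) dH.
Qed.

Lemma tnth6E (a b c d e f : R) :
  tnth [tuple a; b; c; d; e; f] = join3 (vec3 a b c) (vec3 d e f).
Proof.
apply: funext => i; have <- := @splitK 3 3 i; case: (@split 3 3 i) => j;
  by rewrite /join3 unsplitK (tnth_nth a); elim/ord3P: j.
Qed.

Lemma tnth6_ext (a b c d e f a' b' c' d' e' f' : R) :
  a = a' -> b = b' -> c = c' -> d = d' -> e = e' -> f = f' ->
  tnth [tuple a; b; c; d; e; f] = tnth [tuple a'; b'; c'; d'; e'; f'].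
Proof. by move=> -> -> -> -> -> ->. Qed.

Definition invariants H : 'I_6 -> R :=
  tnth [tuple inv_i2 H; inv_i3 H; inv_i4 H; inv_k4 H; inv_k8 H; inv_k9 H].

Lemma invariants_act g H : SO3 g -> invariants (act g H) = invariants H.
Proof.
move=> gSO; exact: (tnth6_ext (act_i2 gSO H) (act_i3 gSO H) (act_i4 gSO H)
  (act_k4 gSO H) (act_k8 gSO H) (act_k9 gSO H)).
Qed.

(** A triangular polynomial change of coordinates with polynomial inverse [of_inv], so polynomials
    in the six invariants are the same as polynomials in [td_inv] and [k]. *)
Definition to_inv (z : 'I_6 -> R) : 'I_6 -> R := join3
  (vec3 (6 * fst3 z o0) (36 * fst3 z o1) (24 * (fst3 z o2 - fst3 z o0 ^+ 2 / 5)))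
  (snd3 z).

Definition of_inv (z : 'I_6 -> R) : 'I_6 -> R := join3
  (vec3 (fst3 z o0 / 6) (fst3 z o1 / 36) (fst3 z o2 / 24 + (fst3 z o0 / 6) ^+ 2 / 5))
  (snd3 z).

Lemma to_invK : cancel to_inv of_inv.
Proof.
move=> z; rewrite /of_inv /to_inv fst3_join snd3_join -[RHS]join3_fst_snd.
congr (join3 _ _); apply: funext; elim/ord3P; rewrite /vec3 /=; by field.
Qed.

Lemma of_invK : cancel of_inv to_inv.
Proof.
move=> z; rewrite /of_inv /to_inv fst3_join snd3_join -[RHS]join3_fst_snd.
congr (join3 _ _); apply: funext; elim/ord3P; rewrite /vec3 /=; by field.
Qed.

Definition par_k H : 'I_3 -> R := kvec (parA H) (parB H).

Lemma M12_vdm H : H \in harmonic R 4 -> diag_d2 H ->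
  inv_M12 H = slice_vdm (parL H) (parA H) (parB H) ^+ 2 / 6.
Proof.
move=> HH /(offdiag_eq0 HH) off; rewrite {1}(harmonic4_param HH) slice_M12 //.
- exact: (off o2).
- exact: (off o1).
exact: (off o0).
Qed.

Lemma slice_invariants H : H \in harmonic R 4 -> diag_d2 H -> inv_M12 H != 0 ->
  invariants H = to_inv (join3 (td_inv (parA H)) (par_k H)).
Proof.
move=> HH dH M0; have off := offdiag_eq0 HH dH.
have e01 := off o2; have e02 := off o1; have e12 := off o0.
have v0 : slice_vdm (parL H) (parA H) (parB H) != 0.
  by apply: contraNneq M0 => v0; rewrite M12_vdm // v0 expr0n mul0r.
have eH := harmonic4_param HH; set f := harm4 _ _ _ in eH.
rewrite {1}eH /invariants tnth6E /to_inv fst3_join snd3_join.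
congr (join3 (vec3 _ _ _) _).
- exact: (slice_i2 e01 e02 e12 v0).
- exact: (slice_i3 e01 e02 e12 v0).
- exact: (slice_i4 e01 e02 e12 v0).
apply: funext; elim/ord3P; rewrite /par_k kvecE /vec3 /=.
- exact: (slice_k4 e01 e02 e12 v0).
- exact: (slice_k8 e01 e02 e12 v0).
exact: (slice_k9 e01 e02 e12 v0).
Qed.

(** [k] needs no computation here: on the slice it is the last half of the six invariants, which
    rotations preserve. *)
Lemma td_rotation t H : H \in harmonic R 4 -> diag_d2 H -> inv_M12 H != 0 ->
  exists g, [/\ SO3 g, act g H \in harmonic R 4, diag_d2 (act g H),
    parA (act g H) = td_act t (parA H) & par_k (act g H) = par_k H].
Proof.
move=> HH dH M0; exists (td_mx t); have gSO := td_mx_SO3 t.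
have HH' : act (td_mx t) H \in harmonic R 4 by apply: act_harmonic; case: gSO.
have dH' := td_diag_d2 t dH; split => //; first exact: td_parA.
have M0' : inv_M12 (act (td_mx t) H) != 0 by rewrite act_M12.
have := invariants_act H gSO; rewrite !slice_invariants //.
by move/(congr1 (@snd3 R)); rewrite !snd3_join.
Qed.

Lemma slice_rep H : H \in harmonic R 4 -> diag_d2 H ->
  slice_den (parA H) (par_k H) != 0 ->
  H = symt 4 (harm4 (parL_of (parA H) (par_k H)) (parA_of (parA H) (par_k H))
        (parB_of (parA H) (par_k H))).
Proof.
move=> HH dH d0.
have [-> -> ->] := par_of_unique d0 (offdiag_eq0 HH dH) (fun _ => erefl).
exact: harmonic4_param.
Qed.

End SliceInvariance.

(** * Generation and independence *)

Section PolynomialData.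
Variable R : realType.
Local Notation V := ('I_6 -> R).
Implicit Types (F G : 'I_3 -> V -> R).

Lemma polyfun_vec3 (a b c : V -> R) (i : 'I_3) : polyfun a -> polyfun b -> polyfun c ->
  polyfun (fun z : V => vec3 (a z) (b z) (c z) i).
Proof. by elim/ord3P: i; rewrite /vec3 /=. Qed.

Lemma polyfun_det3f (M : 'I_3 -> 'I_3 -> V -> R) : (forall i j, polyfun (M i j)) ->
  polyfun (fun z : V => det3f (fun i j => M i j z)).
Proof.
move=> h; rewrite /det3f.
by do ?[exact: h | apply: polyfunD | apply: polyfunM | apply: polyfunN].
Qed.

Lemma polyfun_cramer (M : 'I_3 -> 'I_3 -> V -> R) F j : (forall i j, polyfun (M i j)) ->
  (forall i, polyfun (F i)) -> polyfun (fun z : V => cramer (fun i j => M i j z) (F^~ z) j).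
Proof.
move=> hM hF; apply: (polyfun_det3f (M := fun i l z => if l == j then F i z else M i l z)).
by move=> i l; case: eqP.
Qed.

Ltac poly := repeat first [
  match goal with h : forall i, polyfun _ |- _ => exact: h end |
  apply: polyfunD | apply: polyfunN | apply: polyfunM | apply: polyfunXn |
  exact: polyfunX | exact: polyfunC ].

Lemma polyfun_offmx F G i j : (forall i, polyfun (F i)) -> (forall i, polyfun (G i)) ->
  polyfun (fun z : V => offmx (F^~ z) (G^~ z) i j).
Proof.
move=> hF hG; elim/ord3P: i; elim/ord3P: j; rewrite /offmx /vec3 /=; poly.
Qed.

Lemma polyfun_offcst F G i : (forall i, polyfun (F i)) -> (forall i, polyfun (G i)) ->
  polyfun (fun z : V => offcst (F^~ z) (G^~ z) i).
Proof. by move=> hF hG; elim/ord3P: i; rewrite /offcst /vec3 /=; poly. Qed.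

Lemma polyfun_kmx F i j : (forall i, polyfun (F i)) -> polyfun (fun z : V => kmx (F^~ z) i j).
Proof.
move=> hF; have hd : polyfun (fun z : V => disc (F^~ z)) by rewrite /disc; poly.
apply: polyfun_vec3.
- by apply: (polyfunM (polyfunC _ (- (8 / 5)))); apply: polyfun_vec3; poly.
- exact: (polyfunM (polyfunM (polyfunC _ (- 96)) hd) (hF j)).
apply: (polyfunM (polyfunM (polyfunC _ (- 6912)) hd)).
by apply: polyfun_vec3; apply: polyfunM.
Qed.

Let A (i : 'I_3) : V -> R := fun z => fst3 z i.
Let k (i : 'I_3) : V -> R := fun z => snd3 z i.
Let hA i : polyfun (A i). Proof. exact: polyfunX. Qed.
Let hk i : polyfun (k i). Proof. exact: polyfunX. Qed.

Let hnB i : polyfun (fun z : V => numB (fst3 z) (snd3 z) i).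
Proof. by apply: polyfun_cramer => // ? ?; apply: polyfun_kmx. Qed.

Let hn : polyfun (fun z : V => det3f (kmx (fst3 z))).
Proof. by apply: polyfun_det3f => ? ?; apply: polyfun_kmx. Qed.

Let hnA i : polyfun (fun z : V => numA (fst3 z) i).
Proof. exact: (polyfunM hn (hA i)). Qed.

Let hM i j : polyfun (fun z : V => offmx (numA (fst3 z)) (numB (fst3 z) (snd3 z)) i j).
Proof.
exact: (@polyfun_offmx (fun i z => numA (fst3 z) i) (fun i z => numB (fst3 z) (snd3 z) i)).
Qed.

Let hD : polyfun (fun z : V => offdet (fst3 z) (snd3 z)).
Proof. exact: (polyfun_det3f hM). Qed.

Lemma polyfun_slice_den : polyfun (fun z : V => slice_den (fst3 z) (snd3 z)).
Proof. exact: (polyfunM hn hD). Qed.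

Let hL i : polyfun (fun z : V => numL (fst3 z) (snd3 z) i).
Proof.
apply: (polyfun_cramer (F := fun i z => - offcst (numA (fst3 z)) (numB (fst3 z) (snd3 z)) i)).
  exact: hM.
move=> l; apply: polyfunN.
exact: (@polyfun_offcst (fun i z => numA (fst3 z) i) (fun i z => numB (fst3 z) (snd3 z) i)).
Qed.

Lemma polyfun_num4 a b c : polyfun (fun z : V => num4 (fst3 z) (snd3 z) a b c).
Proof.
have hA' i : polyfun (fun z : V => fst3 z i * slice_den (fst3 z) (snd3 z)).
  exact: (polyfunM (hA i) polyfun_slice_den).
have hB' i : polyfun (fun z : V => numB (fst3 z) (snd3 z) i * offdet (fst3 z) (snd3 z)).
  exact: (polyfunM (hnB i) hD).
rewrite /num4; move: a b c => [|[|[|[|[|a]]]]] [|[|[|[|[|b]]]]] [|[|[|[|[|c]]]]];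
  rewrite /harm4 /=; poly.
Qed.

Lemma polyfun_pe n (f : nat -> nat -> nat -> V -> R) :
  (forall a b c, polyfun (f a b c)) -> polyfun (fun z : V => pe n (fun a b c => f a b c z) (fun=> 1)).
Proof.
elim: n f => [|n IHn] f h /=; first exact: h.
apply: polyfunD; first apply: polyfunD; apply: polyfunM; try exact: polyfunC.
- exact: (IHn (fun a b c => f a.+1 b c)).
- exact: (IHn (fun a b c => f a b.+1 c)).
exact: (IHn (fun a b c => f a b c.+1)).
Qed.

Lemma polyfun_num_vdm : polyfun (fun z : V => num_vdm (fst3 z) (snd3 z)).
Proof.
have hd i : polyfun (fun z : V => d2f (num4 (fst3 z) (snd3 z)) i i).
  apply: (@polyfun_pe 3 (fun a b c z => shift i (num4 (fst3 z) (snd3 z)) a b c *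
    shift i (num4 (fst3 z) (snd3 z)) a b c)) => a b c.
  by elim/ord3P: i; exact: (polyfunM (polyfun_num4 _ _ _) (polyfun_num4 _ _ _)).
rewrite /num_vdm /vdm.
by repeat first [exact: hd | apply: polyfunD | apply: polyfunM | apply: polyfunN].
Qed.

Lemma polyfun_of_inv i : polyfun (fun z : V => of_inv z i).
Proof.
rewrite /of_inv /join3; case: split => j; last exact: polyfunX.
by elim/ord3P: j; rewrite /vec3 /=; poly; exact: polyfunX.
Qed.

Lemma polyfun_to_inv i : polyfun (fun z : V => to_inv z i).
Proof.
rewrite /to_inv /join3; case: split => j; last exact: polyfunX.
by elim/ord3P: j; rewrite /vec3 /=; poly; exact: polyfunX.
Qed.

Lemma meval_of_inv (P : {mpoly R[6]}) :
  exists Q : {mpoly R[6]}, forall z, Q.@[to_inv z] = P.@[z].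
Proof.
have [Q hQ] := polyfun_meval P polyfun_of_inv; exists Q => z.
by rewrite -hQ -[in RHS](to_invK z).
Qed.

Lemma meval_to_inv (P : {mpoly R[6]}) :
  exists Q : {mpoly R[6]}, forall z, Q.@[z] = P.@[to_inv z].
Proof. by have [Q hQ] := polyfun_meval P polyfun_to_inv; exists Q => z; rewrite -hQ. Qed.

End PolynomialData.

(** * Comparison of rational functions through their values *)

Section SpecializationTheory.
Variables (R : realType) (n : nat) (m : {mpoly R[n]}).
Hypothesis m0 : m != 0.
Local Notation K := {fraction {mpoly R[n]}}.
Implicit Types (f g : K) (phi : ('I_n -> R) -> R).

(** A numerator that vanishes wherever [m] does not has zero product with [m] at every point, and
    [m] can be cancelled. *)
Lemma specializes_eq0 f phi : specializes m f phi ->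
  (f = 0) <-> (forall h, m.@[h] != 0 -> phi h = 0).
Proof.
move=> [N [r [-> hr]]].
have mN0 : (m%:F) ^+ N != 0 :> K by rewrite expf_neq0 // tofrac_eq0.
split=> [/eqP|h0].
  rewrite mulf_eq0 invr_eq0 (negbTE mN0) orbF tofrac_eq0 => /eqP r0 h mh.
  by rewrite hr // r0 meval0 mul0r.
suff -> : r = 0 by rewrite tofrac0 mul0r.
have: r * m = 0.
  apply: mpoly_eq0 => h; rewrite mevalM; have [->|mh] := eqVneq m.@[h] 0.
    by rewrite mulr0.
  have := h0 h mh; rewrite hr // => /eqP; rewrite mulf_eq0 invr_eq0 expf_eq0.
  by rewrite (negbTE mh) andbF orbF => /eqP ->; rewrite mul0r.
by move/eqP; rewrite mulf_eq0 (negbTE m0) orbF => /eqP.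
Qed.

Lemma specializes_inj f g phi : specializes m f phi -> specializes m g phi -> f = g.
Proof.
move=> hf hg; apply/eqP; rewrite -subr_eq0; apply/eqP.
apply/(specializes_eq0 (specializesD m0 hf (specializesN hg))) => h _.
by rewrite subrr.
Qed.

Lemma specializes_neq0 f phi (q : {mpoly R[n]}) : specializes m f phi -> f != 0 -> q != 0 ->
  exists h, [/\ m.@[h] != 0, q.@[h] != 0 & phi h != 0].
Proof.
move=> [N [r [-> hr]]] f0 q0.
have r0 : r != 0 by apply: contraNneq f0 => ->; rewrite tofrac0 mul0r.
have /mpoly_neq0P [h] : r * q * m != 0 by rewrite !mulf_neq0.
rewrite !mevalM !mulf_eq0 !negb_or => /andP [/andP [rh qh] mh].
by exists h; split=> //; rewrite hr // mulf_neq0 // invr_eq0 expf_neq0.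
Qed.

End SpecializationTheory.

Lemma tnth6_ind (S S' X : Type) (Q : S -> (X -> S') -> Prop) a0 a1 a2 a3 a4 a5
    (f0 f1 f2 f3 f4 f5 : X -> S') :
  Q a0 f0 -> Q a1 f1 -> Q a2 f2 -> Q a3 f3 -> Q a4 f4 -> Q a5 f5 -> forall i,
  Q (tnth [tuple a0; a1; a2; a3; a4; a5] i)
    (fun h => tnth [tuple f0 h; f1 h; f2 h; f3 h; f4 h; f5 h] i).
Proof. by move=> ? ? ? ? ? ? [[|[|[|[|[|[|i]]]]]] lti]. Qed.

Section Main.
Variable R : realType.
Local Notation H4 := (harmonic R 4).
Local Notation dimH4 := (\dim H4).
Local Notation basisH4 := (vbasis H4).
Local Notation K := (ratfun R).
Local Notation gen := (generic R).
Implicit Types h : 'I_dimH4 -> R.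

Definition inv_frac : 'I_6 -> K :=
  tnth [tuple inv_i2 gen; inv_i3 gen; inv_i4 gen; inv_k4 gen; inv_k8 gen; inv_k9 gen].

Lemma M12_frac : exists m : {mpoly R[dimH4]},
  inv_M12 gen = m%:F /\ forall h, inv_M12 (point h) = m.@[h].
Proof. exact: (specializes1P (specializes_M12 (tspecializes_generic R))). Qed.

Definition slice_tensor (A k : 'I_3 -> R) : tensor R 4 :=
  symt 4 (harm4 (parL_of A k) (parA_of A k) (parB_of A k)).

(** The converse of [slice_invariants]: off the zeros of two polynomials, [A] and [k] can be
    prescribed at will. *)
Lemma slice_tensor_invariants (A k : 'I_3 -> R) :
  slice_den A k != 0 -> num_vdm A k != 0 ->
  [/\ slice_tensor A k \in H4, inv_M12 (slice_tensor A k) != 0 &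
      invariants (slice_tensor A k) = to_inv (join3 (td_inv A) k)].
Proof.
move=> d0 v0; have off := offdiag_par_of d0.
have e01 := off o2; have e02 := off o1; have e12 := off o0.
have vn0 : slice_vdm (parL_of A k) (parA_of A k) (parB_of A k) != 0.
  by rewrite slice_vdm_par_of mulf_neq0 // invr_eq0 expf_neq0.
have eA : parA_of A k = A by apply: funext => i; rewrite parA_ofE.
split; first exact: harm4_harmonic.
  rewrite (slice_M12 e01 e02 e12) mulf_neq0 ?expf_neq0 //.
  by rewrite invr_eq0 pnatr_eq0.
rewrite /slice_tensor /invariants tnth6E /to_inv fst3_join snd3_join.
congr (join3 (vec3 _ _ _) _).
- by rewrite (slice_i2 e01 e02 e12 vn0) eA.
- by rewrite (slice_i3 e01 e02 e12 vn0) eA.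
- by rewrite (slice_i4 e01 e02 e12 vn0) eA.
apply: funext => i; rewrite -[RHS](kvec_parB_of d0) kvecE.
elim/ord3P: i; rewrite /vec3 /=.
- by rewrite (slice_k4 e01 e02 e12 vn0) eA.
- by rewrite (slice_k8 e01 e02 e12 vn0) eA.
by rewrite (slice_k9 e01 e02 e12 vn0) eA.
Qed.

Section WithM12.
Variable m : {mpoly R[dimH4]}.
Hypothesis Hm : inv_M12 gen = m%:F.
Hypothesis Em : forall h, inv_M12 (point h) = m.@[h].

Lemma M12_neq0 : m != 0.
Proof.
have [A [k [d0 v0]]] := slice_witness R.
have [HH M0 _] := slice_tensor_invariants d0 v0.
apply: contraNneq M0 => m0.
by rewrite -(point_coord HH) Em m0 meval0.
Qed.

Let m0 := M12_neq0.

Lemma specializes_inv i : specializes m (inv_frac i) (fun h => invariants (point h) i).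
Proof.
have G := tspecializes_generic R.
exact: (tnth6_ind (Q := specializes m) (specializes_i2 G Hm Em)
  (specializes_i3 G Hm Em) (specializes_i4 G Hm Em) (specializes_k4 G m0 Hm Em)
  (specializes_k8 G Hm Em) (specializes_k9 G m0 Hm Em)).
Qed.

Lemma specializes_rateval (P : {mpoly R[6]}) :
  specializes m (rateval inv_frac P) (fun h => P.@[invariants (point h)]).
Proof. exact: (specializes_mmap m0 P specializes_inv). Qed.

(** A relation vanishes at all slice tensors, hence at [td_inv A] and [k] for generic [A] and [k],
    hence for all of them; for each fixed [k] it is then a relation between the values of
    [td_inv]. *)
Lemma invariants_independent : alg_independent inv_frac.
Proof.
move=> P P0; have [Q hQ] := meval_to_inv P.
suff Q0 z : Q.@[z] = 0.
  by apply: mpoly_eq0 => y; rewrite -(of_invK y) -hQ Q0.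
have Qtd A k : Q.@[join3 (td_inv A) k] = 0.
  have [D hD] := polyfunM (polyfun_slice_den R) (polyfun_num_vdm R).
  have [S hS] : polyfun (fun z => Q.@[join3 (td_inv (fst3 z)) (snd3 z)]).
    apply: polyfun_meval => i; rewrite /join3; case: split => j.
      apply: polyfun_vec3; rewrite /sum_sq /prod3 /sum_sq2;
        by repeat first [apply: polyfunD | apply: polyfunM | apply: polyfunXn | exact: polyfunX].
    exact: polyfunX.
  (* [D] vanishes wherever the slice tensor fails to be defined or has [inv_M12] equal to 0, so the
     product vanishes everywhere. *)
  have /eqP : S * D = 0.
    apply: mpoly_eq0 => y; rewrite mevalM -hS -hD.
    have [->|d0] := eqVneq (slice_den (fst3 y) (snd3 y)) 0; first by rewrite mul0r mulr0.
    have [->|v0] := eqVneq (num_vdm (fst3 y) (snd3 y)) 0; first by rewrite !mulr0.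
    have [HH M0 e] := slice_tensor_invariants d0 v0.
    rewrite hQ -e -(point_coord HH).
    rewrite (iffLR (specializes_eq0 m0 (specializes_rateval P)) P0) ?mul0r //.
    by rewrite -Em point_coord.
  rewrite mulf_eq0 => /orP [/eqP S0|/eqP D0].
    by have := hS (join3 A k); rewrite S0 meval0 fst3_join snd3_join.
  have [A' [k' [d0 v0]]] := slice_witness R.
  have := hD (join3 A' k'); rewrite D0 meval0 fst3_join snd3_join => /eqP.
  by rewrite mulf_eq0 (negbTE d0) (negbTE v0).
have [T hT] : polyfun (fun y : 'I_3 -> R => Q.@[join3 y (snd3 z)]).
  apply: polyfun_meval => i; rewrite /join3; case: split => j; first exact: polyfunX.
  exact: polyfunC.
have T0 : T = 0 by apply: td_inv_independent => a; rewrite -hT Qtd.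
by rewrite -(join3_fst_snd z) hT T0 meval0.
Qed.

(** The denominator is a power of the invariant [m], and the values are invariant where [m] is not
    zero; so the numerator agrees with its rotated form there, hence everywhere. *)
Lemma inv_frac_invariant i : rational_invariant (inv_frac i).
Proof.
have [N [r [-> hr]]] := specializes_inv i.
rewrite -tofracXn; apply/rational_invariantP; first by rewrite expf_neq0.
move=> g gSO h.
have mg h' : m.@[act_point g h'] = m.@[h'] by rewrite -!Em act_pointE // act_M12.
rewrite !rmorphXn /= mg; congr (_ * _).
have [p hp] : polyfun (fun h => r.@[act_point g h]).
  by exists (act_poly g r) => h'; rewrite meval_act_poly.
suff e : p = r by rewrite hp e.
apply/eqP; rewrite -subr_eq0.
have: (p - r) * m = 0.
  apply: mpoly_eq0 => h'; rewrite mevalM mevalB -hp.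
  have [->|mh] := eqVneq m.@[h'] 0; first by rewrite mulr0.
  have mh' : m.@[act_point g h'] != 0 by rewrite mg.
  have := hr _ mh'; rewrite act_pointE // invariants_act // hr // mg => /divIf e.
  by rewrite e ?subrr ?mul0r // expf_neq0.
by move/eqP; rewrite mulf_eq0 (negbTE m0) orbF.
Qed.

Definition slice_coord (A k : 'I_3 -> R) (i : 'I_dimH4) : R :=
  coord basisH4 i (slice_tensor A k).

Lemma slice_coord_num i : exists U : ('I_6 -> R) -> R, polyfun U /\
  forall A k, slice_coord A k i = U (join3 A k) / slice_den A k.
Proof.
exists (fun z => coord basisH4 i (symt 4 (num4 (fst3 z) (snd3 z)))); split.
  apply: (polyfun_ext (f := fun z => \sum_u symt 4 (num4 (fst3 z) (snd3 z)) u *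
      coord basisH4 i [ffun t => (t == u)%:R])) => [z|].
    rewrite [in RHS](tensor_basis_sum (symt 4 _)) linear_sum.
    by apply: eq_bigr => u _; rewrite linearZ.
  apply: polyfun_sum => u; apply: polyfunM (polyfunC _ _).
  apply: (polyfun_ext _ (polyfun_num4 _ _ _ _)) => z.
  by rewrite ffunE.
move=> A k; rewrite fst3_join snd3_join [RHS]mulrC.
transitivity (coord basisH4 i ((slice_den A k)^-1 *: symt 4 (num4 A k))); last exact: linearZ.
congr (coord _ _ _); rewrite symtZ; apply: symt_ext => a b c _.
by rewrite mulrC -harm4_scale.
Qed.

Lemma slice_pullback (p : {mpoly R[dimH4]}) : exists N (r : {mpoly R[6]}), forall A k,
  slice_den A k != 0 -> p.@[slice_coord A k] = r.@[join3 A k] / slice_den A k ^+ N.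
Proof.
have /boolp.choice [U hU] := slice_coord_num.
have [N [r hr]] := clear_denom p (fun i => (hU i).1) (polyfun_slice_den R).
exists N, r => A k d0; have := hr (join3 A k); rewrite fst3_join snd3_join => <- //.
by apply: meval_eq => i; case: (hU i).
Qed.

(** One power of [slice_den] serves both polynomials. With the exponent [N.+1] both sides are 0 at
    the zeros of [slice_den], so the identities hold without restriction. *)
Lemma slice_pullback2 (p q : {mpoly R[dimH4]}) : exists N (p' q' : {mpoly R[6]}), forall A k,
  p'.@[join3 A k] = slice_den A k ^+ N.+1 * p.@[slice_coord A k] /\
  q'.@[join3 A k] = slice_den A k ^+ N.+1 * q.@[slice_coord A k].
Proof.
have [M [r hr]] := slice_pullback p; have [N [s hs]] := slice_pullback q.
have [d hd] := polyfun_slice_den R.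
exists (M + N)%N, (r * d ^+ N.+1), (s * d ^+ M.+1) => A k.
have := hd (join3 A k); rewrite fst3_join snd3_join !mevalM !rmorphXn /= => <-.
have [->|d0] := eqVneq (slice_den A k) 0; first by rewrite !exprS !mul0r !mulr0.
have e a i j : a * slice_den A k ^+ j.+1 =
    slice_den A k ^+ (i + j).+1 * (a / slice_den A k ^+ i).
  by rewrite -addnS exprD mulrAC [_ * (a / _)]mulrC divfK // expf_neq0.
by rewrite hr // hs //; split; [apply: e | rewrite addnC; apply: e].
Qed.

(** All T_d-images of one diagonal form are provided, since the sums in [generation] run over them.
    Each of them is a rotated copy of [h], described by [slice_coord] where the denominators do not
    vanish. *)
Lemma diag_point h : m.@[h] != 0 -> exists A k, forall t,
  invariants (point h) = to_inv (join3 (td_inv (td_act t A)) k) /\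
  (slice_den (td_act t A) k != 0 ->
    exists2 g, SO3 g & slice_coord (td_act t A) k = act_point g h).
Proof.
move=> mh; have [g gSO dH] := diagonalize_d2 (point_harmonic h).
have HH : act g (point h) \in H4 by rewrite -act_pointE // point_harmonic.
have M0 : inv_M12 (act g (point h)) != 0 by rewrite act_M12 // Em.
exists (parA (act g (point h))), (par_k (act g (point h))) => t.
have [g' [gSO' HH' dH' eA ek]] := td_rotation t HH dH M0.
rewrite -eA -ek; split.
  rewrite -(invariants_act (point h) gSO) -(invariants_act _ gSO') slice_invariants //.
  by rewrite act_M12.
move=> d0; exists (g' *m g); first exact: SO3_mul.
apply: funext => i; rewrite -[RHS]coord_point act_pointE; last exact: SO3_mul.
by rewrite -act_mul {3}(slice_rep HH' dH' d0).
Qed.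

Lemma td_act1 (A : 'I_3 -> R) : td_act (false, false, 1%g) A = A.
Proof.
apply: funext => i; rewrite /td_act /td_sign perm1 /=.
by elim/ord3P: i; rewrite /vec3 /= expr0 !mul1r.
Qed.

Lemma td_sum_inv (p : {mpoly R[6]}) : exists P : {mpoly R[6]}, forall A k,
  P.@[to_inv (join3 (td_inv A) k)] = \sum_t p.@[join3 (td_act t A) k].
Proof.
have [P hP] := td_sum p; have [Q hQ] := meval_of_inv P.
by exists Q => A k; rewrite hQ hP.
Qed.

(** The T_d-sum of the squares of [slice_den] is a nonzero polynomial in the six functions. At a
    point where it, [m] and [q] are all nonzero, some T_d-image has nonzero [slice_den]. *)
Lemma generic_orbit (q : {mpoly R[dimH4]}) : q != 0 -> exists h g A k,
  [/\ m.@[h] != 0, q.@[h] != 0, SO3 g, slice_den A k != 0 &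
      slice_coord A k = act_point g h /\
      invariants (point h) = to_inv (join3 (td_inv A) k)].
Proof.
move=> q0; have [d hd] := polyfun_slice_den R.
have [P hP] := td_sum_inv (d ^+ 2).
have dE A k : d.@[join3 A k] = slice_den A k by rewrite -hd fst3_join snd3_join.
have PE A k : P.@[to_inv (join3 (td_inv A) k)] = \sum_t slice_den (td_act t A) k ^+ 2.
  by rewrite hP; apply: eq_bigr => t _; rewrite rmorphXn /= dE.
have P0 : rateval inv_frac P != 0.
  apply: contraTneq isT => /invariants_independent P0.
  have [A [k [d0 _]]] := slice_witness R.
  have /esym/eqP := PE A k; rewrite P0 meval0 psumr_eq0 => [|t _]; last exact: sqr_ge0.
  move/allP => /(_ (false, false, 1%g) (mem_index_enum _)).
  by rewrite /= td_act1 expf_eq0 /= (negbTE d0).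
have [h [mh qh Ph]] := specializes_neq0 m0 (specializes_rateval P) P0 q0.
have [A [k hA]] := diag_point mh.
have [t dt] : exists t, slice_den (td_act t A) k != 0.
  apply/existsP; apply: contraNT Ph; rewrite negb_exists => /forallP d0.
  rewrite (hA (false, false, 1%g)).1 td_act1 PE big1 // => t _.
  by have := d0 t; rewrite negbK => /eqP ->; rewrite expr0n.
have [ei /(_ dt) [g gSO eg]] := hA t.
by exists h, g, (td_act t A), k; split.
Qed.

Lemma generation (f : K) : rational_invariant f -> exists P Q : {mpoly R[6]},
  rateval inv_frac Q != 0 /\ f = rateval inv_frac P / rateval inv_frac Q.
Proof.
rewrite [f]fraction_numden; set p := \n_(repr f); set q := \d_(repr f).
have q0 : q != 0 by exact: denom_ratioP.
move/(rational_invariantP _ q0) => inv.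
have [h0 [g0 [A0 [k0 [mh0 qh0 gSO0 d0 [e0 eI0]]]]]] := generic_orbit q0.
have gT0 := SO3_tr gSO0.
(* The polynomial [q] is not invariant and could vanish on the whole slice. Translating [p] and [q]
   by the inverse of [g0] makes the denominator nonzero at the slice point of [h0]. *)
have [N [p' [q' pq']]] := slice_pullback2 (act_poly g0^T p) (act_poly g0^T q).
have [P hP] := td_sum_inv (p' * q'); have [Q hQ] := td_sum_inv (q' * q').
(* At a slice point q' ^+ 2 is nonnegative on the whole T_d-orbit, hence Q != 0. *)
exists P, Q.
have Q0 : rateval inv_frac Q != 0.
  apply/eqP => /(iffLR (specializes_eq0 m0 (specializes_rateval Q))) /(_ h0 mh0) /eqP.
  rewrite eI0 hQ psumr_eq0 => [/allP /(_ (false, false, 1%g) (mem_index_enum _))|t _].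
    rewrite /= td_act1 mevalM mulf_eq0 orbb (pq' A0 k0).2 mulf_eq0 expf_eq0 (negbTE d0) /=.
    by rewrite meval_act_poly e0 (act_pointK _ gSO0) (negbTE qh0).
  by rewrite mevalM -expr2 sqr_ge0.
split=> //.
have qF0 : q%:F != 0 :> K by rewrite tofrac_eq0.
apply/eqP; rewrite eqr_div //; apply/eqP.
apply: (specializes_inj m0 (specializesM (specializes_poly m p) (specializes_rateval Q))).
have [M [r [-> hr]]] := specializesM (specializes_rateval P) (specializes_poly m q).
exists M, r; split=> // h mh; rewrite -hr //.
have [A [k hA]] := diag_point mh.
(* The identity p Q = P q at [h] holds term by term in the sums over T_d. *)
rewrite (hA (false, false, 1%g)).1 td_act1 hP hQ mulr_sumr mulr_suml.
apply: eq_bigr => t _; rewrite !mevalM (pq' _ _).1 (pq' _ _).2.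
have [->|dt] := eqVneq (slice_den (td_act t A) k) 0.
  by rewrite !exprS !mul0r !mulr0.
have [_ /(_ dt) [g gSO ->]] := hA t.
(* The translated polynomials are read at the image x of [h] under a rotation, and invariance gives
   p(x) q(h) = p(h) q(x). *)
rewrite !meval_act_poly; have := inv _ (SO3_mul gT0 gSO) h.
have -> : act_point (g0^T *m g) h = act_point g0^T (act_point g h).
  apply: funext => i; rewrite -[LHS]coord_point -[RHS]coord_point.
  by rewrite !act_pointE ?act_mul //; apply: SO3_mul.
move: (act_point _ _) (slice_den _ _) => x d e.
set a := d ^+ _; transitivity (a * a * q.@[x] * (p.@[h] * q.@[x])); first by ring.
by rewrite -e; ring.
Qed.

End WithM12.
End Main.

Theorem theoremB3 (R : realType) :
  let H := generic R in
  let v := tnth [tuple inv_i2 H; inv_i3 H; inv_i4 H;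
                       inv_k4 H; inv_k8 H; inv_k9 H] in
  generates_invariants v /\ alg_independent v.
Proof.
have [m [Hm Em]] := M12_frac R.
split; last exact: (invariants_independent Hm Em).
split; first exact: (inv_frac_invariant Hm Em).
exact: (generation Hm Em).
Qed.
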